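(* Let $X$ be a compact Riemann surface, $c_1,\dots,c_n\in X$ distinct points, and $q$ a meromorphic section of $K_X^4$ with $\operatorname{div}(q)=\sum_im_ic_i$, $m_i>-4$, and rotational holonomy $\rho$. Let $e\ge1$ with $e\mid4$. Then $q=\eta^{e}$ for a meromorphic section $\eta$ of $K_X^{4/e}$ if and only if $\operatorname{im}\rho\subseteq e\mathbb{Z}_4$. Consequently, if $d\in\{1,2,4\}$ generates $\operatorname{im}\rho$ (i.e. $\operatorname{im}\rho=d\mathbb{Z}_4$) then $q=\eta^{d}$ for a primitive $(4/d)$-differential $\eta$ with $\operatorname{div}(\eta)=\sum_i (m_i/d)c_i$; and conversely, for a primitive $(4/d)$-differential $\eta$ with divisor $\sum_i(m_i/d)c_i$, the $4$-differential $\eta^{d}$ has rotational holonomy with image exactly $d\mathbb{Z}_4$.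
   Context: $\mathbb{Z}_4=\mathbb{Z}/4\mathbb{Z}$ is identified with the fourth roots of unity via $k\mapsto i^k$; its subgroups are $d\mathbb{Z}_4$, $d\in\{1,2,4\}$, with $4\mathbb{Z}_4=0$. $K_X$ is the canonical bundle; a $k$-differential is a nonzero meromorphic section of $K_X^k$, and it is primitive if it is not the $e$-th power of a $(k/e)$-differential for any $e>1$ dividing $k$ (every abelian differential, $k=1$, is primitive). The rotational holonomy of $q$ is the homomorphism $\rho\colon H_1(X\setminus\{c_1,\dots,c_n\};\mathbb{Z})\to\mathbb{Z}_4$ given by the monodromy of the local fourth roots of $q$: continuing a local fourth root along $\gamma$ multiplies it by $i^{\rho(\gamma)}$. (Equivalently it is the rotational holonomy of the flat cone metric $|q|^{1/2}$.) *)

(* Defs.v *)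
From HB Require Import structures.
From mathcomp Require Import all_boot all_order all_algebra.
From mathcomp Require Import complex.
From mathcomp Require Import all_classical all_reals all_analysis.
From mathcomp Require Import freeg.

Set Implicit Arguments.
Unset Strict Implicit.
Unset Printing Implicit Defensive.

Import Order.TTheory GRing.Theory Num.Theory.
Import numFieldNormedType.Exports.

Local Open Scope classical_set_scope.
Local Open Scope quotient_scope.
Local Open Scope ring_scope.

(* Barycentric coordinates. *)
Definition simplex (R : realType) (n : nat) : set 'rV[R]_n.+1 :=
  [set x | (forall i, 0 <= x 0 i) /\ \sum_i x 0 i = 1].
Arguments simplex : clear implicits.

Lemma vertex_subproof (R : realType) (n : nat) (i : 'I_n.+1) :
  (delta_mx 0 i : 'rV[R]_n.+1) \in simplex R n.
Proof.
apply/mem_set; split=> [j|]; first by rewrite mxE ler0n.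
rewrite (bigD1 i) //= big1 => [|j ji]; rewrite mxE ?eqxx ?addr0 //.
by rewrite (negbTE ji).
Qed.

Definition vertex (R : realType) (n : nat) (i : 'I_n.+1) : simplex R n :=
  SigSub (vertex_subproof R i).

(* The i-th face map inserts a zero coordinate at position i. *)
Definition face_mx (R : realType) (n : nat) (i : 'I_n.+2) (x : 'rV[R]_n.+1) :
  'rV[R]_n.+2 := \row_j oapp (x 0) 0 (unlift i j).

Lemma face_subproof (R : realType) (n : nat) (i : 'I_n.+2) (x : simplex R n) :
  face_mx i (set_val x) \in simplex R n.+1.
Proof.
have [x0 x1] := set_valP x.
apply/mem_set; split=> [j|]; first by rewrite mxE; case: unliftP => /=.
rewrite (bigD1_ord i) //= mxE unlift_none add0r -[RHS]x1.
by apply: eq_bigr => j _; rewrite mxE liftK.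
Qed.

Definition face_fun (R : realType) (n : nat) (i : 'I_n.+2) (x : simplex R n) :
  simplex R n.+1 := SigSub (face_subproof i x).

Lemma face_continuous (R : realType) (n : nat) (i : 'I_n.+2) :
  continuous (@face_fun R n i).
Proof.
apply: continuous_comp_initial => x A [P xP PA].
have cv (k : 'I_n.+1) : continuous (fun y : simplex R n => set_val y 0 k).
  move=> y; apply: (@continuous_comp _ _ _ set_val (fun M : 'rV[R]_n.+1 => M 0 k)).
    exact: initial_continuous.
  exact: coord_continuous.
have xF := nbhs_filter x.
have : nbhs x [set y | forall j, P 0 j (face_mx i (set_val y) 0 j)].
  apply: (@filter_forall _ _ (fun j y => P 0 j (face_mx i (set_val y) 0 j))
    _ xF) => j; have := xP 0 j.
  rewrite /= set_valE /face_mx mxE; case: unliftP => [k ->|->] /= Pj.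
    apply: (@filterS _ _ xF _ _ _ (cv k x _ Pj)) => y /=.
    by rewrite mxE liftK.
  apply: (@nearW _ _ _ xF) => y.
  by rewrite mxE unlift_none; exact: nbhs_singleton Pj.
by apply: (@filterS _ _ xF) => y Py; apply: PA => a b; rewrite (ord1 a); exact: Py.
Qed.

Definition face (R : realType) (n : nat) (i : 'I_n.+2) :
  continuousType (simplex R n) (simplex R n.+1) :=
  mkcts (@face_continuous R n i).

Definition singular (R : realType) (n : nat) (Y : topologicalType) :=
  continuousType (simplex R n) Y.

Definition chain (R : realType) (n : nat) (Y : topologicalType) :=
  {freeg (singular R n Y) / int}.

Definition bd_singular (R : realType) (n : nat) (Y : topologicalType)
  (s : singular R n.+1 Y) : chain R n Y :=
  \sum_(i < n.+2) << (-1) ^+ i *g (s \o face R i : singular R n Y) >>.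

Definition bd (R : realType) (n : nat) (Y : topologicalType) :
  chain R n.+1 Y -> chain R n Y := fglift (@bd_singular R n Y).

Lemma bd_is_zmod_morphism (R : realType) (n : nat) (Y : topologicalType) :
  zmod_morphism (@bd R n Y).
Proof. exact: lift_is_additive. Qed.

HB.instance Definition _ (R : realType) (n : nat) (Y : topologicalType) :=
  GRing.isZmodMorphism.Build _ _ (@bd R n Y) (@bd_is_zmod_morphism R n Y).

Definition is_cycle1 (R : realType) (Y : topologicalType) : {pred chain R 1 Y} :=
  fun z => bd z == 0.

Lemma is_cycle1_closed (R : realType) (Y : topologicalType) :
  zmod_closed (@is_cycle1 R Y).
Proof.
split=> [|y z]; rewrite /is_cycle1 !unfold_in ?raddf0 //.
by move=> /eqP y0 /eqP z0; rewrite raddfB /= y0 z0 subrr.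
Qed.

HB.instance Definition _ (R : realType) (Y : topologicalType) :=
  GRing.isZmodClosed.Build _ (@is_cycle1 R Y) (@is_cycle1_closed R Y).

Record cycle1 (R : realType) (Y : topologicalType) := Cycle1 {
  cycle1_val :> chain R 1 Y;
  cycle1_valP : cycle1_val \in @is_cycle1 R Y
}.

HB.instance Definition _ (R : realType) (Y : topologicalType) :=
  [isSub for @cycle1_val R Y].
HB.instance Definition _ (R : realType) (Y : topologicalType) :=
  [Choice of cycle1 R Y by <:].
HB.instance Definition _ (R : realType) (Y : topologicalType) :=
  [SubChoice_isSubZmodule of cycle1 R Y by <:].

Definition is_boundary1 (R : realType) (Y : topologicalType) :
  {pred cycle1 R Y} := fun z => `[< exists b : chain R 2 Y, bd b = val z >].

Lemma is_boundary1_closed (R : realType) (Y : topologicalType) :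
  zmod_closed (@is_boundary1 R Y).
Proof.
split=> [|y z]; rewrite !unfold_in.
  by apply/asboolP; exists 0; rewrite !raddf0.
move=> /asboolP[b yb] /asboolP[b' zb]; apply/asboolP; exists (b - b').
by rewrite !raddfB /= yb zb.
Qed.

HB.instance Definition _ (R : realType) (Y : topologicalType) :=
  GRing.isZmodClosed.Build _ (@is_boundary1 R Y) (@is_boundary1_closed R Y).

Definition homology1 (R : realType) (Y : topologicalType) : zmodType :=
  Quotient.quot (@is_boundary1 R Y).

Lemma simplex0P (R : realType) (x : simplex R 0) : set_val x = 1%:M.
Proof.
have [_] := set_valP x; rewrite big_ord1 => x1.
by apply/rowP => i; rewrite mxE (ord1 i) /= set_valE.
Qed.

Lemma face_vertex (R : realType) (i : 'I_2) (x : simplex R 0) :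
  face R i x = vertex R (rev_ord i).
Proof.
apply: val_inj; apply/rowP => j; rewrite /= simplex0P !mxE eqxx /=.
case: unliftP => [k ->|->] /=; rewrite ?(ord1 k) ?mxE.
  by case: i => [[|[|]]].
by case: i => [[|[|]]].
Qed.

Lemma loop_is_cycle1 (R : realType) (Y : topologicalType) (g : singular R 1 Y) :
  g (vertex R 0) = g (vertex R 1) -> << g >> \in @is_cycle1 R Y.
Proof.
move=> g01; rewrite unfold_in /is_cycle1 /bd liftU scale1r /bd_singular.
rewrite big_ord_recl big_ord1 /= expr0 expr1.
set s := (_ \o _ : singular _ _ _); set t := (_ \o _ : singular _ _ _).
have -> : s = t.
  apply/continuousEP => x; rewrite /s /t /= !face_vertex.
  have -> : rev_ord 0 = 1 :> 'I_2 by apply: val_inj.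
  by have -> : rev_ord (fintype.lift 0 0) = 0 :> 'I_2 by apply: val_inj.
by rewrite freegUD subrr freegU0.
Qed.

Definition loop_class (R : realType) (Y : topologicalType) (g : singular R 1 Y)
  (g01 : g (vertex R 0) = g (vertex R 1)) : homology1 R Y :=
  \pi_(Quotient.quot (@is_boundary1 R Y)) (Cycle1 (loop_is_cycle1 g01)).

(* As a [numClosedFieldType], the complex numbers over [R] get the norm topology
   of [numFieldNormedType]; [derivable f z 1] is complex differentiability. *)
Definition C (R : realType) : numClosedFieldType := complex R.

Record compact_riemann_surface (R : realType) (X : topologicalType) :=
  CompactRiemannSurface {
  chart_index : Type;
  dom : chart_index -> set X;
  chart : chart_index -> X -> C R;
  param : chart_index -> C R -> X;
  surface_compact : compact [set: X];
  surface_hausdorff : hausdorff_space X;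
  surface_connected : connected [set: X];
  surface_nonempty : [set: X] !=set0;
  dom_open : forall i, open (dom i);
  dom_cover : forall x, exists i, dom i x;
  codom_open : forall i, open (chart i @` dom i);
  chartK : forall i x, dom i x -> param i (chart i x) = x;
  chart_continuous : forall i x, dom i x -> {for x, continuous (chart i)};
  param_continuous : forall i x, dom i x ->
    {for chart i x, continuous (param i)};
  transition_holomorphic : forall i j x, dom i x -> dom j x ->
    derivable (chart j \o param i) (chart i x) 1
}.

Section Differentials.
Context (R : realType) (X : topologicalType) (S : compact_riemann_surface R X).

(* [s i x] is the coefficient at [x] of a section of a power of the canonical
   bundle in the chart [i], i.e. the section is [s i (dz_i)^k]. Only the values
   [s i x] with [dom i x] are meaningful. *)
Definition section := chart_index S -> X -> C R.

Definition transforms (k : nat) (s : section) (x : X) :=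
  forall i j, dom i x -> dom j x ->
    s i x = s j x * ('D_1 (chart j \o param i) (chart i x)) ^+ k.

Definition local_expr (s : section) (i : chart_index S) : C R -> C R :=
  s i \o param i.

(* Since [0^-1 = 0], this forces [f a = 0] when [m < 0] and [f] to be holomorphic
   at [a] when [0 <= m]: meromorphic functions are represented by total functions
   with the value 0 at the poles, so that they are equal iff pointwise equal. *)
Definition order_at (f : C R -> C R) (a : C R) (m : int) :=
  exists g : C R -> C R, [/\ \forall z \near a, derivable g z 1, g a != 0 &
    \forall z \near a, f z = (z - a) ^ m * g z].

Definition meromorphic_at (f : C R -> C R) (a : C R) :=
  (\forall z \near a, f z = 0) \/ exists m, order_at f a m.

Definition meromorphic_section (k : nat) (s : section) :=
  forall x, transforms k s x /\
    forall i, dom i x -> meromorphic_at (local_expr s i) (chart i x).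

Definition section_eq (s t : section) :=
  forall i x, dom i x -> s i x = t i x.

Definition section_pow (s : section) (e : nat) : section :=
  fun i x => s i x ^+ e.

Definition differential (k : nat) (s : section) :=
  meromorphic_section k s /\ exists i x, dom i x /\ s i x != 0.

Definition primitive (k : nat) (s : section) :=
  forall e, (1 < e)%N -> (e %| k)%N ->
    ~ exists t, differential (k %/ e) t /\ section_eq s (section_pow t e).

Definition has_divisor (s : section) (D : X -> int) :=
  forall x i, dom i x -> order_at (local_expr s i) (chart i x) (D x).

(* The divisor [\sum_i m_i c_i], as a function on points. *)
Definition point_divisor (n : nat) (c : 'I_n -> X) (m : 'I_n -> int) (x : X) : int :=
  \sum_(i < n | c i == x) m i.

Definition local_fourth_root (q w : section) (x : X) :=
  \forall y \near x, transforms 1 w y /\ forall i, dom i y ->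
    derivable (local_expr w i) (chart i y) 1 /\ w i y ^+ 4 = q i y.

Definition germ_eq (s t : section) (x : X) :=
  \forall y \near x, forall i, dom i y -> s i y = t i y.

Context (n : nat) (c : 'I_n -> X).

Definition punctured : set X := ~` range c.

(* Analytic continuation of a fourth root of [q] along [g]: a locally constant
   choice of germs [w t] at [g t], [t] ranging over the 1-simplex. *)
Definition continues_fourth_root (q : section) (g : singular R 1 punctured)
  (w : simplex R 1 -> section) :=
  forall t, local_fourth_root q (w t) (set_val (g t)) /\
    \forall u \near t, germ_eq (w u) (w t) (set_val (g u)).

(* [g] is a loop from [vertex R 0] to [vertex R 1]; the identification of [Z_4]
   with the fourth roots of unity is [k |-> 'i ^+ k]. *)
Definition rotational_holonomy (q : section)
  (rho : {additive homology1 R punctured -> 'Z_4}) :=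
  forall (g : singular R 1 punctured) (g01 : g (vertex R 0) = g (vertex R 1))
    (w : simplex R 1 -> section), continues_fourth_root q g w ->
    germ_eq (w (vertex R 1))
      (fun i y => 'i ^+ (rho (loop_class g01)) * w (vertex R 0) i y)
      (set_val (g (vertex R 0))).

End Differentials.

(* The subgroup [d Z_4] of [Z_4]. *)
Definition mulZ4 (d : nat) : set 'Z_4 := range (fun k : 'Z_4 => k *+ d).

(* Main.v *)
From HB Require Import structures.
From mathcomp Require Import freeg.
Require Import Defs.
From mathcomp Require Import all_boot all_order all_algebra.
From mathcomp Require Import complex.
From mathcomp Require Import all_classical all_reals all_analysis.
From mathcomp Require Import ring lra.
Set Implicit Arguments.
Unset Strict Implicit.
Unset Printing Implicit Defensive.
Import Order.TTheory GRing.Theory Num.Theory.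
Import numFieldNormedType.Exports.
Local Open Scope classical_set_scope.
Local Open Scope quotient_scope.
Local Open Scope ring_scope.

(** Away from its zeros and poles, [q] has four local holomorphic fourth roots,
    and continuing a root along a path permutes them.  An [e]-th root of [q]
    restricts to a single-valued choice of [w ^ (4 / e)], where [w] is a local
    fourth root; since [w] changes by [i ^ k] around a loop of rotation [k],
    such a choice exists iff [e] divides every [k].  This is [holonomy_range]
    in one direction and [global_root_pow], [global_root_meromorphic] in the
    other.  Everything else in the statement follows: primitivity of the root
    because a further root would shrink the image of the holonomy
    ([primitive_of_holonomy]), and the converse because a smaller image would
    give a root of higher order, which is proportional to a root of the given
    differential by connectedness of the surface ([proportional]).

    The topology is isolated in a combinatorial description of the covering of
    fourth roots.  Choosing one root [r y] at each point [y], the germ of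
    [r y0] near [y0] is [i ^ T y0 y] times [r y], and the function [T] is a
    cocycle near the diagonal, called [local_system] below.  Continuations along
    maps from simplices become functions into [Z_4] that vary according to [T].
    They exist by subdivision ([lift_box]), which makes the holonomy of a path a
    1-cochain that vanishes on boundaries; it therefore induces a homomorphism
    on homology ([monodromy_exists]).  As every class is a combination of loops
    ([homology1_loop_ind]), knowing the holonomy on loops is enough.
    Conversely, a homomorphism with values in a subgroup lets one readjust the
    roots [r y] so that the cocycle itself takes values in that subgroup
    ([monodromy_potential]).

    On the analytic side the proof uses no integration.  Local roots are
    written down with square roots close to 1 ([holomorphic_root4]).  To move a
    local root from one chart to another one needs the derivative of a
    transition map to be continuous; its fourth power is a quotient of
    coefficients of [q], and among the four candidate branches the derivative
    cannot jump, by the intermediate value property of real derivatives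
    ([derive_continuous]).  At a puncture, a root on the punctured disc extends
    with the expected order because an odd power of [z] has no continuous
    square root around 0: comparing a root at [z] and at [- z] gives a contradiction
    ([disc_no_odd_sqrt], [puncture_root]). *)

(** * Locally constant functions and subdivision of intervals *)

Lemma connected_locally_constant (Z : topologicalType) (K : set Z) (A : Type)
    (k : Z -> A) :
  connected K -> (forall z, K z -> \forall u \near z, K u -> k u = k z) ->
  forall x y, K x -> K y -> k y = k x.
Proof.
move=> Kc kc x y Kx Ky.
have eqK : K `&` [set z | k z = k x] = K.
  apply: Kc; first by exists x.
  - exists (interior [set z | K z -> k z = k x]); first exact: open_interior.
    apply/seteqP; split=> z /= [Kz kz]; split=> //.
      by apply: filterS (kc z Kz) => u /= h Ku; rewrite h.
    by have /= := nbhs_singleton kz; exact.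
  - exists (~` interior [set z | K z -> k z <> k x]).
      exact/open_closedC/open_interior.
    apply/seteqP; split=> z /= [Kz kz]; split=> //.
      by move=> /nbhs_singleton; apply.
    apply: contrapT => kzx; apply: kz.
    by apply: filterS (kc z Kz) => u /= h Ku; rewrite h.
by move: Ky; rewrite -{1}eqK => -[].
Qed.

(** Real induction on pairs of endpoints: the truth value of [Q a x] is a
    locally constant function of [x], hence constant. *)
Lemma interval_induction (R : realType) (Q : R -> R -> Prop) (a b : R) :
  a <= b ->
  (forall x y z, a <= x -> x <= y -> y <= z -> z <= b -> Q x z -> Q x y) ->
  (forall x y z, a <= x -> x <= y -> y <= z -> z <= b ->
    Q x y -> Q y z -> Q x z) ->
  (forall t, a <= t -> t <= b -> exists2 e : R, 0 < e & forall x y,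
    a <= x -> x <= y -> y <= b -> `|x - t| < e -> `|y - t| < e -> Q x y) ->
  Q a b.
Proof.
move=> ab sub glue loc.
have Qaa : Q a a.
  by have [e e0] := loc a (lexx a) ab; apply; rewrite ?subrr ?normr0.
have cst := @connected_locally_constant R `[a, b] Prop (Q a)
  (@segment_connected _ a b).
rewrite (cst _ a b) ?Qaa //=; rewrite ?in_itv /= ?lexx ?ab //.
move=> t; rewrite /= in_itv /= => /andP[at_ tb].
have [e e0 he] := loc t at_ tb.
have : \forall u \near t, `|u - t| < e.
  by apply: filterS (nbhsx_ballx t e e0) => u /=; rewrite /ball /= distrC.
apply: filterS => u ut; rewrite in_itv /= => /andP[au ub].
have tt : `|t - t| < e by rewrite subrr normr0.
apply/propext; have [tu|/ltW ut'] := leP t u; split.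
- exact: (sub a t u).
- by move=> Qat; apply: (glue a t u) => //; exact: he.
- by move=> Qau; apply: (glue a u t) => //; exact: he.
- exact: (sub a u t).
Qed.

(** * Lifting maps to local systems *)

Section LocalSystem.
Variables (Y : topologicalType) (A : comNzRingType) (T : Y -> Y -> A).

(** For a covering with simply transitive action of [A] and a chosen point in
    each fibre, [T y0 y] is the difference at [y] between the local section
    through the chosen point over [y0] and the chosen point over [y].  The
    condition is the cocycle relation near the diagonal. *)
Definition local_system := forall y0 : Y, \forall y1 \near y0,
  \forall y2 \near y1, T y0 y2 = T y0 y1 + T y1 y2.

(** The value [k z] stands for the point of the fibre over [f z] that lies at
    distance [k z] from the chosen one; the equation says that these points form
    a continuous lift of [f] to the covering. *)
Definition lift_on (Z : topologicalType) (f : Z -> Y) (K : set Z) (k : Z -> A) :=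
  forall z, K z -> \forall u \near z, K u -> k u = k z + T (f z) (f u).

Lemma lift_subset (Z : topologicalType) (f : Z -> Y) (K L : set Z) k :
  L `<=` K -> lift_on f K k -> lift_on f L k.
Proof. by move=> LK lk z /LK /lk; apply: filterS => u + /LK. Qed.

Lemma lift_comp (Z Z' : topologicalType) (f : Z -> Y) (g : Z' -> Z)
    (K : set Z) (L : set Z') k :
  continuous g -> (forall z, L z -> K (g z)) -> lift_on f K k ->
  lift_on (f \o g) L (k \o g).
Proof.
move=> gc LK lk z Lz; have := gc z _ (lk _ (LK _ Lz)).
by rewrite /= /nbhs /=; apply: filterS => u /= h /LK.
Qed.

(** Two lifts differ by a locally constant function. *)
Lemma lift_unique (Z : topologicalType) (f : Z -> Y) (K : set Z) k k' :
  connected K -> lift_on f K k -> lift_on f K k' ->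
  forall z z', K z -> K z' -> k z' - k z = k' z' - k' z.
Proof.
move=> Kc lk lk' z z' Kz Kz'.
have /(_ _ _ Kz Kz') : forall z z', K z -> K z' -> k' z' - k z' = k' z - k z.
  apply: (connected_locally_constant Kc) => u Ku.
  apply: filterS2 (lk u Ku) (lk' u Ku) => v h h' Kv.
  by rewrite h // h' // opprD addrACA subrr addr0.
by move=> h; rewrite -[k' z'](subrK (k z')) h; ring.
Qed.

Lemma lift_shift (Z : topologicalType) (f : Z -> Y) (K : set Z) k a :
  lift_on f K k -> lift_on f K (fun z => a + k z).
Proof.
by move=> lk z Kz; apply: filterS (lk z Kz) => u /= h Ku; rewrite h // addrA.
Qed.

Hypothesis TP : local_system.

Lemma local_system_self y : T y y = 0.
Proof.
have /eqP := nbhs_singleton (nbhs_singleton (TP y)).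
by rewrite -subr_eq0 opprD addrA subrr sub0r oppr_eq0 => /eqP.
Qed.

Lemma lift_local (Z : topologicalType) (f : Z -> Y) z : continuous f ->
  \forall u \near z, \forall v \near u, T (f z) (f v) = T (f z) (f u) + T (f u) (f v).
Proof.
move=> fc; have := fc z _ (TP (f z)); rewrite /nbhs /=.
by apply: filterS => u /= /(fc u).
Qed.

(** A constant correction of the second lift makes both agree at one point of the
    intersection, and hence on all of it because it is connected. *)
Lemma lift_glue (Z : topologicalType) (f : Z -> Y) (K L : set Z) k l :
  continuous f -> closed K -> closed L -> connected (K `&` L) ->
  K `&` L !=set0 -> lift_on f K k -> lift_on f L l ->
  exists m, lift_on f (K `|` L) m.
Proof.
move=> fc Kcl Lcl KLc [p [Kp Lp]] lk ll.
pose l' z := (k p - l p) + l z.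
have ll' : lift_on f L l' := lift_shift _ ll.
have kl' z : K z -> L z -> k z = l' z.
  move=> Kz Lz.
  have := @lift_unique _ f (K `&` L) k l' KLc
    (lift_subset (@subIsetl _ K L) lk) (lift_subset (@subIsetr _ K L) ll') p z.
  move=> /(_ (conj Kp Lp) (conj Kz Lz)); rewrite /l' => h.
  by rewrite -[k z](subrK (k p)) h /l'; ring.
exists (fun z => if pselect (K z) then k z else l' z) => z KLz.
have nearC (M : set Z) : closed M -> ~ M z -> \forall u \near z, ~ M u.
  by move=> Mcl Mz; apply: open_nbhs_nbhs; split=> //; exact: closed_openC.
case: (pselect (K z)) => [Kz|nKz]; have [Lz|nLz] := pselect (L z).
- apply: filterS2 (lk z Kz) (ll' z Lz) => u h h' KLu.
  case: pselect => [/h //|nKu]; case: KLu => // Lu.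
  by rewrite (kl' z) //; exact: h'.
- apply: filterS2 (lk z Kz) (nearC L Lcl nLz) => u h Lu [] // Ku.
  by case: (pselect (K u)) => [Ku'|/(_ Ku)//]; exact: h.
- apply: filterS2 (ll' z Lz) (nearC K Kcl nKz) => u h nKu [] // Lu.
  by case: (pselect (K u)) => [/nKu //|nKu']; exact: h.
- by case: KLz.
Qed.

End LocalSystem.

Lemma continuous_at_pair (Z Z1 Z2 : topologicalType) (f : Z -> Z1) (g : Z -> Z2) z :
  {for z, continuous f} -> {for z, continuous g} ->
  {for z, continuous (fun u => (f u, g u))}.
Proof.
by move=> fc gc; exact: (@cvg_pair _ _ _ (nbhs z) (nbhs (f z)) (nbhs (g z))).
Qed.

Section Square.
Variables (R : realType).

Definition box (a b c d : R) : set (R * R) :=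
  [set p | [/\ a <= p.1, p.1 <= b, c <= p.2 & p.2 <= d]].

Lemma closed_box a b c d : closed (box a b c d).
Proof.
have -> : box a b c d = (fst @^-1` `[a, b]) `&` (snd @^-1` `[c, d]).
  apply/seteqP; split=> p /=; rewrite !in_itv /=.
    by move=> [-> -> -> ->].
  by move=> [/andP[? ?] /andP[? ?]].
refine (@closedI _ (fst @^-1` `[a, b]%classic) (snd @^-1` `[c, d]%classic) _ _).
  apply: (proj1 (continuous_closedP (@fst R R))); last exact: itv_closed.
  by move=> p; exact: cvg_fst.
apply: (proj1 (continuous_closedP (@snd R R))); last exact: itv_closed.
by move=> p; exact: cvg_snd.
Qed.

Lemma connected_hsegment a b d : connected (box a b d d).
Proof.
have -> : box a b d d = (fun x => (x, d)) @` `[a, b].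
  apply/seteqP; split=> -[x y] /=.
    move=> [/= ax xb dy yd]; exists x; first by rewrite in_itv /= ax.
    by congr pair; apply/le_anti; rewrite dy.
  by move=> [x' + [<- <-]]; rewrite in_itv /= => /andP[? ?]; split=> /=.
apply: connected_continuous_connected; first exact: segment_connected.
apply: continuous_subspaceT => x.
by apply: continuous_at_pair; [exact: cvg_id|exact: cvg_cst].
Qed.

Lemma connected_vsegment b c d : connected (box b b c d).
Proof.
have -> : box b b c d = (fun x => (b, x)) @` `[c, d].
  apply/seteqP; split=> -[x y] /=.
    move=> [/= bx xb cy yd]; exists y; first by rewrite in_itv /= cy.
    by congr pair; apply/le_anti; rewrite bx.
  by move=> [x' + [<- <-]]; rewrite in_itv /= => /andP[? ?]; split=> /=.
apply: connected_continuous_connected; first exact: segment_connected.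
apply: continuous_subspaceT => x.
by apply: continuous_at_pair; [exact: cvg_cst|exact: cvg_id].
Qed.

Variables (Y : topologicalType) (A : comNzRingType) (T : Y -> Y -> A).
Hypothesis TP : local_system T.

(** Two interval inductions: the inner one, in the second variable, produces lifts
    on a thin strip around each vertical segment, and the outer one joins the
    strips. *)
Lemma lift_box (f : R * R -> Y) a b c d : continuous f -> a <= b -> c <= d ->
  exists k, lift_on T f (box a b c d) k.
Proof.
move=> fc ab cd.
have locb t s : exists2 e : R, 0 < e & forall x y x' y',
    `|x - t| < e -> `|y - t| < e -> `|x' - s| < e -> `|y' - s| < e ->
    exists k, lift_on T f (box x y x' y') k.
  have [[U V] /= [Ut Vs] UV] := lift_local TP (t, s) fc.
  move: Ut Vs => /nbhs_ballP[e1 /= e10 e1U] /nbhs_ballP[e2 /= e20 e2V].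
  exists (Num.min e1 e2); first by rewrite lt_min e10.
  move=> x y x' y'; rewrite !lt_min => /andP[xt1 xt2] /andP[yt1 yt2]
    /andP[xs1 xs2] /andP[ys1 ys2].
  exists (fun z => T (f (t, s)) (f z)) => -[u v] [/= xu uy xv vy].
  have : nbhs (u, v) [set w | T (f (t, s)) (f w) =
      T (f (t, s)) (f (u, v)) + T (f (u, v)) (f w)].
    apply: (UV (u, v)); split=> /=.
      apply: e1U; rewrite /ball /= ltr_norml.
      by move: xt1 yt1; rewrite !ltr_norml => /andP[? ?] /andP[? ?];
        apply/andP; split; lra.
    apply: e2V; rewrite /ball /= ltr_norml.
    by move: xs2 ys2; rewrite !ltr_norml => /andP[? ?] /andP[? ?];
        apply/andP; split; lra.
  by apply: filterS => w h _.
pose Q x y := exists k, lift_on T f (box x y c d) k.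
apply: (@interval_induction R Q a b ab).
- move=> x y z ax xy yz zb [k lk]; exists k; apply: lift_subset lk => p.
  by move=> [h1 h2 h3 h4]; split=> //; exact: le_trans yz.
- move=> x y z ax xy yz zb [k lk] [l ll]; rewrite /Q.
  have -> : box x z c d = box x y c d `|` box y z c d.
    apply/seteqP; split=> p /=; last first.
      by case=> -[? ? ? ?]; split=> //; [exact: le_trans yz|exact: le_trans xy _].
    by move=> [? ? ? ?]; case: (lerP p.1 y) => [?|/ltW ?]; [left|right].
  apply: lift_glue lk ll => //; try exact: closed_box.
    have -> : box x y c d `&` box y z c d = box y y c d.
      apply/seteqP; split=> p /=; first by move=> [[? ? ? ?] [? ? ? ?]].
      by move=> [? ? ? ?]; split; split=> //; exact: le_trans yz || exact: le_trans xy _.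
    exact: connected_vsegment.
  by exists (y, c); split; split=> /=.
- move=> t at_ tb.
  (* Lifts over a strip of unspecified width around the vertical line at [t]. *)
  pose Q' x' y' := exists2 e : R, 0 < e & forall x y,
    `|x - t| < e -> `|y - t| < e -> x <= y -> exists k, lift_on T f (box x y x' y') k.
  suff [e e0 he] : Q' c d by exists e => // x y _ xy _ xt yt; exact: he.
  apply: (@interval_induction R Q' c d cd).
  + move=> x' y' z' _ xy yz _ [e e0 he]; exists e => // x y xt yt xy'.
    have [k lk] := he x y xt yt xy'; exists k; apply: lift_subset lk => p.
    by move=> [h1 h2 h3 h4]; split=> //; exact: le_trans yz.
  + move=> x' y' z' _ xy yz _ [e e0 he] [e' e0' he'].
    exists (Num.min e e') => [|x y]; first by rewrite lt_min e0.
    rewrite !lt_min => /andP[xt xt'] /andP[yt yt'] lexy.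
    have [k lk] := he x y xt yt lexy; have [l ll] := he' x y xt' yt' lexy.
    have -> : box x y x' z' = box x y x' y' `|` box x y y' z'.
      apply/seteqP; split=> p /=; last first.
        by case=> -[? ? ? ?]; split=> //; [exact: le_trans yz|exact: le_trans xy _].
      by move=> [? ? ? ?]; case: (lerP p.2 y') => [?|/ltW ?]; [left|right].
    apply: lift_glue lk ll => //; try exact: closed_box.
      have -> : box x y x' y' `&` box x y y' z' = box x y y' y'.
        apply/seteqP; split=> p /=; first by move=> [[? ? ? ?] [? ? ? ?]].
        by move=> [? ? ? ?]; split; split=> //; exact: le_trans yz || exact: le_trans xy _.
      exact: connected_hsegment.
    by exists (x, y'); split; split=> /=.
  + move=> s _ _; have [e e0 he] := locb t s.
    exists e => // x' y' _ _ _ xs ys; exists e => // x y xt yt _.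
    exact: he.
Qed.

End Square.

(** * Simplices as retracts of the square *)

Lemma max_continuous (R : realType) (Z : topologicalType) (f g : Z -> R) z :
  {for z, continuous f} -> {for z, continuous g} ->
  {for z, continuous (fun u => Num.max (f u) (g u))}.
Proof. by move=> fc gc; exact: (@continuous_max R Z f g z fc gc). Qed.

Lemma min_continuous (R : realType) (Z : topologicalType) (f g : Z -> R) z :
  {for z, continuous f} -> {for z, continuous g} ->
  {for z, continuous (fun u => Num.min (f u) (g u))}.
Proof. by move=> fc gc; exact: (@continuous_min R Z f g z fc gc). Qed.

Section SimplexCoordinates.
Variable R : realType.

Lemma simplex_continuous (Z : topologicalType) (n : nat) (f : Z -> simplex R n) :
  (forall j, continuous (fun z => set_val (f z) 0 j)) -> continuous f.
Proof.
move=> fc; apply: continuous_comp_initial => z B [P zP PB].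
have zF := nbhs_filter z.
have : nbhs z [set u | forall j, P 0 j (set_val (f u) 0 j)].
  apply: (@filter_forall _ _ (fun j u => P 0 j (set_val (f u) 0 j)) _ zF) => j.
  exact: fc (zP 0 j).
by apply: filterS => u Pu; apply: PB => a b; rewrite (ord1 a); exact: Pu.
Qed.

Lemma coord_simplex_continuous (n : nat) (j : 'I_n.+1) :
  continuous (fun x : simplex R n => set_val x 0 j).
Proof.
move=> y; apply: (@continuous_comp _ _ _ set_val (fun M : 'rV[R]_n.+1 => M 0 j)).
  exact: initial_continuous.
exact: coord_continuous.
Qed.

Lemma simplex_eqP (n : nat) (x y : simplex R n) :
  (forall j, set_val x 0 j = set_val y 0 j) -> x = y.
Proof. by move=> h; apply: val_inj; apply/rowP => j; exact: h. Qed.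

Lemma simplex_ge0 n (x : simplex R n) j : 0 <= set_val x 0 j.
Proof. by have [h _] := set_valP x. Qed.

Lemma simplex_sum n (x : simplex R n) : \sum_j set_val x 0 j = 1.
Proof. by have [_ h] := set_valP x. Qed.

Lemma simplex_le1 n (x : simplex R n) j : set_val x 0 j <= 1.
Proof.
rewrite -(simplex_sum x) (bigD1 j) //= lerDl sumr_ge0 // => i _.
exact: simplex_ge0.
Qed.

Definition clamp (t : R) : R := Num.max 0 (Num.min t 1).

Lemma clamp_ge0 t : 0 <= clamp t. Proof. by rewrite le_max lexx. Qed.
Lemma clamp_le1 t : clamp t <= 1.
Proof. by rewrite ge_max ler01 ge_min lexx orbT. Qed.
Lemma clampE t : 0 <= t -> t <= 1 -> clamp t = t.
Proof. by move=> t0 t1; rewrite /clamp min_l // max_r. Qed.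

Lemma clamp_continuous : continuous clamp.
Proof.
move=> t; apply: (@max_continuous R R (fun=> 0) (fun t => Num.min t 1)).
  exact: cvg_cst.
by apply: (@min_continuous R R id (fun=> 1)); [exact: cvg_id|exact: cvg_cst].
Qed.

Lemma seg_pt_subproof (t : R) :
  (\row_(j < 2) (if j == 0 then 1 - clamp t else clamp t)) \in simplex R 1.
Proof.
apply/mem_set; split=> [j|].
  rewrite mxE; case: ifP => _; last exact: clamp_ge0.
  by rewrite subr_ge0 clamp_le1.
by rewrite big_ord_recl big_ord1 !mxE /= subrK.
Qed.

(** Clamping makes the parametrisation total, so that every path extends to the
    whole line; this is what makes concatenation and reversal easy to write. *)
Definition seg_pt (t : R) : simplex R 1 := SigSub (seg_pt_subproof t).

Lemma seg_ptE t j : set_val (seg_pt t) 0 j = if j == 0 then 1 - clamp t else clamp t.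
Proof. by rewrite set_valE /= mxE. Qed.

Lemma seg_pt_continuous : continuous seg_pt.
Proof.
apply: simplex_continuous => j.
have -> : (fun t => set_val (seg_pt t) 0 j) =
    (fun t => if j == 0 then 1 - clamp t else clamp t).
  by apply/funext => t; exact: seg_ptE.
case: (j == 0); last exact: clamp_continuous.
by move=> t; apply: cvgB; [exact: cvg_cst|exact: clamp_continuous].
Qed.

Lemma simplex1_coord0 (x : simplex R 1) : set_val x 0 0 = 1 - set_val x 0 1.
Proof.
rewrite -(simplex_sum x) big_ord_recl big_ord1.
by have -> : fintype.lift ord0 ord0 = 1 :> 'I_2; [exact: val_inj|rewrite addrK].
Qed.

Lemma seg_ptK (x : simplex R 1) : seg_pt (set_val x 0 1) = x.
Proof.
apply: simplex_eqP => j; rewrite seg_ptE clampE ?simplex_ge0 ?simplex_le1 //.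
case: eqP => [->|/eqP j0]; first by rewrite simplex1_coord0.
by have -> : j = 1 by apply: val_inj; move: j j0 => [[|[|]]].
Qed.

Lemma vertex_coord n (i j : 'I_n.+1) : set_val (vertex R i) 0 j = (j == i)%:R.
Proof. by rewrite set_valE /= mxE eqxx. Qed.

Lemma seg_pt0 t : t <= 0 -> seg_pt t = vertex R 0.
Proof.
move=> t0; have ct : clamp t = 0 by rewrite /clamp max_l // ge_min t0.
by apply: simplex_eqP => -[[|[|]]] // ?; rewrite seg_ptE vertex_coord ct /= ?subr0.
Qed.

Lemma seg_pt1 t : 1 <= t -> seg_pt t = vertex R 1.
Proof.
move=> t1; have ct : clamp t = 1 by rewrite /clamp min_r // max_r.
by apply: simplex_eqP => -[[|[|]]] // ?; rewrite seg_ptE vertex_coord ct /= ?subrr.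
Qed.

Lemma connected_simplex1 : connected [set: simplex R 1].
Proof.
have -> : [set: simplex R 1] = seg_pt @` `[0, 1].
  apply/seteqP; split=> x //= _; exists (set_val x 0 1); last exact: seg_ptK.
  by rewrite /= in_itv /= simplex_ge0 simplex_le1.
apply: connected_continuous_connected; first exact: segment_connected.
exact/continuous_subspaceT/seg_pt_continuous.
Qed.

Definition tri_x1 (p : R * R) := clamp p.1.
Definition tri_x2 (p : R * R) := Num.max 0 (Num.min p.2 (1 - clamp p.1)).

Lemma tri_pt_subproof (p : R * R) :
  (\row_(j < 3) (if j == 0 then 1 - tri_x1 p - tri_x2 p
     else if j == 1 then tri_x1 p else tri_x2 p)) \in simplex R 2.
Proof.
apply/mem_set; split=> [j|].
  rewrite mxE; case: ifP => _; last case: ifP => _; last by rewrite le_max lexx.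
    by rewrite subr_ge0 ge_max subr_ge0 clamp_le1 ge_min lexx orbT.
  exact: clamp_ge0.
by rewrite !big_ord_recl big_ord0 !mxE /=; ring.
Qed.

(** By [tri_ptK], a retraction of the plane onto the triangle. *)
Definition tri_pt (p : R * R) : simplex R 2 := SigSub (tri_pt_subproof p).

Lemma tri_pt_continuous : continuous tri_pt.
Proof.
have c1 : continuous tri_x1.
  move=> p; apply: (@continuous_comp _ _ _ fst clamp); first exact: cvg_fst.
  exact: clamp_continuous.
have c2 : continuous tri_x2.
  move=> p; apply: (@max_continuous R (R * R)%type (fun=> 0)
    (fun p => Num.min p.2 (1 - clamp p.1))); first exact: cvg_cst.
  apply: (@min_continuous R (R * R)%type snd (fun p => 1 - clamp p.1)); first exact: cvg_snd.
  by apply: cvgB; [exact: cvg_cst|exact: c1].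
apply: simplex_continuous => j.
have -> : (fun t => set_val (tri_pt t) 0 j) =
    (fun p => (if j == 0 then 1 - tri_x1 p - tri_x2 p
     else if j == 1 then tri_x1 p else tri_x2 p)).
  by apply/funext => t; rewrite set_valE /= mxE.
case: (j == 0); last by case: (j == 1).
by move=> t; apply: cvgB; [apply: cvgB; [exact: cvg_cst|exact: c1]|exact: c2].
Qed.

Lemma simplex2_coord0 (x : simplex R 2) :
  set_val x 0 0 = 1 - set_val x 0 1 - set_val x 0 2.
Proof.
rewrite -(simplex_sum x) !big_ord_recl big_ord0.
have -> : fintype.lift ord0 ord0 = 1 :> 'I_3 by apply: val_inj.
have -> : fintype.lift ord0 (fintype.lift ord0 ord0) = 2 :> 'I_3 by apply: val_inj.
ring.
Qed.

Lemma tri_ptK (x : simplex R 2) : tri_pt (set_val x 0 1, set_val x 0 2) = x.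
Proof.
have x1 : tri_x1 (set_val x 0 1, set_val x 0 2) = set_val x 0 1.
  by rewrite /tri_x1 clampE ?simplex_ge0 ?simplex_le1.
have x2 : tri_x2 (set_val x 0 1, set_val x 0 2) = set_val x 0 2.
  rewrite /tri_x2 /= clampE ?simplex_ge0 ?simplex_le1 // min_l ?max_r ?simplex_ge0 //.
  by rewrite -subr_ge0 -simplex2_coord0 simplex_ge0.
apply: simplex_eqP => j; rewrite [in LHS]set_valE /= mxE x1 x2.
case: eqP => [->|/eqP j0]; first by rewrite simplex2_coord0.
case: eqP => [->//|/eqP j1].
by have -> : j = 2 by apply: val_inj; move: j j0 j1 => [[|[|[|]]]].
Qed.

End SimplexCoordinates.

(** * Holonomy of a local system along paths *)

Section SimplexLifts.
Variables (R : realType) (Y : topologicalType) (A : comNzRingType) (T : Y -> Y -> A).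
Hypothesis TP : local_system T.

(** Lifts over a retract of the square are restrictions of lifts over the
    square. *)
Lemma lift_retract (Z : topologicalType) (r : R * R -> Z) (i : Z -> R * R) (f : Z -> Y) :
  continuous r -> continuous i -> (forall z, box 0 1 0 1 (i z)) -> cancel i r ->
  continuous f -> exists k, lift_on T f setT k.
Proof.
move=> rc ic ibox iK fc.
have [k lk] : exists k, lift_on T (f \o r) (box 0 1 0 1) k.
  apply: lift_box => // p; apply: continuous_comp; [exact: rc|exact: fc].
exists (k \o i).
have -> : f = (f \o r) \o i by apply/funext => z /=; rewrite iK.
by apply: lift_comp lk.
Qed.

Lemma lift_simplex1 (s : singular R 1 Y) : exists k, lift_on T s setT k.
Proof.
apply: (@lift_retract _ (@seg_pt R \o fst) (fun x => (set_val x 0 1, 0))).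
- move=> p; apply: (@continuous_comp _ _ _ fst (@seg_pt R)).
    exact: cvg_fst.
  exact: seg_pt_continuous.
- move=> x; apply: continuous_at_pair; last exact: cst_continuous.
  exact: coord_simplex_continuous.
- by move=> x; split=> //=; rewrite ?simplex_ge0 ?simplex_le1.
- by move=> x /=; exact: seg_ptK.
- exact: cts_fun.
Qed.

Lemma lift_simplex2 (s : singular R 2 Y) : exists k, lift_on T s setT k.
Proof.
apply: (@lift_retract _ (@tri_pt R) (fun x => (set_val x 0 1, set_val x 0 2))).
- exact: tri_pt_continuous.
- by move=> x; apply: continuous_at_pair; exact: coord_simplex_continuous.
- by move=> x; split=> /=; rewrite ?simplex_ge0 ?simplex_le1.
- exact: tri_ptK.
- exact: cts_fun.
Qed.

(** By uniqueness of lifts, the choice of the lift does not matter ([holonomyE]). *)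
Definition holonomy (s : singular R 1 Y) : A :=
  let k := sval (cid (lift_simplex1 s)) in k (vertex R 1) - k (vertex R 0).

Lemma holonomyE (s : singular R 1 Y) k : lift_on T s setT k ->
  holonomy s = k (vertex R 1) - k (vertex R 0).
Proof.
rewrite /holonomy; case: cid => k' /= lk' lk.
exact: (lift_unique (@connected_simplex1 R) lk' lk).
Qed.

Lemma face_vertex_lift n (i : 'I_n.+2) (j : 'I_n.+1) :
  face R i (vertex R j) = vertex R (fintype.lift i j).
Proof.
apply: simplex_eqP => l; rewrite [in LHS]set_valE /= mxE vertex_coord.
case: unliftP => [m ->|->] /=.
  by rewrite vertex_coord (inj_eq (@lift_inj _ i)).
by rewrite (negbTE (neq_lift i j)).
Qed.

(** The holonomies of the three sides are the differences of the values at the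
    vertices of one lift over the triangle. *)
Lemma holonomy_triangle (s : singular R 2 Y) :
  \sum_(i < 3) (-1) ^+ i * holonomy (s \o face R i : singular R 1 Y) = 0.
Proof.
have [k lk] := lift_simplex2 s.
have h (i a b : 'I_3) : fintype.lift i 0 = a -> fintype.lift i 1 = b ->
    holonomy (s \o face R i : singular R 1 Y) = k (vertex R b) - k (vertex R a).
  move=> <- <-; rewrite (@holonomyE _ (k \o face R i)) /= ?face_vertex_lift //.
  by apply: (@lift_comp _ _ _ _ _ s (face R i) setT) => //; exact: cts_fun.
rewrite !big_ord_recl big_ord0.
rewrite (h ord0 1 2) //=; try exact: val_inj.
rewrite (h (fintype.lift ord0 ord0) 0 2) //=; try exact: val_inj.
rewrite (h (fintype.lift ord0 (fintype.lift ord0 ord0)) 0 1) //=; try exact: val_inj.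
by rewrite /bump /=; ring.
Qed.

End SimplexLifts.

(** * Chains and affine paths *)

Section ChainLift.
Variables (R : realType) (n : nat) (Y : topologicalType) (M : zmodType).

(** The universal property of chains for an arbitrary abelian group, viewed as a
    module over the integers through [zmodule]. *)
Definition chain_lift (f : singular R n Y -> M) : chain R n Y -> M :=
  fglift (f : singular R n Y -> zmodule M).

Lemma chain_lift_is_zmod_morphism f : zmod_morphism (chain_lift f).
Proof. exact: (@lift_is_additive _ _ (zmodule M)). Qed.

HB.instance Definition _ f :=
  GRing.isZmodMorphism.Build _ _ (chain_lift f) (chain_lift_is_zmod_morphism f).

Lemma chain_liftU f s : chain_lift f << s >> = f s.
Proof. by rewrite /chain_lift liftU scale1r. Qed.

Lemma chain_ind (P : chain R n Y -> Prop) :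
  (forall a b, P a -> P b -> P (a - b)) -> P 0 -> (forall s, P << s >>) ->
  forall z, P z.
Proof.
move=> PB P0 PU z; rewrite -(freeg_sumE z).
have PN a : P a -> P (- a) by move=> Pa; rewrite -sub0r; exact: PB.
have PD a b : P a -> P b -> P (a + b).
  by move=> Pa Pb; rewrite -[b]opprK; apply: PB => //; exact: PN.
have PM s m : P (<< s >> *~ m).
  elim/int_ind: m => [|m Pm|m Pm]; first by rewrite mulr0z.
    by rewrite -pmulrn mulrS; apply: PD.
  by rewrite mulrNz -pmulrn mulrSr opprD -mulNrn; apply: PB; rewrite ?mulNrn ?pmulrn -?mulrNz.
elim: (freeg.dom z) => [|s r IH]; first by rewrite big_nil.
rewrite big_cons; apply: PD => //.
by rewrite -[freeg.coeff s z]intz -freegU_mulz.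
Qed.

End ChainLift.

Section Homology.
Variables (R : realType) (Y : topologicalType).

Notation path := (singular R 1 Y).

Definition bounds (z : chain R 1 Y) := exists b : chain R 2 Y, bd b = z.

Lemma bounds0 : bounds 0. Proof. by exists 0; rewrite raddf0. Qed.
Lemma boundsB y z : bounds y -> bounds z -> bounds (y - z).
Proof. by move=> [b <-] [b' <-]; exists (b - b'); rewrite raddfB. Qed.
Lemma boundsD y z : bounds y -> bounds z -> bounds (y + z).
Proof. by move=> [b <-] [b' <-]; exists (b + b'); rewrite raddfD. Qed.

Lemma bdU n (s : singular R n.+1 Y) : bd << s >> = bd_singular s.
Proof. by rewrite /bd liftU scale1r. Qed.

Lemma addr_continuous (Z : topologicalType) (f g : Z -> R) :
  continuous f -> continuous g -> continuous (fun z => f z + g z).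
Proof. by move=> fc gc z; apply: cvgD; [exact: fc|exact: gc]. Qed.

Lemma mul_coord_continuous n (a : R) (j : 'I_n.+1) :
  continuous (fun x : simplex R n => a * set_val x 0 j).
Proof.
move=> x; apply: (@continuous_comp (simplex R n) R R (fun x => set_val x 0 j) ( *%R a)).
  exact: coord_simplex_continuous.
exact: mulrl_continuous.
Qed.

Section AffinePath.
Variables (g : R -> Y) (gc : continuous g).

(** The path from [g a] to [g b] obtained by running affinely along [g]. *)
Definition aff_path_fun (a b : R) (x : simplex R 1) : Y :=
  g (a * set_val x 0 0 + b * set_val x 0 1).

Lemma aff_path_continuous a b : continuous (aff_path_fun a b).
Proof.
move=> x; apply: (@continuous_comp (simplex R 1) R Y
  (fun x => a * set_val x 0 0 + b * set_val x 0 1) g); last exact: gc.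
by apply: (@addr_continuous (simplex R 1)); exact: mul_coord_continuous.
Qed.

Definition aff_path a b : path := mkcts (@aff_path_continuous a b).

Definition aff_triangle_fun (a b c : R) (x : simplex R 2) : Y :=
  g (a * set_val x 0 0 + b * set_val x 0 1 + c * set_val x 0 2).

Lemma aff_triangle_continuous a b c : continuous (aff_triangle_fun a b c).
Proof.
move=> x; apply: (@continuous_comp (simplex R 2) R Y
  (fun x => a * set_val x 0 0 + b * set_val x 0 1 + c * set_val x 0 2) g); last exact: gc.
apply: (@addr_continuous (simplex R 2)); last exact: mul_coord_continuous.
by apply: (@addr_continuous (simplex R 2)); exact: mul_coord_continuous.
Qed.

Definition aff_triangle a b c : singular R 2 Y := mkcts (@aff_triangle_continuous a b c).

(** The three affine paths are the sides of one affine triangle.  Concatenation,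
    reversal and constant paths are all instances. *)
Lemma bounds_triangle a b c :
  bounds (<< aff_path b c >> - << aff_path a c >> + << aff_path a b >>).
Proof.
exists << aff_triangle a b c >>; rewrite bdU /bd_singular !big_ord_recl big_ord0.
have face_coord (i : 'I_3) (j : 'I_2) (x : simplex R 1) :
    set_val (face R i x) 0 (fintype.lift i j) = set_val x 0 j.
  by rewrite [in LHS]set_valE /= mxE liftK.
have face_coord0 (i : 'I_3) (x : simplex R 1) : set_val (face R i x) 0 i = 0.
  by rewrite [in LHS]set_valE /= mxE unlift_none.
have fE (i : 'I_3) j k x : fintype.lift i j = k -> set_val (face R i x) 0 k = set_val x 0 j.
  by move=> <-.
have f0 (i k : 'I_3) x : i = k -> set_val (face R i x) 0 k = 0.
  by move=> <-.
have -> : (aff_triangle a b c \o face R ord0 : path) = aff_path b c.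
  apply/continuousEP => x /=; rewrite /mkcts /aff_triangle_fun /aff_path_fun.
  rewrite (f0 _ 0) ?(fE _ 0 1) ?(fE _ 1 2) ?mulr0 ?add0r //; exact: val_inj.
have -> : (aff_triangle a b c \o face R (fintype.lift ord0 ord0) : path) = aff_path a c.
  apply/continuousEP => x /=; rewrite /mkcts /aff_triangle_fun /aff_path_fun.
  rewrite (f0 _ 1) ?(fE _ 0 0) ?(fE _ 1 2) ?mulr0 ?addr0 //; exact: val_inj.
have -> : (aff_triangle a b c \o face R (fintype.lift ord0 (fintype.lift ord0 ord0)) : path)
    = aff_path a b.
  apply/continuousEP => x /=; rewrite /mkcts /aff_triangle_fun /aff_path_fun.
  rewrite (f0 _ 2) ?(fE _ 0 0) ?(fE _ 1 1) ?mulr0 ?addr0 //; exact: val_inj.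
rewrite /bump /= addr0 expr0 expr1 sqrrN expr1n addrA.
by rewrite -freegUN.
Qed.

Lemma aff_path0 a b : aff_path a b (vertex R 0) = g a.
Proof. by rewrite /= /mkcts /aff_path_fun !vertex_coord mulr1 mulr0 addr0. Qed.

Lemma aff_path1 a b : aff_path a b (vertex R 1) = g b.
Proof. by rewrite /= /mkcts /aff_path_fun !vertex_coord mulr1 mulr0 add0r. Qed.

Lemma aff_path_bary a b x : aff_path a b x = g (a + (b - a) * set_val x 0 1).
Proof. by rewrite /= /mkcts /aff_path_fun simplex1_coord0; congr g; ring. Qed.

Lemma bounds_const a : bounds << aff_path a a >>.
Proof. by have := bounds_triangle a a a; rewrite subrr add0r. Qed.

Lemma bounds_reverse a b : bounds (<< aff_path a b >> + << aff_path b a >>).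
Proof.
have := boundsD (bounds_triangle a b a) (bounds_const a).
by rewrite addrAC subrK addrC.
Qed.

End AffinePath.

Lemma path_seg_pt_continuous (s : path) : continuous (s \o @seg_pt R).
Proof.
by move=> t; apply: continuous_comp; [exact: seg_pt_continuous|exact: cts_fun].
Qed.

Lemma aff_path_seg_pt (s : path) : aff_path (@path_seg_pt_continuous s) 0 1 = s.
Proof.
by apply/continuousEP => x; rewrite aff_path_bary subr0 add0r mul1r /= seg_ptK.
Qed.

Definition glue_at (a : R) (f g : R -> Y) (t : R) := if t <= a then f t else g t.

Lemma glue_at_continuous a f g : f a = g a -> continuous f -> continuous g ->
  continuous (glue_at a f g).
Proof.
move=> fga fc gc t U; rewrite {1}/glue_at.
have [ta|ta|ta] := ltgtP t a => tU.
- have := fc t _ tU; rewrite /nbhs /=.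
  by apply: filterS2 (lt_nbhsl ta) => u ua fu; rewrite /preimage /= /glue_at ltW.
- have := gc t _ tU; rewrite /nbhs /=.
  by apply: filterS2 (lt_nbhsr ta) => u ua fu; rewrite /preimage /= /glue_at leNgt ua.
- have h1 : nbhs t (f @^-1` U) by exact: fc.
  have h2 : nbhs t (g @^-1` U).
    by apply: gc; rewrite ta -fga -ta.
  apply: filterS2 h1 h2 => u fu gu.
  by rewrite /preimage /= /glue_at; case: ifP.
Qed.

Lemma glue_atl a f g t : t <= a -> glue_at a f g t = f t.
Proof. by rewrite /glue_at => ->. Qed.

Lemma glue_atr a f g t : f a = g a -> a <= t -> glue_at a f g t = g t.
Proof.
rewrite /glue_at => fg; rewrite le_eqVlt => /predU1P[<-|]; first by rewrite lexx.
by rewrite ltNge => /negbTE ->.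
Qed.

End Homology.

(** * First homology is generated by loops *)

Section Loops.
Variables (R : realType) (Y : topologicalType).
Notation path := (singular R 1 Y).

Definition joined (y z : Y) := exists s : path, s (vertex R 0) = y /\ s (vertex R 1) = z.

Lemma shift_path_continuous (s : path) (h : R -> R) : continuous h ->
  continuous (fun t => s (seg_pt (h t))).
Proof.
move=> hc t; apply: (@continuous_comp R R Y h (s \o @seg_pt R)); first exact: hc.
exact: path_seg_pt_continuous.
Qed.

(** The path [l] follows [p], then [s], then [r] backwards; the three pieces are
    placed on the intervals from 0 to 1, 1 to 2 and 2 to 3 of one function on the
    line, so that two triangles and one reversal give the homology. *)
Lemma zigzag (p s r : path) : p (vertex R 1) = s (vertex R 0) ->
  s (vertex R 1) = r (vertex R 1) ->
  exists l : path, [/\ l (vertex R 0) = p (vertex R 0),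
    l (vertex R 1) = r (vertex R 0) &
    bounds (<< p >> + << s >> - << r >> - << l >>)].
Proof.
move=> ps sr.
pose f1 t := p (seg_pt t).
pose f2 t := s (seg_pt (t - 1)).
pose f3 t := r (seg_pt (3 - t)).
have f1c : continuous f1 by apply: shift_path_continuous => t; exact: cvg_id.
have f2c : continuous f2.
  by apply: shift_path_continuous => t; apply: cvgB; [exact: cvg_id|exact: cvg_cst].
have f3c : continuous f3.
  by apply: shift_path_continuous => t; apply: cvgB; [exact: cvg_cst|exact: cvg_id].
have f12 : f1 1 = f2 1 by rewrite /f1 /f2 subrr seg_pt1 // seg_pt0.
pose g12 := glue_at 1 f1 f2.
have g12c : continuous g12 by exact: glue_at_continuous.
have f23 : g12 2 = f3 2.
  by rewrite /g12 glue_atr ?ler1n // /f2 /f3 !seg_pt1 //; lra.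
pose g := glue_at 2 g12 f3.
have gc : continuous g by exact: glue_at_continuous.
have x01 (x : simplex R 1) : 0 <= set_val x 0 1 <= 1 by rewrite simplex_ge0 simplex_le1.
have ep : aff_path gc 0 1 = p.
  apply/continuousEP => x; rewrite aff_path_bary /g; have /andP[x0 x1] := x01 x.
  by rewrite glue_atl /g12 ?glue_atl ?subr0 ?add0r ?mul1r /f1 ?seg_ptK //; lra.
have es : aff_path gc 1 2 = s.
  apply/continuousEP => x; rewrite aff_path_bary /g; have /andP[x0 x1] := x01 x.
  rewrite glue_atl; last by lra.
  rewrite /g12 glue_atr //; last by lra.
  by rewrite /f2 (_ : _ - 1 = set_val x 0 1) ?seg_ptK //; ring.
have er : aff_path gc 2 3 = aff_path (@path_seg_pt_continuous _ _ r) 1 0.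
  apply/continuousEP => x; rewrite !aff_path_bary /g; have /andP[x0 x1] := x01 x.
  rewrite glue_atr //; last by lra.
  by rewrite /f3 /=; congr (r (seg_pt _)); ring.
exists (aff_path gc 0 3); split.
- by rewrite aff_path0 -[in RHS]ep aff_path0.
- rewrite aff_path1 /g glue_atr //; last by lra.
  by rewrite /f3 subrr seg_pt0.
have t1 := bounds_triangle gc 0 1 2; have t2 := bounds_triangle gc 0 2 3.
have := bounds_reverse (@path_seg_pt_continuous _ _ r) 0 1.
rewrite aff_path_seg_pt -er => t3.
have := boundsB (boundsD t1 t2) t3.
congr bounds; rewrite ep es; move: << aff_path gc 2 3 >> << aff_path gc 0 2 >> << aff_path gc 0 3 >> << p >> << s >> << r >> => /= a b c d e f.
rewrite [e - b + d]addrAC [e + d]addrC [a - c + b]addrC addrA subrK opprD.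
by rewrite [- f - a]addrC addrA addrA [_ - c - a]addrAC addrK addrAC.
Qed.

Lemma joined_refl y : joined y y.
Proof.
have yc : continuous (fun _ : R => y) by move=> t; exact: cvg_cst.
by exists (aff_path yc 0 1); rewrite aff_path0 aff_path1.
Qed.

Lemma joined_sym y z : joined y z -> joined z y.
Proof.
move=> [s [<- <-]]; exists (aff_path (@path_seg_pt_continuous _ _ s) 1 0).
by rewrite aff_path0 aff_path1 /comp seg_pt1 // seg_pt0.
Qed.

Lemma joined_trans x y z : joined x y -> joined y z -> joined x z.
Proof.
move=> [p [p0 p1]] [s [s0 s1]]; have [r [r0 r1]] := joined_refl z.
have [||l [l0 l1 _]] := @zigzag p s r; rewrite ?p1 ?s0 ?s1 ?r1 //.
by exists l; rewrite l0 l1 p0 r0.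
Qed.

(** A choice of base point depending only on the path component: it is chosen from
    the set of points joined to [y], which is the same set for joined points. *)
Lemma path_component_base : exists base : Y -> Y, (forall y, joined (base y) y) /\
  forall y z, joined y z -> base y = base z.
Proof.
exists (fun y => xget y (fun z => joined z y)); split=> [y|y z yz].
  by apply: (@xgetPex _ y (fun z => joined z y)); exists y; exact: joined_refl.
have eyz : (fun x => joined x y) = (fun x => joined x z).
  apply/funext => x; apply/propext; split=> h; first exact: joined_trans yz.
  exact: joined_trans (joined_sym yz).
rewrite eyz /xget; case: pselect => // -[]; exists z; apply/asboolP; exact: joined_refl.
Qed.

(** With a path [p y] from the base point of its component to each [y], every path
    [s] closes up to a loop [L s] that follows [p], then [s], then [p]
    backwards. *)
Lemma basepoint_loops : exists (p : Y -> path) (L : path -> path), forall s : path,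
  L s (vertex R 0) = L s (vertex R 1) /\
  bounds (<< p (s (vertex R 0)) >> + << s >> - << p (s (vertex R 1)) >> - << L s >>).
Proof.
have [base [basej baseE]] := path_component_base.
pose p y := sval (cid (basej y)).
have p0 y : p y (vertex R 0) = base y by rewrite /p; case: cid => ? [].
have p1 y : p y (vertex R 1) = y by rewrite /p; case: cid => ? [].
have Lex (s : path) : exists l : path, l (vertex R 0) = l (vertex R 1) /\
    bounds (<< p (s (vertex R 0)) >> + << s >> - << p (s (vertex R 1)) >> - << l >>).
  have [||l [l0 l1 lb]] := @zigzag (p (s (vertex R 0))) s (p (s (vertex R 1))).
  - by rewrite p1.
  - by rewrite p1.
  exists l; split=> //; rewrite l0 l1 !p0; apply: baseE; by exists s.
exists p, (fun s => sval (cid (Lex s))) => s; by case: cid.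
Qed.

Lemma path_facesE (s : path) (x : simplex R 0) : 
  (s \o face R ord0 : singular R 0 Y) x = s (vertex R 1) /\
  (s \o face R (fintype.lift ord0 ord0) : singular R 0 Y) x = s (vertex R 0).
Proof.
rewrite /= !face_vertex; split; congr (s (vertex R _)); exact: val_inj.
Qed.

End Loops.

Lemma subrACA (V : zmodType) (x y z t : V) : (x - y) - (z - t) = (x - z) - (y - t).
Proof. by rewrite !opprB (addrC t) addrACA (addrC _ t). Qed.

Section HomologyLoops.
Variables (R : realType) (Y : topologicalType).
Notation path := (singular R 1 Y).

Lemma homology1_eq (y z : cycle1 R Y) : bounds (val y - val z) ->
  \pi_(homology1 R Y) y = \pi_(homology1 R Y) z.
Proof.
move=> [b bE]; apply/eqP; rewrite -Quotient.idealrBE unfold_in /is_boundary1.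
by apply/asboolP; exists b; rewrite bE raddfB.
Qed.

(** Replacing each path by the loop of [basepoint_loops] changes a chain by a
    boundary and by the paths [p] over its own boundary, which cancel for a
    cycle. *)
Lemma homology1_loop_ind (P : homology1 R Y -> Prop) :
  P 0 -> (forall a b, P a -> P b -> P (a - b)) ->
  (forall (g : path) (g01 : g (vertex R 0) = g (vertex R 1)), P (loop_class g01)) ->
  forall x, P x.
Proof.
move=> P0 PB Ploop x.
have [p [L Lp]] := basepoint_loops R Y.
pose Lc s : cycle1 R Y := Cycle1 (loop_is_cycle1 (proj1 (Lp s))).
pose Phi : chain R 1 Y -> cycle1 R Y := chain_lift Lc.
(* The base point paths over a boundary; this vanishes on cycles. *)
pose pbd : chain R 0 Y -> chain R 1 Y :=
  chain_lift (fun v : singular R 0 Y => << p (v (vertex R 0)) >>).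
have main z : bounds (z - pbd (bd z) - val (Phi z)).
  apply: (@chain_ind _ _ _ (fun z => bounds (z - pbd (bd z) - val (Phi z)))) => [a b ha hb||s].
  - have := boundsB ha hb; congr bounds.
    have -> : bd (a - b) = bd a - bd b by exact: raddfB.
    have -> : pbd (bd a - bd b) = pbd (bd a) - pbd (bd b) by exact: raddfB.
    have -> : Phi (a - b) = Phi a - Phi b by exact: raddfB.
    by rewrite subrACA (subrACA a).
  - have -> : bd (0 : chain R 1 Y) = 0 by exact: raddf0.
    have -> : pbd 0 = 0 by exact: raddf0.
    have -> : Phi 0 = 0 by exact: raddf0.
    by rewrite !subr0; exact: bounds0.
  - rewrite /Phi /pbd chain_liftU bdU /bd_singular !big_ord_recl big_ord0 addr0.
    rewrite expr0 expr1 raddfD -freegUN raddfN /= !chain_liftU.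
    have [-> ->] := path_facesE s (vertex R 0).
    by case: (Lp s) => _; congr bounds; rewrite opprB addrA; congr (_ - _ - _); exact: addrC.
rewrite -[x]reprK; set z := repr x.
have -> : \pi z = \pi_(homology1 R Y) (Phi (val z)).
  apply: homology1_eq; have := main (val z).
  by have /eqP -> := cycle1_valP z; rewrite /pbd raddf0 subr0.
apply: (@chain_ind _ _ _ (fun z => P (\pi_(homology1 R Y) (Phi z)))) => [a b ha hb||s].
- have -> : Phi (a - b) = Phi a - Phi b by exact: raddfB.
  by rewrite raddfB; exact: PB.
- have -> : Phi 0 = 0 by exact: raddf0.
  by rewrite raddf0.
- by rewrite /Phi chain_liftU; exact: Ploop.
Qed.

End HomologyLoops.

(** * Monodromy of a local system on homology *)

Section Monodromy.
Variables (R : realType) (Y : topologicalType) (A : comNzRingType) (T : Y -> Y -> A).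
Hypothesis TP : local_system T.

Notation hol := (@holonomy R Y A T TP).

Lemma holonomy_bounds (z : chain R 1 Y) : bounds z -> chain_lift hol z = 0.
Proof.
move=> [b <-]; move: b.
apply: (@chain_ind _ _ _ (fun b => chain_lift hol (bd b) = 0)) => [a b ha hb||s].
- by rewrite !raddfB /= ha hb subrr.
- by rewrite !raddf0.
- rewrite bdU /bd_singular raddf_sum -[RHS](holonomy_triangle TP s).
  apply: eq_bigr => i _; rewrite -[_ ^+ _ in LHS]intz -freegU_mulz raddfMz /= chain_liftU.
  by rewrite -mulrzl; congr (_ * _); rewrite rmorphXn /= mulrNz.
Qed.

(** The holonomy cochain kills boundaries of triangles, so it descends to the
    quotient. *)
Theorem monodromy_exists : exists rho : {additive homology1 R Y -> A},
  forall (g : singular R 1 Y) (g01 : g (vertex R 0) = g (vertex R 1)),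
    rho (loop_class g01) = hol g.
Proof.
pose f (x : homology1 R Y) : A := chain_lift hol (val (repr x)).
have f_pi z : f (\pi z) = chain_lift hol (val z).
  rewrite /f; apply/eqP; rewrite -subr_eq0 -raddfB /=; apply/eqP/holonomy_bounds.
  have /eqP : \pi_(homology1 R Y) (repr (\pi_(homology1 R Y) z)) = \pi z.
    by rewrite reprK.
  rewrite -Quotient.idealrBE unfold_in /is_boundary1 => /asboolP[b bE].
  by exists b; rewrite bE raddfB.
have fB : zmod_morphism f.
  move=> x y; rewrite -[x]reprK -[y]reprK -raddfB !f_pi; exact: raddfB.
pose fH := GRing.isZmodMorphism.Build _ _ f fB.
pose F : {additive homology1 R Y -> A} := HB.pack f fH.
by exists F => g g01; rewrite /= f_pi /= chain_liftU.
Qed.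

(** The potential at [y] is the holonomy of the path from the base point to [y]:
    then the corrected holonomy of a path [s] is that of the loop [L s] given by
    [basepoint_loops]. *)
Theorem monodromy_potential (rho : {additive homology1 R Y -> A}) (P : set A) :
  (forall (g : singular R 1 Y) (g01 : g (vertex R 0) = g (vertex R 1)),
    rho (loop_class g01) = hol g) ->
  range rho `<=` P ->
  exists phi : Y -> A, forall s : singular R 1 Y,
    P (hol s + phi (s (vertex R 0)) - phi (s (vertex R 1))).
Proof.
move=> rhoE rhoP; have [p [L Lp]] := basepoint_loops R Y.
exists (fun y => hol (p y)) => s; have [L01 Lb] := Lp s.
have h : hol (p (s (vertex R 0))) + hol s - hol (p (s (vertex R 1))) = hol (L s).
  apply/eqP; rewrite -subr_eq0; apply/eqP.
  rewrite -[RHS](holonomy_bounds Lb) !(raddfB (chain_lift hol)) (raddfD (chain_lift hol)).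
  by rewrite /= !chain_liftU.
rewrite [hol s + _]addrC h -(rhoE _ L01); apply: rhoP.
by exists (loop_class L01).
Qed.

End Monodromy.

(** * Derivatives through continuous slopes *)

Section ComplexDerivative.
Variable K : numFieldType.
Implicit Types (f g h : K -> K) (a l : K).

Lemma continuousM_at f g a : {for a, continuous f} -> {for a, continuous g} ->
  {for a, continuous (fun z => f z * g z)}.
Proof. by move=> fc gc; exact: (@cvgM K K (nbhs a) _ f g (f a) (g a)). Qed.

Lemma continuousD_at f g a : {for a, continuous f} -> {for a, continuous g} ->
  {for a, continuous (fun z => f z + g z)}.
Proof. by move=> fc gc; exact: (@cvgD K K K (nbhs a) _ f g (f a) (g a)). Qed.

Lemma continuousN_at f a : {for a, continuous f} ->
  {for a, continuous (fun z => - f z)}.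
Proof. by move=> fc; exact: (@cvgN K K K (nbhs a) _ f (f a)). Qed.

Lemma continuousV_at f a : {for a, continuous f} -> f a != 0 ->
  {for a, continuous (fun z => (f z)^-1)}.
Proof. by move=> fc fa0; exact: (@cvgV K K (nbhs a) _ f (f a)). Qed.

Lemma continuous_id_at a : {for a, continuous (fun z : K => z)}.
Proof. exact: cvg_id. Qed.

Lemma continuous_cst_at (b a : K) : {for a, continuous (fun _ : K => b)}.
Proof. exact: cst_continuous. Qed.

Lemma continuousX_at f n a : {for a, continuous f} ->
  {for a, continuous (fun z => f z ^+ n)}.
Proof.
move=> fc; elim: n => [|n IH].
  exact: (@continuous_cst_at 1 a).
rewrite (_ : (fun _ => _) = (fun z => f z * f z ^+ n)); first exact: continuousM_at.
by apply/funext => z; rewrite exprS.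
Qed.

Lemma continuous_sum_at n (F : 'I_n -> K -> K) a :
  (forall i, {for a, continuous (F i)}) ->
  {for a, continuous (fun z => \sum_(i < n) F i z)}.
Proof.
elim: n F => [|n IH] F Fc.
  rewrite (_ : (fun _ => _) = (fun=> 0)); first exact: continuous_cst_at.
  by apply/funext => z; rewrite big_ord0.
rewrite (_ : (fun _ => _) = (fun z => F ord0 z +
  \sum_(i < n) F (fintype.lift ord0 i) z)); last first.
  by apply/funext => z; rewrite big_ord_recl.
by apply: continuousD_at => //; apply: (IH (fun i => F (fintype.lift ord0 i))).
Qed.

Lemma near_continuous f g a : {near a, f =1 g} -> {for a, continuous f} ->
  {for a, continuous g}.
Proof.
move=> fg fc U; rewrite -(nbhs_singleton fg) => /fc fU.
have {fU} h : nbhs a (f @^-1` U) := fU.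
by apply: filterS2 fg h => z; rewrite /preimage /= => ->.
Qed.

Lemma continuous_neq0 f a : {for a, continuous f} -> f a != 0 ->
  \forall z \near a, f z != 0.
Proof.
move=> fc fa0; have : nbhs (f a) [set y | y != 0].
  apply: open_nbhs_nbhs; split=> //.
  have -> : [set y : K | y != 0] = ~` [set 0].
    by apply/seteqP; split=> y /= /eqP.
  apply: closed_openC; apply: accessible_closed_set1; exact/hausdorff_accessible/norm_hausdorff.
by move/fc.
Qed.

(** Differentiability at [a] is continuity of this function at [a], which turns the
    rules of calculus into rules for continuous functions. *)
Definition slope f a l z := if z == a then l else (f z - f a) / (z - a).

Lemma slopeE f a l z : f z = f a + (z - a) * slope f a l z.
Proof.
rewrite /slope; case: eqVneq => [->|za]; first by rewrite subrr mul0r addr0.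
by rewrite mulrC divfK ?subr_eq0 // addrC subrK.
Qed.

Lemma slope_sub f a l z : f z - f a = (z - a) * slope f a l z.
Proof. by rewrite [in LHS](slopeE f a l z) addrC addKr. Qed.

Definition has_cderiv f a l := {for a, continuous (slope f a l)}.

Lemma derivable_cderiv f a : derivable f a 1 -> has_cderiv f a ('D_1 f a).
Proof.
move=> df; apply/continuous_withinNshiftx; rewrite /slope eqxx /=.
apply: cvg_trans df; apply: near_eq_cvg; rewrite !fctE.
near=> i.
have i0 : i != 0 by near: i; exact: nbhs_dnbhs_neq.
rewrite ifN; first by rewrite addrK mulrC /= [_%:A]mulr1.
by rewrite -subr_eq0 addrK.
Unshelve. all: by end_near. Qed.

Lemma cderiv_derivable f a l : has_cderiv f a l -> derivable f a 1 /\ 'D_1 f a = l.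
Proof.
move=> fl.
suff Hf : h^-1 *: ((f \o shift a) (h *: 1) - f a) @[h --> 0^'] --> l.
  by split; [apply/cvg_ex; exists l|exact: cvg_lim].
have F1 : (slope f a l \o shift a) y @[y --> 0^'] --> l.
  have : (slope f a l \o shift a) y @[y --> 0^'] --> slope f a l a.
    exact/continuous_withinNshiftx.
  by rewrite [slope f a l a](_ : _ = l) // /slope eqxx.
apply: cvg_trans F1; apply: near_eq_cvg.
near=> y.
have y0 : y != 0 by near: y; exact: nbhs_dnbhs_neq.
rewrite /= [_%:A]mulr1 [in RHS](slopeE f a l (y + a)) [f a + _]addrC !addrK.
by rewrite /GRing.scale /= mulrA mulVf // mul1r.
Unshelve. all: by end_near. Qed.

Lemma cderivI f g a : {for a, continuous g} ->
  (\forall z \near a, f z = f a + (z - a) * g z) -> has_cderiv f a (g a).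
Proof.
move=> gc fE; apply: near_continuous gc; apply: filterS fE => z fz.
rewrite /slope; case: eqVneq => [->//|za].
by rewrite fz [f a + _]addrC addrK mulrC mulKf // subr_eq0.
Qed.

Lemma derivable_continuous_at f a : derivable f a 1 -> {for a, continuous f}.
Proof.
move=> /derivable_cderiv df.
have -> : f = (fun z => f a + (z - a) * slope f a ('D_1 f a) z).
  by apply/funext => z; exact: slopeE.
apply: continuousD_at; first exact: continuous_cst_at.
apply: continuousM_at; last exact: df.
apply: continuousD_at; [exact: continuous_id_at|exact: continuous_cst_at].
Qed.

Lemma near_cderiv f g a l : {near a, f =1 g} -> has_cderiv f a l -> has_cderiv g a l.
Proof.
move=> fg; apply: near_continuous.
have fga := nbhs_singleton fg; apply: filterS fg => z fz.
by rewrite /slope fz fga.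
Qed.

Lemma near_derivable f g a : {near a, f =1 g} -> derivable f a 1 -> derivable g a 1.
Proof.
by move=> fg /derivable_cderiv /(near_cderiv fg)/cderiv_derivable[].
Qed.

Lemma near_derive f g a : {near a, f =1 g} -> derivable f a 1 -> 'D_1 f a = 'D_1 g a.
Proof.
by move=> fg /derivable_cderiv /(near_cderiv fg)/cderiv_derivable[].
Qed.

Lemma cderiv_comp f g a k l : {for a, continuous f} -> has_cderiv f a k ->
  has_cderiv g (f a) l -> has_cderiv (g \o f) a (l * k).
Proof.
move=> fc fk gl.
pose s z := slope g (f a) l (f z) * slope f a k z.
have -> : l * k = s a by rewrite /s /slope !eqxx.
apply: cderivI; last first.
  apply: (@filterE _ (nbhs a) _) => z /=.
  by rewrite (slopeE g (f a) l (f z)) (slope_sub f a k z) /s mulrCA mulrC; congr (_ + _); ring.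
apply: continuousM_at; last exact: fk.
by apply: (@continuous_comp _ _ _ f (slope g (f a) l)).
Qed.

Lemma derivable_comp f g a : derivable f a 1 -> derivable g (f a) 1 ->
  derivable (g \o f) a 1 /\ 'D_1 (g \o f) a = 'D_1 g (f a) * 'D_1 f a.
Proof.
move=> df dg; apply: cderiv_derivable; apply: cderiv_comp.
- exact: derivable_continuous_at.
- exact: derivable_cderiv.
- exact: derivable_cderiv.
Qed.

Lemma derivable_id_at a : derivable (fun z : K => z) a 1 /\ 'D_1 (fun z : K => z) a = 1.
Proof.
apply: cderiv_derivable; apply: (@cderivI _ (fun=> 1)); first exact: continuous_cst_at.
by apply: (@filterE _ (nbhs a) _) => z; ring.
Qed.

Lemma derivableM_at f g a : derivable f a 1 -> derivable g a 1 ->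
  derivable (fun z => f z * g z) a 1.
Proof. by move=> df dg; exact: (@derivableM K K f g a 1). Qed.

Lemma derivable_cst_at (b a : K) : derivable (fun _ : K => b) a 1.
Proof. exact: derivable_cst. Qed.

Lemma derivableX_at f n a : derivable f a 1 -> derivable (fun z => f z ^+ n) a 1.
Proof.
move=> df; elim: n => [|n IH].
  exact: (@derivable_cst_at 1 a).
rewrite (_ : (fun _ => _) = (fun z => f z * f z ^+ n)); first exact: derivableM_at.
by apply/funext => z; rewrite exprS.
Qed.

(** In [h z ^+ n - h a ^+ n = (h z - h a) * s z] the cofactor [s] is continuous with
    [s a = n * h a ^+ n.-1], which is nonzero. *)
Lemma derivable_root h f n a : (0 < n)%N -> {for a, continuous h} -> h a != 0 ->
  (\forall z \near a, h z ^+ n = f z) -> derivable f a 1 -> derivable h a 1.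
Proof.
move=> n0 hc ha0 hf df.
pose s z := \sum_(i < n) h z ^+ (n.-1 - i) * h a ^+ i.
have sc : {for a, continuous s}.
  apply: continuous_sum_at => i; apply: continuousM_at; last exact: continuous_cst_at.
  exact: continuousX_at.
have sa : s a != 0.
  rewrite /s (eq_bigr (fun=> h a ^+ n.-1)) => [|i _].
    by rewrite sumr_const card_ord -mulr_natr mulf_neq0 ?expf_neq0 // pnatr_eq0 -lt0n.
  by rewrite -exprD subnK // -ltnS prednK.
have dc := derivable_cderiv df.
pose d z := slope f a ('D_1 f a) z / s z.
suff /cderiv_derivable[] : has_cderiv h a (d a) by [].
apply: cderivI; first by apply: continuousM_at => //; exact: continuousV_at.
have hfa := nbhs_singleton hf.
near=> z.
have hfz : h z ^+ n = f z by near: z.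
have sz : s z != 0 by near: z; exact: continuous_neq0.
rewrite /d mulrA; apply/(mulIf sz); rewrite mulrDl mulfVK //.
have /eqP : f z - f a = (h z - h a) * s z by rewrite -hfz -hfa subrXX.
by rewrite (slope_sub f a ('D_1 f a) z) => /eqP ->; ring.
Unshelve. all: by end_near. Qed.

Lemma continuous_dnbhs_eq f g a : {for a, continuous f} -> {for a, continuous g} ->
  (\forall z \near a, z != a -> f z = g z) -> f a = g a.
Proof.
move=> /continuous_withinNx fc /continuous_withinNx gc fg.
apply: (@cvg_unique K (@norm_hausdorff K K) (f @ a^')) => //.
apply: cvg_trans gc; apply: near_eq_cvg.
by rewrite near_withinE; apply: filterS fg => z h /h ->.
Qed.

End ComplexDerivative.

(** * Real modulus and fourth roots of unity *)

Section ComplexModulus.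
Variable R : realType.
Implicit Types (z w a : C R) (f g : C R -> C R).

(** The norm of [C R] takes values in [C R]; this is the same quantity as a real
    number, where linear arithmetic is available. *)
Definition cnorm z : R := Normc.normc z.

Lemma cnormE z : `|z| = (cnorm z)%:C%C. Proof. by []. Qed.
Lemma cnorm_ge0 z : 0 <= cnorm z.
Proof. by have := normr_ge0 z; rewrite cnormE lecE /= eqxx. Qed.
Lemma cnormM z w : cnorm (z * w) = cnorm z * cnorm w. Proof. exact: Normc.normcM. Qed.
Lemma cnormN z : cnorm (- z) = cnorm z. Proof. exact: (@normcN R z). Qed.
Lemma cnormD z w : cnorm (z + w) <= cnorm z + cnorm w. Proof. exact: (@le_normcD R z w). Qed.
Lemma cnorm1 : cnorm 1 = 1. Proof. exact: Normc.normc1. Qed.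
Lemma cnormX z n : cnorm (z ^+ n) = cnorm z ^+ n.
Proof. by elim: n => [|n IH]; rewrite ?expr0 ?cnorm1 // !exprS cnormM IH. Qed.
Lemma cnorm_eq0 z : (cnorm z == 0) = (z == 0).
Proof. by rewrite -[RHS]normr_eq0 cnormE eq_complex /= eqxx andbT. Qed.
Lemma cnorm_gt0 z : (0 < cnorm z) = (z != 0).
Proof. by rewrite lt_neqAle cnorm_ge0 andbT eq_sym cnorm_eq0. Qed.
Lemma cnormB z w : cnorm (z - w) <= cnorm z + cnorm w.
Proof. by rewrite -[cnorm w]cnormN; exact: cnormD. Qed.
Lemma cnorm_real (x : R) : cnorm x%:C%C = `|x|.
Proof. by rewrite /cnorm /= expr0n /= addr0 sqrtr_sqr. Qed.
Lemma cnormMn z n : cnorm (z *+ n) = cnorm z *+ n. Proof. exact: (@normcMn R z n). Qed.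
Lemma cnorm_Re z : `|complex.Re z| <= cnorm z.
Proof. by have := @normc_ge_Re R z; rewrite -[X in _ <= X]/(`|(z : C R)|) cnormE lecE /= eqxx. Qed.

Lemma ball_cnorm (a z e : C R) : 0 < e -> ball a e z <-> cnorm (a - z) < complex.Re e.
Proof. by case: e => e e'; rewrite ltcE /= /ball /= cnormE ltcE /= => /andP[/eqP -> _]; rewrite eqxx. Qed.

Lemma near_cnorm (a : C R) (e : R) : 0 < e -> \forall z \near a, cnorm (z - a) < e.
Proof.
move=> e0; have e0' : 0 < e%:C%C :> C R by rewrite ltcE /= eqxx.
apply: filterS (nbhsx_ballx a _ e0') => z /(ball_cnorm _ _ e0') /=.
by rewrite -cnormN opprB.
Qed.

Lemma nearP_cnorm (a : C R) (P : C R -> Prop) : (\forall z \near a, P z) <->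
  exists2 e : R, 0 < e & forall z, cnorm (z - a) < e -> P z.
Proof.
split=> [/nbhs_ballP[e /= e0 eP]|[e e0 eP]]; last first.
  by apply: filterS (near_cnorm a e0).
exists (complex.Re e); first by move: e0; rewrite ltcE => /andP[].
by move=> z za; apply/eP/(ball_cnorm _ _ e0); rewrite -cnormN opprB.
Qed.

Lemma continuous_cnormP f a : {for a, continuous f} <->
  forall e : R, 0 < e -> \forall z \near a, cnorm (f z - f a) < e.
Proof.
split=> [fc e e0|fe U /nearP_cnorm[e e0 eU]].
  exact: (fc _ (near_cnorm (f a) e0)).
have h := fe e e0; rewrite /nbhs /=.
by apply: filterS h => z; exact: eU.
Qed.

(** The other fourth roots of unity are at distance at least [sqrt 2] from 1. *)
Lemma fourth_root_of_unity_near1 z : z ^+ 4 = 1 -> cnorm (z - 1) < 1 -> z = 1.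
Proof.
move=> z4 z1.
have : (z - 1) * ((z + 1) * (z ^+ 2 + 1)) = 0.
  have -> : (z - 1) * ((z + 1) * (z ^+ 2 + 1)) = z ^+ 4 - 1 by ring.
  by rewrite z4 subrr.
move=> /eqP; rewrite !mulf_eq0 => /or3P[/eqP/subr0_eq//|zm|zi].
  move: zm; rewrite addr_eq0 => /eqP zm; move: z1; rewrite zm -opprD cnormN -mulr2n cnormMn cnorm1.
  by rewrite ltrn1.
have : (z - 1) ^+ 2 = - (z *+ 2).
  have -> : (z - 1) ^+ 2 = (z ^+ 2 + 1) - z *+ 2 by ring.
  by rewrite (eqP zi) sub0r.
have nz : cnorm z = 1.
  have /eqP : cnorm z ^+ 4 = 1 by rewrite -cnormX z4 cnorm1.
  by rewrite pexpr_eq1 ?cnorm_ge0 // => /eqP.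
move=> /(congr1 cnorm); rewrite cnormX cnormN cnormMn nz => h.
have x0 := cnorm_ge0 (z - 1).
have : cnorm (z - 1) * cnorm (z - 1) <= 1 by rewrite mulr_ile1 // ltW.
by rewrite -expr2 h -[X in _ <= X]mulr1n ler_nat.
Qed.

(** The quotient of [f / g] by its value at [a] is a continuous fourth root of unity
    that equals 1 at [a]. *)
Lemma near_root_of_unity f g a : {for a, continuous f} -> {for a, continuous g} ->
  g a != 0 -> (\forall z \near a, f z ^+ 4 = g z ^+ 4) ->
  \forall z \near a, f z = f a / g a * g z.
Proof.
move=> fc gc ga fg; have fga := nbhs_singleton fg.
have fa : f a != 0 by have := expf_eq0 (f a) 4; rewrite fga expf_eq0 (negbTE ga) /= => <-.
pose u z := (f z / g z) / (f a / g a).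
have uc : {for a, continuous u}.
  apply: continuousM_at; last exact: continuous_cst_at.
  exact (continuousM_at fc (continuousV_at gc ga)).
have ua : u a = 1 by rewrite /u divff // mulf_neq0 ?invr_eq0.
near=> z.
have gz : g z != 0 by near: z; exact (continuous_neq0 gc ga).
have u1 : cnorm (u z - 1) < 1.
  by rewrite -ua; near: z; exact (proj1 (continuous_cnormP u a) uc 1 ltr01).
have fz : f z ^+ 4 = g z ^+ 4 by near: z.
have : u z = 1.
  apply: fourth_root_of_unity_near1 => //; rewrite /u !exprMn !exprVn !exprMn !exprVn fz fga.
  by rewrite !divff ?expf_eq0 ?ga ?gz //= mulr1 invr1.
rewrite /u => h; rewrite -[f a / g a]mul1r -h divfK ?divfK //.
by rewrite mulf_neq0 ?invr_eq0.
Unshelve. all: by end_near. Qed.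

End ComplexModulus.

(** * Local holomorphic roots *)

Section ComplexRoots.
Variable R : realType.
Implicit Types (z w a : C R) (f g h : C R -> C R).

Definition near_sqrt (u : C R) : C R :=
  if cnorm (sqrtC u - 1) <= cnorm (sqrtC u + 1) then sqrtC u else - sqrtC u.

Lemma near_sqrtK u : near_sqrt u ^+ 2 = u.
Proof. by rewrite /near_sqrt; case: ifP => _; rewrite ?sqrrN sqrtCK. Qed.

(** From [u - 1 = (r - 1) * (r + 1)], where [r + 1] has modulus at least 1 because [r]
    is closer to 1 than to -1. *)
Lemma near_sqrt_dist u : cnorm (near_sqrt u - 1) <= cnorm (u - 1).
Proof.
set r := near_sqrt u.
have r1 : cnorm (r - 1) <= cnorm (r + 1).
  rewrite /r /near_sqrt; case: ifP => // /negbT; rewrite -ltNge => /ltW.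
  by rewrite -opprD cnormN [- _ + 1]addrC -[cnorm (1 - _)]cnormN opprB.
have r2 : 2 <= cnorm (r + 1) + cnorm (r - 1).
  have : cnorm ((r + 1) - (r - 1)) <= cnorm (r + 1) + cnorm (r - 1) by exact: cnormB.
  by have -> : r + 1 - (r - 1) = 1 *+ 2 by [ring]; rewrite cnormMn cnorm1.
have -> : cnorm (u - 1) = cnorm (r - 1) * cnorm (r + 1).
  by rewrite -cnormM -[in LHS](near_sqrtK u) -/r; congr cnorm; ring.
rewrite ler_peMr ?cnorm_ge0 //.
by move: (cnorm (r - 1)) (cnorm (r + 1)) r1 r2 => x y; clear; lra.
Qed.

(** Near 1 the sum of two such roots has modulus at least 1, so their difference is
    at most that of their squares. *)
Lemma near_sqrt_lipschitz u v : cnorm (u - 1) <= 2^-1 -> cnorm (v - 1) <= 2^-1 ->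
  cnorm (near_sqrt u - near_sqrt v) <= cnorm (u - v).
Proof.
move=> u1 v1; have := near_sqrt_dist u; have := near_sqrt_dist v.
set r := near_sqrt u; set s := near_sqrt v => s1 r1.
have -> : cnorm (u - v) = cnorm (r - s) * cnorm (r + s).
  by rewrite -cnormM -[in LHS](near_sqrtK u) -[in LHS](near_sqrtK v) -/r -/s; congr cnorm; ring.
have h : 2 <= cnorm (r + s) + cnorm (r - 1) + cnorm (s - 1).
  have : cnorm ((r + s) - (r - 1) - (s - 1)) <= cnorm (r + s) + cnorm (r - 1) + cnorm (s - 1).
    by apply: le_trans (cnormB _ _) _; rewrite lerD2r cnormB.
  by have -> : r + s - (r - 1) - (s - 1) = 1 *+ 2 by [ring]; rewrite cnormMn cnorm1.
rewrite ler_peMr ?cnorm_ge0 //; move: h s1 r1 u1 v1.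
move: (cnorm (r + s)) (cnorm (r - 1)) (cnorm (s - 1)) (cnorm (u - 1)) (cnorm (v - 1)).
by clear; move=> x y z t w; lra.
Qed.

Lemma holomorphic_sqrt f a s : (\forall z \near a, derivable f z 1) -> s ^+ 2 = f a ->
  f a != 0 -> exists h, [/\ \forall z \near a, derivable h z 1, h a = s &
    \forall z \near a, h z ^+ 2 = f z].
Proof.
move=> df sa fa0; have s0 : s != 0 by move: fa0; rewrite -sa expf_eq0.
pose u z := f z / f a.
have uc z : derivable f z 1 -> {for z, continuous u}.
  move=> dfz; exact (continuousM_at (derivable_continuous_at dfz) (@continuous_cst_at _ _ z)).
have du z : derivable f z 1 -> derivable u z 1.
  by move=> dfz; exact (derivableM_at dfz (@derivable_cst_at (C R) _ z)).
have ua : u a = 1 by rewrite /u divff.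
exists (fun z => s * near_sqrt (u z)); split.
- have u12 : \forall z \near a, cnorm (u z - 1) < 2^-1.
    have e0 : 0 < 2^-1 :> R by rewrite invr_gt0 ltr0n.
    have := proj1 (continuous_cnormP u a) (uc a (nbhs_singleton df)) _ e0.
    by apply: filterS => z; rewrite ua.
  apply: filterS2 df (near_join u12) => z dfz nuz.
  have uz := nbhs_singleton nuz.
  have rc : {for z, continuous (fun w => near_sqrt (u w))}.
    apply/continuous_cnormP => e e0.
    have h1 := proj1 (continuous_cnormP u z) (uc z dfz) e e0.
    apply: filterS2 nuz h1 => w w1 w2; apply: le_lt_trans w2.
    by apply: near_sqrt_lipschitz; exact: ltW.
  apply (derivableM_at (@derivable_cst_at (C R) s z)).
  apply (@derivable_root _ _ u 2 _ isT rc); last exact (du z dfz).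
    apply/eqP => r0; have u0 : u z = 0 by rewrite -(near_sqrtK (u z)) r0 expr0n.
    move: uz; rewrite u0 sub0r cnormN cnorm1.
    by rewrite ltNge invf_le1 ?ler1n // ltr0n.
  by apply: (@filterE _ (nbhs z) _) => w; exact: near_sqrtK.
- rewrite ua; have := near_sqrt_dist 1; rewrite subrr.
  have -> : cnorm 0 = 0 :> R by exact: Normc.normc0.
  move=> h; have : cnorm (near_sqrt 1 - 1) == 0 by rewrite eq_le h cnorm_ge0.
  by rewrite cnorm_eq0 subr_eq0 => /eqP ->; rewrite mulr1.
- apply: (@filterE _ (nbhs a) _) => z.
  by rewrite exprMn near_sqrtK sa /u mulrC divfK.
Qed.

Lemma holomorphic_root4 f a s : (\forall z \near a, derivable f z 1) -> s ^+ 4 = f a ->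
  f a != 0 -> exists h, [/\ \forall z \near a, derivable h z 1, h a = s &
    \forall z \near a, h z ^+ 4 = f z].
Proof.
move=> df sa fa0; have s0 : s != 0 by move: fa0; rewrite -sa expf_eq0.
have sa2 : (s ^+ 2) ^+ 2 = f a by rewrite -exprM.
have [h1 [dh1 h1a h1f]] := holomorphic_sqrt df sa2 fa0.
have [||h [dh ha hf]] := @holomorphic_sqrt h1 a s dh1.
- by rewrite h1a.
- by rewrite h1a expf_neq0.
exists h; split; [exact dh|exact ha|].
apply: filterS2 hf h1f => z hz h1z.
by rewrite -[4%N]/(2 * 2)%N exprM hz.
Qed.

Lemma exists_root4 (x : C R) : exists s : C R, s ^+ 4 = x.
Proof. by exists (sqrtC (sqrtC x)); rewrite -[4%N]/(2 * 2)%N exprM !sqrtCK. Qed.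

End ComplexRoots.

(** * Continuity of derivatives with holomorphic fourth power *)

Section Darboux.
Variable R : realType.

(** The intermediate value property of derivatives: if [F' 1 < c], then [F t - c * t]
    has an interior maximum, where [F'] takes the value [c]. *)
Lemma darboux (F F' : R -> R) (c : R) :
  (forall t, 0 <= t <= 1 -> has_cderiv F t (F' t)) ->
  (forall t, 0 <= t <= 1 -> F' t != c) -> c < F' 0 -> c < F' 1.
Proof.
move=> dF Fc F0; rewrite ltNge le_eqVlt negb_or Fc ?ler01 ?lexx //=.
apply/negP => F1.
pose G t := F t - c * t.
have dG t : 0 <= t <= 1 -> has_cderiv G t (F' t - c).
  move=> t01; have e : slope F t (F' t) t - c = F' t - c by rewrite /slope eqxx.
  rewrite -e; apply: (@cderivI _ G (fun u => slope F t (F' t) u - c)).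
    apply: continuousD_at; [exact: dF|exact: continuous_cst_at].
  apply: (@filterE _ (nbhs t) _) => u.
  by rewrite /G (slopeE F t (F' t) u); ring.
have Gder t : 0 <= t <= 1 -> derivable G t 1 by move=> /dG/cderiv_derivable[].
have GderE t : 0 <= t <= 1 -> 'D_1 G t = F' t - c by move=> /dG/cderiv_derivable[].
have Gc : {within `[0, 1], continuous G}.
  apply: continuous_in_subspaceT => t; rewrite inE /= in_itv /= => /Gder.
  exact: derivable_continuous_at.
have [x x01 xmax] := EVT_max ler01 Gc.
(* At an end point the sign of the slope excludes a maximum. *)
have max_slope (u d : R) : 0 <= u <= 1 -> (forall e, 0 < e -> exists2 w, 0 <= w <= 1 &
    `|w - u| < e /\ 0 < (w - u) * d) -> has_cderiv G u d -> x <> u.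
  move=> u01 side du xu.
  have d0 : d != 0.
    by have [w _ [_]] := side 1 ltr01; apply: contraTneq => ->; rewrite mulr0 ltxx.
  have : \forall w \near u, 0 < slope G u d w * d.
    have sc : {for u, continuous (fun w => slope G u d w * d)}.
      by apply: continuousM_at => //; exact: continuous_cst_at.
    have e : slope G u d u = d by rewrite /slope eqxx.
    have p : 0 < slope G u d u * d by rewrite e -expr2 exprn_even_gt0 //= d0.
    exact (sc _ (lt_nbhsr p)).
  move=> /nbhs_ballP[e /= e0 eP]; have [w w01 [wu wd]] := side e e0.
  have := eP w; rewrite /ball /= distrC => /(_ wu) sw.
  have := xmax w; rewrite in_itv /= => /(_ w01).
  rewrite xu (slopeE G u d w) gerDl leNgt => /negP; apply.
  have : 0 < (w - u) * d * (slope G u d w * d) by rewrite mulr_gt0.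
  have -> : (w - u) * d * (slope G u d w * d) = (w - u) * slope G u d w * d ^+ 2 by ring.
  by rewrite pmulr_lgt0 // exprn_even_gt0 //= d0.
have x0 : x <> 0.
  apply: (max_slope _ _ _ _ (dG 0 _)); rewrite ?lexx ?ler01 // => e e0.
  have m0 : 0 < Num.min (e / 2) 1 by rewrite lt_min ltr01 divr_gt0.
  exists (Num.min (e / 2) 1); first by rewrite ge_min lexx orbT andbT ltW.
  split; rewrite subr0; last by rewrite mulr_gt0 ?subr_gt0.
  rewrite gtr0_norm // gt_min.
  by rewrite ltr_pdivrMr ?ltr0n // ltr_pMr // ltr1n.
have x1 : x <> 1.
  apply: (max_slope _ _ _ _ (dG 1 _)); rewrite ?lexx ?ler01 // => e e0.
  have m0 : 0 < Num.min (e / 2) 1 by rewrite lt_min ltr01 divr_gt0.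
  exists (1 - Num.min (e / 2) 1).
    by rewrite subr_ge0 ge_min lexx orbT /= gerBl ltW.
  split; rewrite addrAC subrr sub0r.
    rewrite normrN gtr0_norm // gt_min.
    by rewrite ltr_pdivrMr ?ltr0n // ltr_pMr // ltr1n.
  by rewrite mulNr -mulrN mulr_gt0 // opprB subr_gt0.
have xI : x \in `]0, 1[.
  move: x01; rewrite !in_itv /= => /andP[x0' x1'].
  by rewrite !lt_neqAle x0' x1' !andbT eq_sym; apply/andP; split; apply/eqP.
have xI' : 0 <= x <= 1 by move: x01; rewrite in_itv.
have : is_derive x 1 G 0.
  apply: (@derive1_at_max _ G 0 1) => // t; rewrite in_itv /= => /andP[t0 t1].
    by apply: Gder; rewrite !ltW.
  by apply: xmax; rewrite in_itv /= !ltW.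
move=> [_]; rewrite GderE // => /eqP; rewrite subr_eq0; exact/negP/Fc.
Qed.

End Darboux.

Section Segments.
Variable R : realType.
Implicit Types (z w a : C R) (f g h : C R -> C R).

Definition on_segment z w (t : R) : C R := z + t%:C%C * (w - z).

Lemma on_segment_sub z w t u :
  on_segment z w t - on_segment z w u = (t - u)%:C%C * (w - z).
Proof. by rewrite /on_segment rmorphB /=; ring. Qed.

Lemma near_on_segment z w t (e : R) : 0 < e ->
  \forall u \near t, cnorm (on_segment z w u - on_segment z w t) < e.
Proof.
move=> e0.
have d0 : 0 < e / (cnorm (w - z) + 1).
  by rewrite divr_gt0 // ltr_wpDl ?cnorm_ge0.
apply: filterS (nbhsx_ballx t _ d0) => u; rewrite /ball /= distrC => ut.
rewrite on_segment_sub cnormM cnorm_real.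
have n0 : 0 < cnorm (w - z) + 1 by rewrite ltr_wpDl ?cnorm_ge0.
have : `|u - t| * (cnorm (w - z) + 1) < e by rewrite -ltr_pdivlMr.
apply: le_lt_trans; rewrite ler_wpM2l ?normr_ge0 //.
by rewrite lerDl.
Qed.

Lemma near_segment_comp z w t (P : C R -> Prop) :
  (\forall v \near on_segment z w t, P v) -> \forall u \near t, P (on_segment z w u).
Proof.
move=> /nearP_cnorm[e e0 eP]; apply: filterS (near_on_segment z w t e0) => u; exact: eP.
Qed.

Lemma on_segment0 z w : on_segment z w 0 = z.
Proof. by rewrite /on_segment mul0r addr0. Qed.

Lemma on_segment1 z w : on_segment z w 1 = w.
Proof. by rewrite /on_segment mul1r addrC subrK. Qed.

Lemma cnorm_segment a z w t (e : R) : 0 <= t <= 1 -> cnorm (z - a) < e -> cnorm (w - a) < e ->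
  cnorm (on_segment z w t - a) < e.
Proof.
move=> /andP[t0 t1] ze we.
have -> : on_segment z w t - a = (1 - t)%:C%C * (z - a) + t%:C%C * (w - a).
  by rewrite /on_segment rmorphB /= rmorph1; ring.
apply: le_lt_trans (cnormD _ _) _; rewrite !cnormM !cnorm_real !ger0_norm ?subr_ge0 //.
move: (cnorm (z - a)) (cnorm (w - a)) ze we => x y xe ye.
have [t0'|t0'] := eqVneq t 0; first by rewrite t0' subr0 mul1r mul0r addr0.
have : t * y < t * e by rewrite ltr_pM2l // lt_neqAle eq_sym t0' t0.
have : (1 - t) * x <= (1 - t) * e by rewrite ler_wpM2l ?subr_ge0 // ltW.
lra.
Qed.

Lemma segment_locally_constant (A : Type) (k : C R -> A) z w :
  (forall t, 0 <= t <= 1 -> \forall v \near on_segment z w t, k v = k (on_segment z w t)) ->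
  k w = k z.
Proof.
move=> kc; rewrite -[in LHS](on_segment1 z w) -[in RHS](on_segment0 z w).
apply: (@connected_locally_constant R `[0, 1] A (k \o on_segment z w)).
- exact: segment_connected.
- move=> t; rewrite /= in_itv /= => /kc/near_segment_comp.
  by apply: filterS => u -> _.
- by rewrite /= in_itv /= lexx ler01.
- by rewrite /= in_itv /= lexx ler01.
Qed.

Lemma Re_mulC (x : R) z : complex.Re (x%:C%C * z) = x * complex.Re z.
Proof. by case: z => a b /=; rewrite mul0r subr0. Qed.

(** Along a segment, the real part of [f] divided by the direction is a real function
    whose derivative is the real part of the derivative of [f]. *)
Lemma segment_cderiv f z w (t : R) l : has_cderiv f (on_segment z w t) l -> w != z ->
  has_cderiv (fun u => complex.Re (f (on_segment z w u) / (w - z))) t (complex.Re l).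
Proof.
move=> fl wz; set p := on_segment z w t in fl *.
have e : complex.Re (slope f p l p) = complex.Re l by rewrite /slope eqxx.
rewrite -e.
apply: (@cderivI _ _ (fun u => complex.Re (slope f p l (on_segment z w u)))).
  move=> U /nbhs_ballP[d /= d0 dU].
  have h := near_segment_comp (proj1 (continuous_cnormP _ _) fl d d0).
  have h' : \forall u \near t, U (complex.Re (slope f p l (on_segment z w u))).
    apply: filterS h => u hu; apply: dU; rewrite /ball /= distrC.
    apply: le_lt_trans hu; rewrite -raddfB /=; exact: cnorm_Re.
  exact: h'.
apply: (@filterE _ (nbhs t) _) => u.
rewrite (slopeE f p l (on_segment z w u)) on_segment_sub mulrDl raddfD /=; congr (_ + _).
by rewrite -Re_mulC; congr complex.Re; rewrite mulrAC mulfK ?subr_eq0.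
Qed.

End Segments.

Section DeriveContinuous.
Variable R : realType.
Implicit Types (z w a : C R) (f g h : C R -> C R).

Lemma cnorm_ge_Re z : complex.Re z <= cnorm z.
Proof. exact: le_trans (ler_norm _) (cnorm_Re z). Qed.

(** The factors [u + 1], [u - i] and [u + i] of [u ^+ 4 - 1] are bounded below in terms of
    the real part of [u]. *)
Lemma cnorm_exp4_sub1 u (x : R) : x <= complex.Re u -> 0 <= x ->
  cnorm (u - 1) * (x + 1) * x ^+ 2 <= cnorm (u ^+ 4 - 1).
Proof.
move=> xu x0; pose i : C R := (0 +i* 1)%C.
have i2 : i ^+ 2 = -1 by rewrite expr2 /i; apply/eqP; rewrite eq_complex /=; apply/andP; split; apply/eqP; ring.
have -> : u ^+ 4 - 1 = (u - 1) * (u + 1) * ((u - i) * (u + i)).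
  have -> : (u - i) * (u + i) = u ^+ 2 - i ^+ 2 by ring.
  by rewrite i2; ring.
rewrite !cnormM.
have h1 : x + 1 <= cnorm (u + 1) by apply: le_trans (cnorm_ge_Re _); rewrite raddfD /= lerD2r.
have h2 : x <= cnorm (u - i) by apply: le_trans (cnorm_ge_Re _); rewrite raddfB /= subr0.
have h3 : x <= cnorm (u + i) by apply: le_trans (cnorm_ge_Re _); rewrite raddfD /= addr0.
apply: ler_pM.
- by rewrite mulr_ge0 ?cnorm_ge0 // addr_ge0.
- by rewrite exprn_ge0.
- by apply: ler_wpM2l => //; exact: cnorm_ge0.
- by rewrite expr2; exact: ler_pM.
Qed.

(** Let [u] be the derivative divided by its value at [a].  Near [a] its fourth power
    is close to 1, so its real part never equals 1/2; by [darboux] along the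
    segment from [a], it stays larger than 1/2, and then [u] itself is close to 1. *)
Lemma derive_continuous f (Q : C R -> C R) a : (\forall z \near a, derivable f z 1) ->
  {for a, continuous Q} -> Q a != 0 ->
  (\forall z \near a, ('D_1 f z) ^+ 4 = Q z) -> {for a, continuous (fun z => 'D_1 f z)}.
Proof.
move=> df Qc Qa0 fQ; have fQa := nbhs_singleton fQ.
set s := 'D_1 f a in fQa.
have s0 : s != 0 by move: Qa0; rewrite -fQa expf_eq0.
have quart (x y v w : C R) : x ^+ 4 = v -> y ^+ 4 = w -> (x / y) ^+ 4 = v / w.
  by move=> <- <-; exact: expr_div_n.
pose u z := 'D_1 f z / s.
have uE z : 'D_1 f z = s * u z by rewrite /u mulrC divfK.
have ua : u a = 1 by rewrite /u -/s; exact (divff s0).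
have u4 (d : R) : 0 < d -> \forall z \near a, cnorm (u z ^+ 4 - 1) < d.
  move=> d0; have Qdc : {for a, continuous (fun z => Q z / Q a)}.
    exact (continuousM_at Qc (@continuous_cst_at _ _ a)).
  have h := proj1 (continuous_cnormP _ a) Qdc d d0.
  apply: filterS2 fQ h => z fz.
  by rewrite (divff Qa0) /u (quart _ _ _ _ fz fQa).
have main : \forall z \near a, 2^-1 < complex.Re (u z).
  have d0 : 0 < 3 / 16 :> R by lra.
  have /nearP_cnorm[e e0 eP] : \forall z \near a, derivable f z 1 /\ cnorm (u z ^+ 4 - 1) < 3 / 16.
    by apply: filterS2 df (u4 _ d0).
  apply/nearP_cnorm; exists e => // z za.
  have [->|zna] := eqVneq z a; first by rewrite ua /=; lra.
  pose p t := on_segment a z t.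
  have pe t : 0 <= t <= 1 -> cnorm (p t - a) < e.
    by move=> t01; apply: cnorm_segment => //; rewrite subrr /cnorm Normc.normc0.
  have := @darboux R (fun t => complex.Re (f (p t) / s / (z - a)))
    (fun t => complex.Re (u (p t))) 2^-1.
  rewrite /p on_segment0 on_segment1 ua; apply.
  - move=> t /pe /eP[dft _]; apply (@segment_cderiv R (fun v => f v / s) a z t (u (p t))); last exact zna.
    have e1 : slope f (p t) ('D_1 f (p t)) (p t) / s = u (p t).
      by rewrite /slope eqxx.
    rewrite -/(p t) -e1.
    apply (@cderivI (C R) (fun v => f v / s) (fun v => slope f (p t) ('D_1 f (p t)) v / s)).
      exact (continuousM_at (derivable_cderiv dft) (@continuous_cst_at _ _ _)).
    apply: (@filterE _ (nbhs (p t)) _) => v.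
    by rewrite (slopeE f (p t) ('D_1 f (p t)) v) mulrDl mulrA.
  - move=> t /pe /eP[_ ut]; apply/eqP => Re_u; move: ut; rewrite -/(p t); apply/negP.
    have Re_u1 : 2^-1 <= cnorm (u (p t) - 1).
      rewrite -cnormN; apply: le_trans (cnorm_ge_Re _); rewrite opprB raddfB /= Re_u; lra.
    have := @cnorm_exp4_sub1 (u (p t)) 2^-1; rewrite Re_u lexx invr_ge0 ler0n => /(_ isT isT) h.
    rewrite -leNgt; apply: le_trans h.
    by move: (cnorm _) Re_u1 => x; clear; lra.
  - by rewrite /=; lra.
have uc : {for a, continuous u}.
  apply/continuous_cnormP => e e0; have e1 : 0 < 3 / 8 * e by lra.
  apply: filterS2 main (u4 _ e1) => z z1 z2; rewrite ua.
  have := @cnorm_exp4_sub1 (u z) 2^-1 (ltW z1); rewrite invr_ge0 ler0n => /(_ isT) h.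
  have := le_lt_trans h z2; move: (cnorm _) => x; clear; lra.
have -> : (fun z => 'D_1 f z) = (fun z => s * u z) by apply/funext.
exact (continuousM_at (@continuous_cst_at _ s a) uc).
Qed.

End DeriveContinuous.

(** * Roots on punctured discs *)

Lemma int_parity (m : int) : exists k, m = k * 2 \/ m = k * 2 + 1.
Proof.
exists (m %/ 2)%Z; rewrite {1 3}(divz_eq m 2).
have := modz_ge0 m (isT : (2 : int) != 0); have := ltz_pmod m (isT : (0 : int) < 2).
by case: (modz m 2) => [[|[|n]]|n] // _ _; [left; rewrite addr0|right].
Qed.

Section FieldAlgebra.
Variable F : fieldType.
Implicit Types x y c d : F.

Lemma odd_ratio x y c d (k : int) : c != 0 -> d != 0 ->
  x ^+ 2 = c * (- d) ^ (k * 2 + 1) -> y ^+ 2 = c * d ^ (k * 2 + 1) -> (x / y) ^+ 2 = -1.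
Proof.
move=> c0 d0 x2 y2.
have dm : d ^ (k * 2 + 1) != 0 by rewrite expfz_neq0.
have s : (-1 : F) ^ (k * 2 + 1) = -1.
  rewrite expfzDr ?oppr_eq0 ?oner_eq0 // expr1z mulrC mulrC -exprz_exp.
  by rewrite exprzAC -[(-1) ^ 2]/((-1) ^+ 2) sqrrN expr1n exp1rz mul1r.
rewrite expr_div_n x2 y2 -[- d]mulN1r expfzMl s mulN1r mulrN mulNr.
by rewrite divff // mulf_neq0.
Qed.

Lemma pow_ratio x c d (e : nat) (k : int) : d != 0 ->
  x ^+ e = c * d ^ (k * e%:Z) -> (x / d ^ k) ^+ e = c.
Proof.
move=> d0 xe; rewrite expr_div_n xe [(d ^ k) ^+ e]exprnP exprz_exp mulfK //.
by rewrite expfz_neq0.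
Qed.

End FieldAlgebra.

Section PuncturedDisc.
Variable R : realType.
Implicit Types (z w a : C R) (f g h : C R -> C R).

Lemma real_mix_eq0 (x y : R) z : z != 0 -> (x%:C%C + y%:C%C * (0 +i* 1)%C : C R) * z = 0 ->
  x = 0 /\ y = 0.
Proof.
move=> z0 /eqP; rewrite mulf_eq0 (negbTE z0) orbF eq_complex /= => /andP[/eqP + /eqP].
by rewrite !mul0r !mulr0 !mulr1 subr0 !addr0 add0r.
Qed.

(** If the segment from [z] to [w] meets [a], then [w - a] is a negative multiple of
    [z - a], and a detour through the quarter turn of [z] around [a] avoids [a]. *)
Lemma segment_avoids z w a : z != a -> (forall t, 0 <= t <= 1 -> on_segment z w t != a) \/
  let u := a + (0 +i* 1)%C * (z - a) in w != a ->
  (forall t, 0 <= t <= 1 -> on_segment z u t != a) /\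
  (forall t, 0 <= t <= 1 -> on_segment u w t != a).
Proof.
move=> za; have [av|/existsNP[t /not_implyP[t01 /negP/negPn/eqP ta]]] :=
  pselect (forall t, 0 <= t <= 1 -> on_segment z w t != a); [by left|right].
move=> u wa; have Z0 : z - a != 0 by rewrite subr_eq0.
pose i : C R := (0 +i* 1)%C.
have tE : t%:C%C * (w - a) = - ((1 - t)%:C%C * (z - a)).
  apply/eqP; rewrite -addr_eq0; apply/eqP.
  transitivity (on_segment z w t - a); last by rewrite ta subrr.
  by rewrite /on_segment rmorphB /= rmorph1; ring.
split=> s _; apply/eqP => sa.
  have : ((1 - s)%:C%C + s%:C%C * i) * (z - a) = 0.
    transitivity (on_segment z u s - a); last by rewrite sa subrr.
    by rewrite /on_segment /u -/i rmorphB /= rmorph1; ring.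
  move=> /(real_mix_eq0 Z0)[s1 s0]; move: s1; rewrite s0 subr0; exact/eqP/oner_neq0.
have : ((- (s * (1 - t)))%:C%C + ((1 - s) * t)%:C%C * i) * (z - a) = 0.
  have -> : ((- (s * (1 - t)))%:C%C + ((1 - s) * t)%:C%C * i) * (z - a) =
    s%:C%C * - ((1 - t)%:C%C * (z - a)) + (1 - s)%:C%C * t%:C%C * i * (z - a).
    by rewrite rmorphN !rmorphM; ring.
  have -> : s%:C%C * - ((1 - t)%:C%C * (z - a)) + (1 - s)%:C%C * t%:C%C * i * (z - a) =
    t%:C%C * (on_segment u w s - a).
    rewrite -tE /on_segment /u -/i rmorphB /= rmorph1; ring.
  by rewrite sa subrr mulr0.
move=> /(real_mix_eq0 Z0)[/eqP + /eqP]; rewrite oppr_eq0 !mulf_eq0 => st st'.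
have t0 : t != 0.
  apply/eqP => t0; move: tE; rewrite t0 mul0r subr0 mul1r => /eqP.
  by rewrite eq_sym oppr_eq0 (negbTE Z0).
move: st'; rewrite (negbTE t0) orbF subr_eq0 => /eqP s1.
move: st; rewrite -s1 oner_eq0 /= subr_eq0 => /eqP t1.
move: tE; rewrite -t1 subrr mul1r mul0r oppr0 => /eqP; rewrite subr_eq0.
exact/negP.
Qed.

Lemma punctured_disc_constant (A : Type) (k : C R -> A) a (r : R) :
  (forall z, z != a -> cnorm (z - a) < r -> \forall v \near z, k v = k z) ->
  forall z w, z != a -> cnorm (z - a) < r -> w != a -> cnorm (w - a) < r -> k w = k z.
Proof.
move=> kc; have seg z w : cnorm (z - a) < r -> cnorm (w - a) < r ->
    (forall t, 0 <= t <= 1 -> on_segment z w t != a) -> k w = k z.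
  move=> zr wr av; apply: segment_locally_constant => t t01.
  by apply: kc; [exact: av|exact: cnorm_segment].
move=> z w za zr wa wr; have [av|] := segment_avoids w za; first exact: seg.
set u := a + _ => /(_ wa)[av1 av2].
have ur : cnorm (u - a) < r.
  have -> : u - a = (0 +i* 1)%C * (z - a) by rewrite /u addrC addKr.
  by rewrite cnormM {1}/cnorm /= expr0n expr1n /= add0r sqrtr1 mul1r.
by rewrite (seg u w) // (seg z u).
Qed.

Definition disc_continuous f a (r : R) :=
  forall z, z != a -> cnorm (z - a) < r -> {for z, continuous f}.

Lemma disc_root_of_unity f a r : disc_continuous f a r ->
  (forall z, z != a -> cnorm (z - a) < r -> f z ^+ 4 = 1) ->
  exists c, forall z, z != a -> cnorm (z - a) < r -> f z = c.
Proof.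
move=> fc f4.
have [[z0 [z0a z0r]]|no] := pselect (exists z, z != a /\ cnorm (z - a) < r); last first.
  by exists 0 => z za zr; exfalso; apply: no; exists z.
exists (f z0) => z za zr; apply: (@punctured_disc_constant _ f a r) => // {za zr}z za zr.
have near_in : \forall v \near z, v != a /\ cnorm (v - a) < r.
  have d0 : 0 < Num.min (cnorm (z - a)) (r - cnorm (z - a)).
    by rewrite lt_min cnorm_gt0 subr_eq0 za subr_gt0.
  apply: filterS (near_cnorm z d0) => v; rewrite lt_min => /andP[v1 v2].
  have va : v - a = (v - z) + (z - a) by rewrite addrA subrK.
  split; last by rewrite va; apply: le_lt_trans (cnormD _ _) _; rewrite -ltrBrDr.
  by apply/eqP => vE; move: v1; rewrite vE -cnormN opprB ltxx.
have g1 : (1 : C R) != 0 by exact: oner_neq0.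
have h : \forall v \near z, f v ^+ 4 = 1 ^+ 4.
  by apply: filterS near_in => v [va vr]; rewrite expr1n f4.
have := near_root_of_unity (fc z za zr) (@continuous_cst_at (C R) 1 z) g1 h.
by apply: filterS => v ->; rewrite mulr1 divr1.
Qed.

End PuncturedDisc.

Section PuncturedRoots.
Variable R : realType.
Implicit Types (z w a : C R) (f g h : C R -> C R).

Lemma punctured_disc_neq0 a (r : R) : 0 < r -> exists2 z : C R, z != a & cnorm (z - a) < r.
Proof.
move=> r0; have za : a + (r / 2)%:C%C - a = (r / 2)%:C%C :> C R by rewrite addrC addKr.
exists (a + (r / 2)%:C%C).
  by rewrite -subr_eq0 -cnorm_eq0 za cnorm_real normr_eq0 gt_eqF ?divr_gt0.
by rewrite za cnorm_real gtr0_norm ?divr_gt0 // ltr_pdivrMr // ltr_pMr // ltr1n.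
Qed.

Lemma continuousB_id a z : {for z, continuous (fun v : C R => v - a)}.
Proof. exact (continuousD_at (@continuous_id_at (C R) z) (@continuous_cst_at (C R) (- a) z)). Qed.

Lemma continuous_expz a z (k : int) : z != a -> {for z, continuous (fun v : C R => (v - a) ^ k)}.
Proof.
move=> za; have za0 : z - a != 0 by rewrite subr_eq0.
case: k => k; first exact (@continuousX_at (C R) _ k z (@continuousB_id a z)).
have := continuousV_at (@continuousX_at (C R) _ k.+1 z (@continuousB_id a z)).
by apply; rewrite expf_neq0.
Qed.

Lemma disc_pow_ratio f a r (k : int) (e : nat) : (e %| 4)%N ->
  disc_continuous f a r ->
  (forall z, z != a -> cnorm (z - a) < r -> f z ^+ e = (z - a) ^ (k * e%:Z)) ->
  exists d, forall z, z != a -> cnorm (z - a) < r -> f z = d * (z - a) ^ k.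
Proof.
move=> e4 fc fe.
have [|z za zr|d dE] := @disc_root_of_unity R (fun z => f z / (z - a) ^ k) a r.
- move=> z za zr.
  have zk0 : (z - a) ^ k != 0 by rewrite expfz_neq0 // subr_eq0.
  exact (continuousM_at (fc z za zr) (continuousV_at (@continuous_expz a z k za) zk0)).
- have : (f z / (z - a) ^ k) ^+ e = 1.
    by apply: pow_ratio; [rewrite subr_eq0|rewrite mul1r; exact: fe].
  by move=> h; rewrite -(divnK e4) mulnC exprM h expr1n.
exists d => z za zr; rewrite -(dE z za zr) divfK //.
by rewrite expfz_neq0 // subr_eq0.
Qed.

(** With [m] the reflection at [a], the quotient of [f] at [m z] and at [z] squares to -1,
    so it is a constant [d]; but the values of this quotient at [z] and at
    [m z] are inverse to each other, so [d ^+ 2 = 1]. *)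
Lemma disc_no_odd_sqrt f a r (c : C R) (k : int) : 0 < r -> c != 0 ->
  disc_continuous f a r ->
  (forall z, z != a -> cnorm (z - a) < r -> f z ^+ 2 = c * (z - a) ^ (k * 2 + 1)) -> False.
Proof.
move=> r0 c0 fc fe.
pose m z := a *+ 2 - z.
have ma z : m z - a = - (z - a) by rewrite /m; ring.
have mK z : m (m z) = z by rewrite /m; ring.
have mza z : z != a -> m z != a by rewrite -[m z == a]subr_eq0 ma oppr_eq0 subr_eq0.
have mzr z : cnorm (z - a) < r -> cnorm (m z - a) < r by rewrite ma cnormN.
have mc z : {for z, continuous m}.
  exact (continuousD_at (@continuous_cst_at (C R) (a *+ 2) z)
    (continuousN_at (@continuous_id_at (C R) z))).
have f0 z : z != a -> cnorm (z - a) < r -> f z != 0.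
  move=> za zr; have : f z ^+ 2 != 0.
    by rewrite fe // mulf_neq0 // expfz_neq0 // subr_eq0.
  by rewrite expf_eq0.
have p2 z : z != a -> cnorm (z - a) < r -> (f (m z) / f z) ^+ 2 = -1.
  move=> za zr; apply: (@odd_ratio _ _ _ c (z - a) k) => //; first by rewrite subr_eq0.
    by rewrite -ma fe ?mza ?mzr.
  exact: fe.
have [z za zr|z za zr|d dE] := @disc_root_of_unity R (fun z => f (m z) / f z) a r.
- have fmc : {for z, continuous (f \o m)}.
    apply: continuous_comp; [exact: mc|exact: (fc _ (mza z za) (mzr z zr))].
  exact (continuousM_at fmc (continuousV_at (fc z za zr) (f0 z za zr))).
- by rewrite -[4%N]/(2 * 2)%N exprM p2 // sqrrN expr1n.
have [z z_a zr] := punctured_disc_neq0 a r0.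
have d1 := dE z z_a zr; have d2 := dE (m z) (mza z z_a) (mzr z zr).
have := p2 z z_a zr; rewrite /= in d1 d2; rewrite mK in d2.
rewrite expr2 {1}d1 -d2 mulrA (divfK (f0 _ (mza z z_a) (mzr z zr))) (divff (f0 z z_a zr)).
by move=> /eqP; rewrite -addr_eq0 -mulr2n pnatr_eq0.
Qed.

(** For [e = 4], the square of [f] is a square root, hence a constant multiple of a power
    of [z - a], and the argument for square roots applies a second time. *)
Lemma disc_root f a r (m : int) (e : nat) : 0 < r -> (e %| 4)%N -> disc_continuous f a r ->
  (forall z, z != a -> cnorm (z - a) < r -> f z ^+ e = (z - a) ^ m) ->
  exists k d, m = k * e%:Z /\
    forall z, z != a -> cnorm (z - a) < r -> f z = d * (z - a) ^ k.
Proof.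
move=> r0 e4 fc fe.
suff [k mk] : exists k, m = k * e%:Z.
  have [|d dE] := @disc_pow_ratio f a r k e e4 fc.
    by move=> z za zr; rewrite -mk; exact: fe.
  by exists k, d.
have even g (l : int) (c : C R) : c != 0 -> disc_continuous g a r ->
    (forall z, z != a -> cnorm (z - a) < r -> g z ^+ 2 = c * (z - a) ^ l) ->
    exists k, l = k * 2.
  move=> c0 gc ge; have [k [->|lk]] := int_parity l; first by exists k.
  exfalso; apply: (@disc_no_odd_sqrt g a r c k) => //.
  by move=> z za zr; rewrite -lk; exact: ge.
have e124 : [|| e == 1, e == 2 | e == 4]%N by move: e4; clear; case: e => [|[|[|[|[|e]]]]] // /dvdn_leq; apply.
case/or3P: e124 => /eqP ee; subst e.
- by exists m; rewrite mulr1.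
- apply: (even f m 1 (oner_neq0 _) fc) => z za zr; rewrite mul1r; exact: fe.
have f2c : disc_continuous (fun z => f z ^+ 2) a r.
  by move=> z za zr; exact (@continuousX_at (C R) f 2 z (fc z za zr)).
have f22 z : z != a -> cnorm (z - a) < r -> (f z ^+ 2) ^+ 2 = (z - a) ^ m.
  by move=> za zr; rewrite -exprM; exact: fe.
have [k mk] : exists k, m = k * 2.
  by apply: (even _ m 1 (oner_neq0 _) f2c) => z za zr; rewrite mul1r; exact: f22.
have [|d dE] := @disc_pow_ratio _ a r k 2 isT f2c.
  by move=> z za zr; rewrite -mk; exact: f22.
have d0 : d != 0.
  have [z z_a zr] := punctured_disc_neq0 a r0.
  apply/eqP => d0; have := f22 z z_a zr; rewrite dE // d0 mul0r expr0n /= => /eqP.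
  by rewrite eq_sym; apply/negP; rewrite expfz_neq0 // subr_eq0.
have [l kl] := even f k d d0 fc dE.
by exists l; rewrite mk kl -mulrA.
Qed.

End PuncturedRoots.

(** * Orders of meromorphic functions *)

Section Orders.
Variable R : realType.
Implicit Types (z w a : C R) (f g h : C R -> C R).

(** Divide [f] by a holomorphic [e]-th root of [g]; the quotient is an [e]-th root of a
    power of [z - a] on a punctured disc. *)
Lemma puncture_root f g a (m : int) (e : nat) : (e %| 4)%N ->
  (\forall z \near a, derivable g z 1) -> g a != 0 ->
  (\forall z \near a, z != a -> {for z, continuous f} /\ f z ^+ e = (z - a) ^ m * g z) ->
  exists k h, [/\ m = k * e%:Z, \forall z \near a, derivable h z 1, h a != 0 &
    \forall z \near a, z != a -> f z = (z - a) ^ k * h z].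
Proof.
move=> e4 dg ga0 fg.
have [s sa] := exists_root4 (g a).
have [h0 [dh0 h0a h0g]] := holomorphic_root4 dg sa ga0.
have gc := derivable_continuous_at (nbhs_singleton dg).
have gn0 := continuous_neq0 gc ga0.
pose h1 z := h0 z ^+ (4 %/ e).
have h1e z : h0 z ^+ 4 = g z -> h1 z ^+ e = g z by rewrite /h1 -exprM divnK.
have /nearP_cnorm[r r0 rP] : \forall z \near a, [/\ derivable h0 z 1, h0 z ^+ 4 = g z, g z != 0 &
    z != a -> {for z, continuous f} /\ f z ^+ e = (z - a) ^ m * g z].
  near=> z; split; near: z; [exact dh0|exact h0g|exact gn0|exact fg].
have e0 : (0 < e)%N by rewrite (dvdn_gt0 _ e4).
have h10 z : cnorm (z - a) < r -> h1 z != 0.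
  move=> /rP[_ /h1e hz gz _]; move: gz; rewrite -hz expf_eq0 e0 //.
pose F z := f z / h1 z.
have Fc : disc_continuous F a r.
  move=> z za zr; have [dz _ _ /(_ za)[fc _]] := rP z zr.
  have h1c : {for z, continuous h1}.
    exact (@continuousX_at (C R) h0 (4 %/ e) z (derivable_continuous_at dz)).
  exact (continuousM_at fc (continuousV_at h1c (h10 z zr))).
have Fe z : z != a -> cnorm (z - a) < r -> F z ^+ e = (z - a) ^ m.
  move=> za zr; have [_ /h1e hz gz /(_ za)[_ fz]] := rP z zr.
  by rewrite expr_div_n fz hz mulfK.
have [k [d [mk dE]]] := disc_root r0 e4 Fc Fe.
have ar : cnorm (a - a) < r by rewrite subrr /cnorm Normc.normc0.
exists k, (fun z => d * h1 z); split; first exact mk.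
- apply: filterS dh0 => z dz.
  exact (derivableM_at (@derivable_cst_at (C R) d z) (@derivableX_at (C R) h0 (4 %/ e) z dz)).
- apply: mulf_neq0; last exact (h10 a ar).
  have [z z_a zr] := punctured_disc_neq0 a r0.
  apply/eqP => d0; have := Fe z z_a zr; rewrite dE // d0 mul0r expr0n eqn0Ngt e0 /= => /eqP.
  by rewrite eq_sym; apply/negP; rewrite expfz_neq0 // subr_eq0.
- apply/nearP_cnorm; exists r => // z zr za; have := dE z za zr.
  rewrite /F => /(congr1 (fun v => v * h1 z)); rewrite divfK ?h10 // => ->.
  by rewrite -mulrA mulrCA.
Unshelve. all: by end_near. Qed.

(** Dividing two expressions of different orders by the smaller power leaves a
    function that is both nonzero and zero at [a]. *)
Lemma order_at_unique f a m m' : order_at f a m -> order_at f a m' -> m = m'.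
Proof.
have main l l' : order_at f a l -> order_at f a l' -> ~ l < l'.
  move=> [g [dg ga fg]] [g' [dg' ga' fg']]; rewrite -subr_gt0.
  case ll: (l' - l) => [[|n]|n] // _.
  have gc := derivable_continuous_at (nbhs_singleton dg).
  have gc' := derivable_continuous_at (nbhs_singleton dg').
  have hc : {for a, continuous (fun z => (z - a) ^+ n.+1 * g' z)}.
    exact (continuousM_at (@continuousX_at (C R) _ n.+1 a (@continuousB_id R a a)) gc').
  have /eqP := ga; apply.
  rewrite (continuous_dnbhs_eq gc hc) ?subrr ?expr0n ?mul0r //.
  apply: filterS2 fg fg' => z -> h za; have za0 : z - a != 0 by rewrite subr_eq0.
  apply: (mulfI (expfz_neq0 l za0)); rewrite h mulrA; congr (_ * _).
  by rewrite exprnP -expfzDr // -ll (addrC l) subrK.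
by move=> fm fm'; apply/eqP; rewrite eq_le !leNgt; apply/andP; split; apply/negP; apply: main.
Qed.

Lemma order_at_pow f a m (e : nat) : order_at f a m ->
  order_at (fun z => f z ^+ e) a (m * e%:Z).
Proof.
move=> [g [dg ga fg]]; exists (fun z => g z ^+ e); split.
- by apply: filterS dg => z dz; exact (@derivableX_at (C R) g e z dz).
- by rewrite expf_neq0.
- by apply: filterS fg => z ->; rewrite exprMn [((z - a) ^ m) ^+ e]exprnP exprz_exp.
Qed.

Lemma order_at0 f a : order_at f a 0 -> (\forall z \near a, derivable f z 1) /\ f a != 0.
Proof.
move=> [g [dg ga fg]].
have fg' : \forall z \near a, g z = f z by apply: filterS fg => z ->; rewrite expr0z mul1r.
split; last by rewrite -(nbhs_singleton fg').
apply: filterS2 (near_join fg') dg => z fgz; exact: near_derivable.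
Qed.

Lemma order_at0I f a : (\forall z \near a, derivable f z 1) -> f a != 0 -> order_at f a 0.
Proof.
move=> df fa; exists f; split; [exact df|exact fa|].
by apply: (@filterE _ (nbhs a) _) => z; rewrite expr0z mul1r.
Qed.

Lemma near_order_at f g a m : {near a, f =1 g} -> order_at f a m -> order_at g a m.
Proof.
move=> fg [h [dh ha fh]]; exists h; split; [exact dh|exact ha|].
by apply: filterS2 fg fh => z <-.
Qed.

Lemma order_at_near_neq0 f a m : order_at f a m -> \forall z \near a, z != a -> f z != 0.
Proof.
move=> [g [dg ga fg]].
have gn0 := continuous_neq0 (derivable_continuous_at (nbhs_singleton dg)) ga.
by apply: filterS2 gn0 fg => z gz -> za; rewrite mulf_neq0 // expfz_neq0 // subr_eq0.
Qed.

Lemma meromorphic_root_order f g a m (e : nat) : (0 < e)%N -> meromorphic_at f a ->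
  (\forall z \near a, g z = f z ^+ e) -> order_at g a m ->
  exists2 k, m = k * e%:Z & order_at f a k.
Proof.
move=> e0 [f0|[k fk]] gf gm; last first.
  exists k; last exact fk.
  apply: order_at_unique gm _; apply: near_order_at (order_at_pow e fk).
  by apply: filterS gf => z ->.
have g0 : \forall z \near a, g z = 0.
  by apply: filterS2 gf f0 => z -> ->; rewrite expr0n eqn0Ngt e0.
have /nearP_cnorm[r r0 rP] : \forall z \near a, z != a -> False.
  apply: filterS2 (order_at_near_neq0 gm) g0 => z gz gz0 /gz.
  by rewrite gz0 eqxx.
by have [z za /rP/(_ za)] := punctured_disc_neq0 a r0.
Qed.

End Orders.

(** * Charts and germs of sections *)

Section Charts.
Variables (R : realType) (X : topologicalType) (S : compact_riemann_surface R X).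
Implicit Types (x y : X) (i j k : chart_index S) (s t w : section S).

Lemma near_param i x (P : X -> Prop) : dom i x -> (\forall y \near x, P y) ->
  \forall z \near chart i x, P (param i z).
Proof.
move=> ix Px; have := @param_continuous R X S i x ix P.
by rewrite chartK //; apply.
Qed.

Lemma near_chart i x (Q : C R -> Prop) : dom i x -> (\forall z \near chart i x, Q z) ->
  \forall y \near x, Q (chart i y).
Proof. by move=> ix Qx; exact: (@chart_continuous R X S i x ix Q). Qed.

Lemma near_dom i x : dom i x -> \forall y \near x, dom i y.
Proof. by move=> ix; apply: open_nbhs_nbhs; split=> //; exact: dom_open. Qed.

Lemma near_codom i x : dom i x -> 
  \forall z \near chart i x, dom i (param i z) /\ chart i (param i z) = z.
Proof.
move=> ix; have : nbhs (chart i x) (chart i @` dom i).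
  by apply: open_nbhs_nbhs; split; [exact: codom_open|exists x].
by apply: filterS => z [y iy <-]; rewrite chartK.
Qed.

Definition transition i j x := 'D_1 (chart j \o param i) (chart i x).

Lemma transition_comp i j k x : dom i x -> dom j x -> dom k x ->
  transition i k x = transition i j x * transition j k x.
Proof.
move=> ix jx kx; rewrite /transition.
have dij := transition_holomorphic ix jx.
have djk := transition_holomorphic jx kx.
have e : (chart j \o param i) (chart i x) = chart j x by rewrite /= chartK.
rewrite -e in djk *.
have [dc Dc] := derivable_comp dij djk.
rewrite [RHS]mulrC -Dc; symmetry; apply: near_derive; last exact dc.
have := near_param ix (near_dom jx).
by apply: filterS => z jz /=; rewrite chartK.
Qed.

Lemma transition_id i x : dom i x -> transition i i x = 1.
Proof.
move=> ix; have [d1 D1] := derivable_id_at (chart i x).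
rewrite /transition -[RHS]D1; symmetry.
apply (@near_derive (C R) (fun z => z) (chart i \o param i)); last exact d1.
by apply: filterS (near_codom ix) => z [_ /= ->].
Qed.

Lemma transformsE d s x i j : transforms d s x -> dom i x -> dom j x ->
  s i x = s j x * transition i j x ^+ d.
Proof. by move=> sx ix jx; exact: sx. Qed.

Lemma transforms_pow d e s x : transforms d s x -> transforms (d * e) (section_pow s e) x.
Proof. by move=> sx i j ix jx; rewrite /section_pow (sx i j ix jx) exprMn -exprM. Qed.

Lemma transforms_scale d (b : C R) s x : transforms d s x ->
  transforms d (fun i y => b * s i y) x.
Proof. by move=> sx i j ix jx; rewrite (sx i j ix jx) mulrA. Qed.

(** A constant ratio in one chart is the same constant in all charts, since both
    sections transform by the same factor. *)
Lemma germ_ratio d s t x i (b : C R) : dom i x ->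
  (\forall y \near x, transforms d s y) -> (\forall y \near x, transforms d t y) ->
  (\forall y \near x, s i y = b * t i y) -> germ_eq s (fun j y => b * t j y) x.
Proof.
move=> ix sx tx st; rewrite /germ_eq; near=> y => j jy.
have iy : dom i y by near: y; exact: near_dom.
have sy : transforms d s y by near: y.
have ty : transforms d t y by near: y.
rewrite (transformsE sy jy iy) (transformsE ty jy iy) mulrA; congr (_ * _).
by near: y.
Unshelve. all: by end_near. Qed.

Lemma germ_eq_refl s x : germ_eq s s x.
Proof. by apply: (@filterE _ (nbhs x) _) => y. Qed.

Lemma germ_eq_sym s t x : germ_eq s t x -> germ_eq t s x.
Proof. by apply: filterS => y st i iy; rewrite st. Qed.

Lemma germ_eq_trans s t w x : germ_eq s t x -> germ_eq t w x -> germ_eq s w x.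
Proof. by move=> st tw; apply: filterS2 st tw => y h1 h2 i iy; rewrite h1 // h2. Qed.

Lemma germ_eq_scale (b : C R) s t x : germ_eq s t x ->
  germ_eq (fun i y => b * s i y) (fun i y => b * t i y) x.
Proof. by apply: filterS => y h i iy; rewrite h. Qed.

Lemma germ_eq_near s t x : germ_eq s t x -> \forall y \near x, germ_eq s t y.
Proof. exact: near_join. Qed.

Lemma germ_eq_at s t x i : germ_eq s t x -> dom i x -> s i x = t i x.
Proof. by move=> /nbhs_singleton h; exact: h. Qed.

Lemma local_fourth_root_near q w x : local_fourth_root q w x ->
  \forall y \near x, local_fourth_root q w y.
Proof. exact: near_join. Qed.

End Charts.

(** * Local fourth roots on the surface *)

Section LocalRoots.
Variables (R : realType) (X : topologicalType) (S : compact_riemann_surface R X).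
Variables (q : section S) (D : X -> int).
Hypotheses (merq : meromorphic_section 4 q) (divq : has_divisor q D).
Implicit Types (x y : X) (i j k : chart_index S) (s t w : section S).

Lemma regular_expr i x : dom i x -> D x = 0 ->
  (\forall z \near chart i x, derivable (local_expr q i) z 1) /\ q i x != 0.
Proof.
move=> ix Dx; have := divq ix; rewrite Dx => /order_at0.
by rewrite /local_expr /= chartK.
Qed.

(** A holomorphic root [h] in the chart [i] determines the coefficients in all other
    charts.  There they involve the derivative of the transition map; its fourth
    power is a quotient of coefficients of [q], so it is continuous by
    [derive_continuous], and a continuous fourth root of [q] is holomorphic. *)
Lemma local_root_exists x i (v : C R) : (\forall y \near x, D y = 0) -> dom i x ->
  v ^+ 4 = q i x -> exists w, local_fourth_root q w x /\ w i x = v.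
Proof.
move=> Dx ix vq; have [dq qx0] := regular_expr ix (nbhs_singleton Dx).
have [||h [dh ha hq]] := @holomorphic_root4 R (local_expr q i) (chart i x) v dq.
- by rewrite /local_expr /= chartK.
- by rewrite /local_expr /= chartK.
pose w : section S := fun j y => h (chart i y) * transition j i y.
exists w; split; last by rewrite /w transition_id // mulr1.
have N : \forall y \near x, [/\ dom i y, h (chart i y) ^+ 4 = q i y,
    derivable h (chart i y) 1 & D y = 0].
  near=> y; have iy : dom i y by near: y; exact: near_dom.
  split => //; last by near: y; exact Dx.
    rewrite -[in RHS](chartK iy) -[RHS]/(local_expr q i (chart i y)).
    by near: y; exact (near_chart ix hq).
  by near: y; exact (near_chart ix dh).
apply: filterS (near_join N) => y Ny; have [iy hy dhy Dy] := nbhs_singleton Ny.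
have w4 j y' : dom j y' -> dom i y' -> h (chart i y') ^+ 4 = q i y' -> w j y' ^+ 4 = q j y'.
  move=> jy iy' hy'; rewrite /w exprMn hy' -transformsE //.
  by have [] := merq y'.
split.
  move=> j k jy ky; rewrite /w expr1 -mulrA mulrC [RHS]mulrC; congr (_ * _).
  rewrite -/(transition j k y) mulrC; exact: transition_comp.
move=> j jy; split; last exact: w4.
have [dqj qj0] := regular_expr jy Dy.
have [dqi qi0] := regular_expr iy Dy.
set b := chart j y in dqj *.
(* By the transformation rule of [q], the derivative of this transition map has
   fourth power [Q]. *)
pose tau := chart i \o param j.
have taub : tau b = chart i y by rewrite /tau /b /= chartK.
have Nb := near_param jy Ny.
have Cb := near_codom jy.
have Eb := near_param jy (near_dom iy).
have dtau : \forall z \near b, derivable tau z 1.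
  apply: filterS2 Cb Eb => z [jz cz] iz.
  by have := transition_holomorphic jz iz; rewrite cz.
have tauc : {for b, continuous tau} := derivable_continuous_at (nbhs_singleton dtau).
have qitc : {for b, continuous (local_expr q i \o tau)}.
  have c1 : {for tau b, continuous (local_expr q i)}.
    by rewrite taub; exact (derivable_continuous_at (nbhs_singleton dqi)).
  by apply: (@continuous_comp _ _ _ tau (local_expr q i)); [exact tauc|exact c1].
have qjc := derivable_continuous_at (nbhs_singleton dqj).
have qit0 : (local_expr q i \o tau) b != 0 by rewrite /= taub /local_expr /= chartK.
have qjb0 : local_expr q j b != 0 by rewrite /local_expr /b /= chartK.
pose Q z := local_expr q j z / (local_expr q i \o tau) z.
have Qc : {for b, continuous Q} := continuousM_at qjc (continuousV_at qitc qit0).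
have Qb : Q b != 0 by rewrite /Q mulf_neq0 // invr_eq0.
have tQ : \forall z \near b, ('D_1 tau z) ^+ 4 = Q z.
  have n0 := continuous_neq0 qitc qit0.
  near=> z; have [jz cz] : dom j (param j z) /\ chart j (param j z) = z by near: z; exact Cb.
  have iz : dom i (param j z) by near: z; exact Eb.
  have nz : (local_expr q i \o tau) z != 0 by near: z; exact n0.
  have e : local_expr q j z = (local_expr q i \o tau) z * 'D_1 tau z ^+ 4.
    rewrite /local_expr /tau /= chartK //; have [tq _] := merq (param j z).
    by rewrite (transformsE tq jz iz) /transition cz.
  by rewrite /Q e mulrC mulKf.
have dtc := derive_continuous dtau Qc Qb tQ.
pose W z := h (tau z) * 'D_1 tau z.
have Wc : {for b, continuous W}.
  apply: continuousM_at; last exact dtc.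
  have c1 : {for tau b, continuous h} by rewrite taub; exact (derivable_continuous_at dhy).
  by apply: (@continuous_comp _ _ _ tau h); [exact tauc|exact c1].
have WE : \forall z \near b, W z = local_expr w j z.
  by apply: filterS Cb => z [jz cz]; rewrite /W /local_expr /w /= /transition cz.
apply: (near_derivable WE).
have W4 : \forall z \near b, W z ^+ 4 = local_expr q j z.
  near=> z; have [jz cz] : dom j (param j z) /\ chart j (param j z) = z by near: z; exact Cb.
  have -> : W z = local_expr w j z by near: z.
  rewrite /local_expr /=.
  have [iz hz _ _] : [/\ dom i (param j z), h (chart i (param j z)) ^+ 4 = q i (param j z),
    derivable h (chart i (param j z)) 1 & D (param j z) = 0] by near: z; exact Nb.
  exact: w4.
have Wb : W b != 0.
  by have := nbhs_singleton W4; move: qjb0 => /[swap] <-; rewrite expf_eq0.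
exact (@derivable_root (C R) W (local_expr q j) 4 b isT Wc Wb W4 (nbhs_singleton dqj)).
Unshelve. all: by end_near. Qed.

Lemma local_root_continuous w x i : local_fourth_root q w x -> dom i x ->
  {for chart i x, continuous (local_expr w i)}.
Proof.
move=> /nbhs_singleton[_ h] ix; exact (derivable_continuous_at (proj1 (h i ix))).
Qed.

Lemma local_root_pow w x i : local_fourth_root q w x -> dom i x -> w i x ^+ 4 = q i x.
Proof. by move=> /nbhs_singleton[_ h] ix; have [] := h i ix. Qed.

Lemma local_root_neq0 w x i : D x = 0 -> local_fourth_root q w x -> dom i x -> w i x != 0.
Proof.
move=> Dx wx ix; have [_ qx] := regular_expr ix Dx.
by move: qx; rewrite -(local_root_pow wx ix) expf_eq0.
Qed.

Lemma germ_fourth_ratio d s t x i : dom i x ->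
  (\forall y \near x, transforms d s y) -> (\forall y \near x, transforms d t y) ->
  {for chart i x, continuous (local_expr s i)} ->
  {for chart i x, continuous (local_expr t i)} -> t i x != 0 ->
  (\forall y \near x, s i y ^+ 4 = t i y ^+ 4) ->
  germ_eq s (fun j y => s i x / t i x * t j y) x.
Proof.
move=> ix sx tx sc tc t0 st; apply: (germ_ratio ix sx tx).
have t0' : local_expr t i (chart i x) != 0 by rewrite /local_expr /= chartK.
have st' := near_param ix st.
have := near_chart ix (near_root_of_unity sc tc t0' st').
apply: filterS2 (near_dom ix) => y iy.
by rewrite /local_expr /= !chartK.
Qed.

Lemma local_root_ratio w w' x i : D x = 0 -> local_fourth_root q w x ->
  local_fourth_root q w' x -> dom i x ->
  germ_eq w' (fun j y => w' i x / w i x * w j y) x.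
Proof.
move=> Dx wx wx' ix; apply: (@germ_fourth_ratio 1) => //.
- by apply: filterS wx' => y [].
- by apply: filterS wx => y [].
- exact: local_root_continuous.
- exact: local_root_continuous.
- exact: (local_root_neq0 Dx wx ix).
- near=> y; have iy : dom i y by near: y; exact: near_dom.
  have wy : local_fourth_root q w y by near: y; exact: local_fourth_root_near.
  have wy' : local_fourth_root q w' y by near: y; exact: local_fourth_root_near.
  by rewrite (local_root_pow wy iy) (local_root_pow wy' iy).
Unshelve. all: by end_near. Qed.

End LocalRoots.

(** * The local system of fourth roots *)

Section PowersOfI.
Variable R : realType.

Definition ipow (k : 'Z_4) : C R := 'i ^+ k.

Lemma imag_prim : 4.-primitive_root ('i : C R).
Proof.
have N1 : (-1 : C R) != 1.
  by rewrite eq_sym -addr_eq0 -mulr2n pnatr_eq0.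
have i1 : ('i : C R) != 1.
  by apply/eqP => i1; move: N1; rewrite -(sqrCi (C R)) i1 expr1n eqxx.
apply/andP; split=> //; apply/forallP => -[[|[|[|[|]]]] // ?]; rewrite unity_rootE /=.
- by rewrite expr1 (negbTE i1).
- by rewrite sqrCi (negbTE N1).
- rewrite exprS sqrCi mulrN1; apply/eqP/negbTE/eqP => i1'.
  by move: N1; rewrite -(sqrCi (C R)) -sqrrN i1' expr1n eqxx.
- by rewrite -[4%N]/(2 * 2)%N exprM sqrCi sqrrN expr1n !eqxx.
Qed.

Lemma ipowD k l : ipow (k + l) = ipow k * ipow l.
Proof. by rewrite /ipow -exprD /= (prim_expr_mod imag_prim). Qed.

Lemma ipow0 : ipow 0 = 1. Proof. by []. Qed.

Lemma ipow_neq0 k : ipow k != 0.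
Proof. by rewrite expf_neq0 // neq0Ci. Qed.

Lemma ipow_inj : injective ipow.
Proof.
move=> k l /eqP; rewrite /ipow (eq_prim_root_expr imag_prim).
by rewrite !modn_small ?ltn_ord // => /eqP; exact: val_inj.
Qed.

Lemma ipow_exp4 k : ipow k ^+ 4 = 1.
Proof. by rewrite /ipow exprAC (prim_expr_order imag_prim) expr1n. Qed.

Lemma ipow_surj (x : C R) : x ^+ 4 = 1 -> exists k, x = ipow k.
Proof. by move=> /(prim_rootP imag_prim)[k ->]; exists k. Qed.

End PowersOfI.

Section RootSystem.
Variables (R : realType) (X : topologicalType) (S : compact_riemann_surface R X).
Variables (q : section S) (D : X -> int).
Hypotheses (merq : meromorphic_section 4 q) (divq : has_divisor q D).
Variables (n : nat) (c : 'I_n -> X).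
Hypothesis Dreg : forall x, punctured c x -> \forall y \near x, D y = 0.
Implicit Types (x : X) (i j : chart_index S) (w : section S).

Notation Y := (punctured c).

Definition iscale (a : 'Z_4) w : section S := fun i x => ipow R a * w i x.

Lemma iscaleA a b w : iscale a (iscale b w) = iscale (a + b) w.
Proof. by apply/funext => i; apply/funext => x; rewrite /iscale ipowD mulrA. Qed.

Lemma germ_eq_iscale a w w' x : germ_eq w w' x -> germ_eq (iscale a w) (iscale a w') x.
Proof. exact: germ_eq_scale. Qed.

Lemma local_fourth_root_iscale a w x : local_fourth_root q w x ->
  local_fourth_root q (iscale a w) x.
Proof.
apply: filterS => y [tw rw]; split; first exact: transforms_scale.
move=> i iy; have [dw w4] := rw i iy; split.
  exact (derivableM_at (@derivable_cst_at (C R) (ipow R a) (chart i y)) dw).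
by rewrite /iscale exprMn ipow_exp4 mul1r.
Qed.

Lemma root_index w w' x : D x = 0 -> local_fourth_root q w x ->
  local_fourth_root q w' x -> exists a, germ_eq w' (iscale a w) x.
Proof.
move=> Dx wx wx'; have [i ix] := dom_cover S x.
have w0 := local_root_neq0 divq Dx wx ix.
have [|a aE] := @ipow_surj R (w' i x / w i x).
  by rewrite expr_div_n (local_root_pow wx ix) (local_root_pow wx' ix) divff //
    -(local_root_pow wx ix) expf_neq0.
exists a; rewrite /iscale -aE; exact (local_root_ratio divq Dx wx wx' ix).
Qed.

Lemma root_index_unique w w' x a b : D x = 0 -> local_fourth_root q w x ->
  germ_eq w' (iscale a w) x -> germ_eq w' (iscale b w) x -> a = b.
Proof.
move=> Dx wx wa wb; have [i ix] := dom_cover S x.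
have w0 := local_root_neq0 divq Dx wx ix.
apply: (@ipow_inj R); apply: (mulIf w0).
by rewrite -[LHS]/(iscale a w i x) -(germ_eq_at wa ix) (germ_eq_at wb ix).
Qed.

Lemma punctured_regular (y : Y) : D (set_val y) = 0.
Proof. exact: (nbhs_singleton (Dreg (set_valP y))). Qed.

Lemma root_at_exists (y : Y) : exists w, local_fourth_root q w (set_val y).
Proof.
have [i iy] := dom_cover S (set_val y).
have [v vq] := exists_root4 (q i (set_val y)).
have [w [wy _]] := local_root_exists merq divq (Dreg (set_valP y)) iy vq.
by exists w.
Qed.

Definition root_at (y : Y) : section S := sval (cid (root_at_exists y)).

Lemma root_atP (y : Y) : local_fourth_root q (root_at y) (set_val y).
Proof. by rewrite /root_at; case: cid. Qed.

(** Meaningful as long as [root_at y0] is still a fourth root at [y]; the default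
    value 0 occurs only outside that region. *)
Definition root_shift (y0 y : Y) : 'Z_4 :=
  xget 0 [set a | germ_eq (root_at y0) (iscale a (root_at y)) (set_val y)].

Lemma near_punctured (y0 : Y) (P : X -> Prop) :
  (\forall x \near set_val y0, P x) -> \forall y \near y0, P (set_val y).
Proof. by move=> Px; exact: (@initial_continuous _ _ set_val y0 P Px). Qed.

Lemma root_shift_eq (y0 y : Y) a :
  germ_eq (root_at y0) (iscale a (root_at y)) (set_val y) -> root_shift y0 y = a.
Proof.
move=> ha; have h : [set a | germ_eq (root_at y0) (iscale a (root_at y)) (set_val y)]
    (root_shift y0 y) by apply: xgetPex; exists a.
exact (root_index_unique (punctured_regular y) (root_atP y) h ha).
Qed.

Lemma root_shiftP (y0 : Y) : \forall y \near y0,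
  germ_eq (root_at y0) (iscale (root_shift y0 y) (root_at y)) (set_val y).
Proof.
have := near_punctured (local_fourth_root_near (root_atP y0)).
apply: filterS => y yr.
have [a ha] := root_index (punctured_regular y) (root_atP y) yr.
by rewrite (root_shift_eq ha).
Qed.

Lemma root_shift_local_system : local_system root_shift.
Proof.
move=> y0; have h0 := root_shiftP y0.
apply: filterS h0 => y1 g01.
apply: filterS2 (near_punctured (germ_eq_near g01)) (root_shiftP y1) => y2 h1 h2.
apply: root_shift_eq; apply: germ_eq_trans h1 _.
by rewrite -iscaleA; exact: germ_eq_iscale.
Qed.

Notation TP := root_shift_local_system.

(** Lifts to the local system [root_shift] are the same as analytic continuations of
    fourth roots; the converse is [continues_lift]. *)
Lemma lift_continues (g : singular R 1 Y) (k : simplex R 1 -> 'Z_4) : lift_on root_shift g setT k ->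
  continues_fourth_root q g (fun t => iscale (k t) (root_at (g t))).
Proof.
move=> lk t; split; first exact/local_fourth_root_iscale/root_atP.
have h := @cts_fun _ _ g t _ (root_shiftP (g t)).
have {}h : \forall u \near t, germ_eq (root_at (g t))
  (iscale (root_shift (g t) (g u)) (root_at (g u))) (set_val (g u)) by exact: h.
apply: filterS2 (lk t I) h => u ku gu; rewrite ku //.
by rewrite -iscaleA; apply: germ_eq_iscale; exact: germ_eq_sym.
Qed.

Lemma continues_lift (g : singular R 1 Y) (w : simplex R 1 -> section S) :
  continues_fourth_root q g w -> exists k, lift_on root_shift g setT k /\
    forall t, germ_eq (w t) (iscale (k t) (root_at (g t))) (set_val (g t)).
Proof.
move=> cw.
have ex t : exists a, germ_eq (w t) (iscale a (root_at (g t))) (set_val (g t)).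
  exact (root_index (punctured_regular _) (root_atP _) (proj1 (cw t))).
pose k t := sval (cid (ex t)).
have kP t : germ_eq (w t) (iscale (k t) (root_at (g t))) (set_val (g t)).
  by rewrite /k; case: cid.
exists k; split=> // t _; have [_ wt] := cw t.
have h1 : \forall u \near t, germ_eq (root_at (g t))
  (iscale (root_shift (g t) (g u)) (root_at (g u))) (set_val (g u)).
  exact (@cts_fun _ _ g t _ (root_shiftP (g t))).
have h2 : \forall u \near t, germ_eq (w t) (iscale (k t) (root_at (g t))) (set_val (g u)).
  exact (@cts_fun _ _ g t _ (near_punctured (germ_eq_near (kP t)))).
near=> u => _.
have a1 : germ_eq (w u) (w t) (set_val (g u)) by near: u; exact wt.
have a2 : germ_eq (w t) (iscale (k t) (root_at (g t))) (set_val (g u)) by near: u; exact h2.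
have a3 : germ_eq (root_at (g t))
  (iscale (root_shift (g t) (g u)) (root_at (g u))) (set_val (g u)) by near: u; exact h1.
apply: (root_index_unique (punctured_regular (g u)) (root_atP (g u)) (kP u)).
rewrite -iscaleA; apply: germ_eq_trans a1 _; apply: germ_eq_trans a2 _.
exact: germ_eq_iscale.
Unshelve. all: by end_near. Qed.

(** The germ at the end of a continuation is [i ^ (k 1 - k 0)] times the germ at its
    start. *)
Lemma rotational_holonomyP (rho : {additive homology1 R Y -> 'Z_4}) :
  rotational_holonomy q rho <->
  forall (g : singular R 1 Y) (g01 : g (vertex R 0) = g (vertex R 1)),
    rho (loop_class g01) = holonomy TP g.
Proof.
split=> rhoP g g01.
  have [k lk] := lift_simplex1 TP g.
  have := rhoP g g01 _ (lift_continues lk).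
  rewrite (holonomyE TP lk) -[X in germ_eq _ X]/(iscale _ (iscale _ _)) iscaleA -g01 => h.
  have := root_index_unique (punctured_regular _) (root_atP _) h (germ_eq_refl _ _).
  by move=> <-; rewrite addrK.
move=> w cw; have [k [lk kP]] := continues_lift cw.
rewrite -[X in germ_eq _ X]/(iscale _ _) (rhoP g g01) (holonomyE TP lk).
have h0 := germ_eq_iscale (k (vertex R 1) - k (vertex R 0)) (germ_eq_sym (kP (vertex R 0))).
apply: germ_eq_trans h0; rewrite iscaleA subrK.
by have := kP (vertex R 1); rewrite -g01.
Qed.

End RootSystem.

(** * Holonomy of powers *)

Lemma ipowMn (R : realType) (k : 'Z_4) (l : nat) : ipow R (k *+ l) = ipow R k ^+ l.
Proof. by elim: l => [|l IH]; rewrite ?mulr0n ?ipow0 // mulrS exprS ipowD IH. Qed.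

Lemma mulZ4P (R : realType) (e : nat) (k : 'Z_4) : (e %| 4)%N ->
  mulZ4 e k <-> ipow R k ^+ (4 %/ e) = 1.
Proof.
move=> e4; split=> [[l _ <-]|].
  by rewrite ipowMn -exprM mulnC divnK // ipow_exp4.
rewrite -exprM => /eqP; rewrite -(prim_order_dvd (imag_prim R)) => dk.
have e0 : (0 < e)%N := dvdn_gt0 (isT : (0 < 4)%N) e4.
have d0 : (0 < 4 %/ e)%N by rewrite divn_gt0 // (dvdn_leq _ e4).
have ek : (e %| k)%N by rewrite -(dvdn_pmul2r d0) mulnC divnK.
by exists (k %/ e)%:R => //; rewrite -mulrnA divnK // natr_Zp.
Qed.

Lemma mulZ4B (e : nat) (k l : 'Z_4) : mulZ4 e k -> mulZ4 e l -> mulZ4 e (k - l).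
Proof. by move=> [a _ <-] [b _ <-]; exists (a - b) => //; rewrite mulrnBl. Qed.

Lemma mulZ40 (e : nat) : mulZ4 e 0.
Proof. by exists 0 => //; rewrite mul0rn. Qed.

Section PowersHaveSmallHolonomy.
Variables (R : realType) (X : topologicalType) (S : compact_riemann_surface R X).
Variables (q : section S) (D : X -> int).
Hypotheses (merq : meromorphic_section 4 q) (divq : has_divisor q D).
Variables (n : nat) (c : 'I_n -> X).
Hypothesis Dreg : forall x, punctured c x -> \forall y \near x, D y = 0.
Variables (e : nat) (e4 : (e %| 4)%N).
Implicit Types (x : X) (i j : chart_index S) (w : section S).

Notation Y := (punctured c).
Notation TP := (root_shift_local_system merq divq Dreg).
Notation rt := (root_at merq divq Dreg).

Let e0 : (0 < e)%N := dvdn_gt0 (isT : (0 < 4)%N) e4.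

Lemma root_order (eta : section S) x i : meromorphic_section (4 %/ e) eta ->
  section_eq q (section_pow eta e) -> dom i x ->
  exists2 k, D x = k * e%:Z & order_at (local_expr eta i) (chart i x) k.
Proof.
move=> meta qeta ix; have [_ /(_ i ix) mi] := meta x.
apply: meromorphic_root_order e0 mi _ (divq ix).
have := near_param ix (near_dom ix).
by apply: filterS => z iz; rewrite /local_expr /= qeta.
Qed.

Section PowerGiven.
Variable eta : section S.
Hypotheses (meta : meromorphic_section (4 %/ e) eta).
Hypothesis qeta : section_eq q (section_pow eta e).

Lemma power_root_regular x i : D x = 0 -> dom i x ->
  {for chart i x, continuous (local_expr eta i)} /\ eta i x != 0.
Proof.
move=> Dx ix; have [k ke ok] := root_order meta qeta ix.
have k0 : k = 0.
  move: ke; rewrite Dx => /eqP; rewrite eq_sym mulf_eq0 => /orP[/eqP//|/eqP[e0']].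
  by move: e0; rewrite e0'.
move: ok; rewrite k0 => /order_at0[dk k1]; split.
  exact (derivable_continuous_at (nbhs_singleton dk)).
by move: k1; rewrite /local_expr /= chartK.
Qed.

(** Both the power of the local root and [eta] are [e]-th roots of [q] near [y]. *)
Lemma root_power_ratio (y : Y) : exists z : C R,
  germ_eq (section_pow (rt y) (4 %/ e)) (fun i x => z * eta i x) (set_val y).
Proof.
have [i iy] := dom_cover S (set_val y).
have [etac eta0] := power_root_regular (punctured_regular Dreg y) iy.
exists (section_pow (rt y) (4 %/ e) i (set_val y) / eta i (set_val y)).
have ry := root_atP merq divq Dreg y.
apply (@germ_fourth_ratio R X S (4 %/ e) (section_pow (rt y) (4 %/ e)) eta (set_val y) i iy); [| |  |exact etac|exact eta0|].
- apply: filterS ry => x [tx _]; by have := transforms_pow (4 %/ e) tx; rewrite mul1n.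
- by apply: (@filterE _ (nbhs (set_val y)) _) => x; have [] := meta x.
- exact (@continuousX_at (C R) (local_expr (rt y) i) (4 %/ e) _ (local_root_continuous ry iy)).
- near=> x; have ix : dom i x by near: x; exact: near_dom.
  have rx : local_fourth_root q (rt y) x by near: x; exact: local_fourth_root_near.
  rewrite /section_pow -exprM mulnC exprM (local_root_pow rx ix) qeta // /section_pow.
  by rewrite -exprM mulnC divnK.
Unshelve. all: by end_near. Qed.

(** The ratio between [w ^ (4 / e)] and [eta] is constant along a continuation [w];
    since a loop of rotation [k] multiplies [w] by [i ^ k], it follows that
    [i ^ (k * (4 / e))] is 1. *)
Lemma power_loop_holonomy (g : singular R 1 Y) : g (vertex R 0) = g (vertex R 1) ->
  mulZ4 e (holonomy TP g).
Proof.
move=> g01; have [k lk] := lift_simplex1 TP g; rewrite (holonomyE TP lk).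
(* [F] is the ratio between the power of the continued root and [eta]. *)
pose z y := sval (cid (root_power_ratio y)).
have zP y : germ_eq (section_pow (rt y) (4 %/ e)) (fun i x => z y * eta i x) (set_val y).
  by rewrite /z; case: cid.
pose F t := ipow R (k t) ^+ (4 %/ e) * z (g t).
have FP t : germ_eq (section_pow (iscale (k t) (rt (g t))) (4 %/ e))
    (fun i x => F t * eta i x) (set_val (g t)).
  by apply: filterS (zP (g t)) => x h i ix; rewrite /F -mulrA -h // /section_pow exprMn.
have Fc t u : [set: simplex R 1] t -> [set: simplex R 1] u -> F u = F t.
  apply: (connected_locally_constant (@connected_simplex1 R)) => {t u}t _.
  have [_ h1] := lift_continues lk t.
  have h2 := @cts_fun _ _ g t _ (near_punctured (germ_eq_near (FP t))).
  have {}h2 : \forall u \near t, germ_eq (section_pow (iscale (k t) (rt (g t))) (4 %/ e))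
    (fun i x => F t * eta i x) (set_val (g u)) by exact h2.
  apply: filterS2 h1 h2 => u ku ut _.
  have [i iu] := dom_cover S (set_val (g u)).
  have [_ eta0] := power_root_regular (punctured_regular Dreg (g u)) iu.
  apply: (mulIf eta0); rewrite -[LHS](germ_eq_at (FP u) iu) -[RHS](germ_eq_at ut iu).
  by rewrite /section_pow (germ_eq_at ku iu).
have := Fc (vertex R 0) (vertex R 1) I I; rewrite /F -g01.
have z0 : z (g (vertex R 0)) != 0.
  have [i iy] := dom_cover S (set_val (g (vertex R 0))).
  have := germ_eq_at (zP (g (vertex R 0))) iy.
  have r0 := local_root_neq0 divq (punctured_regular Dreg (g (vertex R 0)))
    (root_atP merq divq Dreg (g (vertex R 0))) iy.
  by move=> h; apply/eqP => z0; move: h; rewrite z0 mul0r => /eqP; rewrite expf_eq0 (negbTE r0) andbF.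
move=> /(mulIf z0) h; apply/(mulZ4P R _ e4).
apply: (mulIf (expf_neq0 (4 %/ e) (ipow_neq0 R (k (vertex R 0))))).
by rewrite mul1r -exprMn -ipowD subrK.
Qed.

End PowerGiven.

Lemma holonomy_range (rho : {additive homology1 R Y -> 'Z_4}) (eta : section S) :
  rotational_holonomy q rho -> meromorphic_section (4 %/ e) eta ->
  section_eq q (section_pow eta e) -> range rho `<=` mulZ4 e.
Proof.
move=> /(rotational_holonomyP merq divq Dreg) rhoE meta qeta _ [x _ <-].
have step (a b : homology1 R Y) : mulZ4 e (rho a) -> mulZ4 e (rho b) -> mulZ4 e (rho (a - b)).
  by move=> ha hb; rewrite raddfB; exact: mulZ4B.
have base : mulZ4 e (rho 0) by rewrite raddf0; exact: mulZ40.
refine (homology1_loop_ind (P := fun h => mulZ4 e (rho h)) base step _ x).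
by move=> g g01; rewrite rhoE; exact: power_loop_holonomy meta qeta g g01.
Qed.

End PowersHaveSmallHolonomy.

(** * Short paths and local potentials *)

Lemma nbhs_set_val (X : topologicalType) (A : set X) (y : A) (P : A -> Prop) :
  (\forall z \near y, P z) -> \forall x \near set_val y, forall z : A, set_val z = x -> P z.
Proof.
rewrite {1}/prop_near1 /= nbhsE => -[B [[U Uo UB] By] BP].
have Uy : U (set_val y) by move: By; rewrite -UB.
have : nbhs (set_val y) U by apply: open_nbhs_nbhs.
by apply: filterS => x Ux z zx; apply: BP; rewrite -UB /preimage /= zx.
Qed.

Section LocalPaths.
Variables (R : realType) (X : topologicalType) (S : compact_riemann_surface R X).
Variable A : set X.
Hypothesis Anear : forall x, A x -> \forall y \near x, A y.

(** Straight segments in a chart. *)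
Lemma locally_path_connected (y0 : A) (N : A -> Prop) : (\forall y \near y0, N y) ->
  \forall y \near y0, exists s : singular R 1 A,
    [/\ s (vertex R 0) = y0, s (vertex R 1) = y & forall t, N (s t)].
Proof.
move=> Ny; have [i iy] := dom_cover S (set_val y0).
pose a := chart i (set_val y0).
have /nearP_cnorm[r r0 rP] : \forall z \near a, [/\ A (param i z),
    (forall y : A, set_val y = param i z -> N y),
    dom i (param i z) & chart i (param i z) = z].
  have h1 := near_param iy (Anear (set_valP y0)).
  have h2 := near_param iy (nbhs_set_val Ny).
  by near=> z; have [iz cz] : dom i (param i z) /\ chart i (param i z) = z;
    [near: z; exact: near_codom|split=> //; near: z].
have h : \forall x \near set_val y0, dom i x /\ cnorm (chart i x - a) < r.
  have h1 := near_chart iy (near_cnorm a r0).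
  by apply: filterS2 (near_dom iy) h1 => x.
have {}h : \forall y \near y0, dom i (set_val y) /\ cnorm (chart i (set_val y) - a) < r.
  exact (@initial_continuous _ _ set_val y0 _ h).
apply: filterS h => y [iy' yr].
set b := chart i (set_val y) in yr.
pose g t := param i (on_segment a b t).
have rt t : 0 <= t <= 1 -> cnorm (on_segment a b t - a) < r.
  by move=> t01; apply: cnorm_segment => //; rewrite subrr /cnorm Normc.normc0.
have t01 (t : simplex R 1) : 0 <= set_val t 0 1 <= 1.
  by rewrite simplex_ge0 simplex_le1.
have gA (t : simplex R 1) : g (set_val t 0 1) \in A.
  by apply/mem_set; have [] := rP _ (rt _ (t01 t)).
pose f (t : simplex R 1) : A := SigSub (gA t).
have fE t : set_val (f t) = g (set_val t 0 1) by rewrite set_valE.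
have fc : continuous f.
  apply: continuous_comp_initial => t U Ut.
  have [_ _ iz cz] := rP _ (rt _ (t01 t)).
  have pc := param_continuous iz; rewrite cz in pc.
  have h1 := pc U Ut.
  exact (@coord_simplex_continuous R 1 1 t _ (near_segment_comp h1)).
exists (mkcts fc); split.
- apply: val_inj; rewrite -[LHS]/(set_val (f (vertex R 0))) fE vertex_coord /g on_segment0.
  by rewrite /a chartK // set_valE.
- apply: val_inj; rewrite -[LHS]/(set_val (f (vertex R 1))) fE vertex_coord eqxx /g on_segment1.
  by rewrite /b chartK // set_valE.
- by move=> t; have [_ hN _ _] := rP _ (rt _ (t01 t)); apply: hN; exact: fE.
Unshelve. all: by end_near. Qed.

(** A path from [y0] to [y] that stays where the cocycle relation at [y0] holds has
    holonomy [T y0 y]. *)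
Lemma potential_local (B : comNzRingType) (T : A -> A -> B) (TP : local_system T)
    (P : B -> Prop) (phi : A -> B) :
  (forall s : singular R 1 A,
    P (holonomy TP s + phi (s (vertex R 0)) - phi (s (vertex R 1)))) ->
  forall y0, \forall y \near y0, P (phi y0 + T y0 y - phi y).
Proof.
move=> Pphi y0; have := locally_path_connected (TP y0).
apply: filterS => y [s [s0 s1 sN]].
have lk : lift_on T s setT (fun t => T y0 (s t)).
  move=> t _.
  have h : \forall u \near t, T y0 (s u) = T y0 (s t) + T (s t) (s u).
    exact (@cts_fun _ _ s t _ (sN t)).
  by apply: filterS h.
have := Pphi s; rewrite (holonomyE TP lk) s0 s1 (local_system_self TP) subr0.
by rewrite [T y0 y + _]addrC.
Qed.

End LocalPaths.

(** * Construction of a global root *)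

Lemma ipow_root (R : realType) (e : nat) (b : C R) : (e %| 4)%N -> b ^+ e = 1 ->
  exists l, b = ipow R l ^+ (4 %/ e).
Proof.
move=> e4 be.
have [|l bl] := @ipow_surj R b.
  by rewrite -(divnK e4) mulnC exprM be expr1n.
have e0 : (0 < e)%N := dvdn_gt0 (isT : (0 < 4)%N) e4.
have d4 : (4 %/ e %| 4)%N by apply/dvdnP; exists e; rewrite mulnC divnK.
have d0 : (0 < 4 %/ e)%N by rewrite divn_gt0 // (dvdn_leq _ e4).
have dd : (4 %/ (4 %/ e) = e)%N by rewrite -{1}(divnK e4) mulKn.
have [_ h] := mulZ4P R l d4.
have [|l' _ ll'] := h; first by rewrite dd -bl.
by exists l'; rewrite bl -ll' ipowMn.
Qed.

Section RootConstruction.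
Variables (R : realType) (X : topologicalType) (S : compact_riemann_surface R X).
Variables (q : section S) (D : X -> int).
Hypotheses (merq : meromorphic_section 4 q) (divq : has_divisor q D).
Variables (n : nat) (c : 'I_n -> X).
Notation Y := (punctured c).
Hypothesis Yiso : forall x, \forall p \near x, p <> x -> Y p.
Hypothesis DY : forall x, Y x -> D x = 0.
Variables (e : nat) (e4 : (e %| 4)%N).
Implicit Types (x : X) (i j : chart_index S) (w : section S).

Lemma punctured_near x : Y x -> \forall p \near x, Y p.
Proof.
move=> Yx; apply: filterS (Yiso x) => p Yp.
by have [->//|/Yp] := pselect (p = x).
Qed.

Lemma divisor_near0 x : D x = 0 -> \forall p \near x, D p = 0.
Proof.
move=> Dx; apply: filterS (Yiso x) => p Yp.
by have [->//|/Yp/DY] := pselect (p = x).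
Qed.

Lemma punctured_divisor0 x : Y x -> \forall p \near x, D p = 0.
Proof. by move=> Yx; apply: divisor_near0; exact: DY. Qed.

Notation Dreg := punctured_divisor0.
Notation rt := (root_at merq divq Dreg).
Notation TP := (root_shift_local_system merq divq Dreg).

Let e0 : (0 < e)%N := dvdn_gt0 (isT : (0 < 4)%N) e4.
Let d := (4 %/ e)%N.
Let de : (d * e = 4)%N. Proof. by rewrite divnK. Qed.

Variable phi : Y -> 'Z_4.
Hypothesis phiP : forall s : singular R 1 Y,
  mulZ4 e (holonomy TP s + phi (s (vertex R 0)) - phi (s (vertex R 1))).

(** The roots readjusted by the potential: neighbouring ones differ by powers of [i] with
    exponent in [mulZ4 e], so that their [d]-th powers agree. *)
Definition adjusted_root (y : Y) : section S := iscale (phi y) (rt y).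

Lemma adjusted_rootP (y : Y) : local_fourth_root q (adjusted_root y) (set_val y).
Proof. exact/local_fourth_root_iscale/root_atP. Qed.

Lemma adjusted_root_power (y0 : Y) : \forall y \near y0,
  germ_eq (section_pow (adjusted_root y0) d) (section_pow (adjusted_root y) d) (set_val y).
Proof.
have h := potential_local S punctured_near phiP y0.
apply: filterS2 h (root_shiftP merq divq Dreg y0) => y hy g.
have g' : germ_eq (adjusted_root y0)
    (iscale (phi y0 + root_shift merq divq Dreg y0 y - phi y) (adjusted_root y)) (set_val y).
  rewrite /adjusted_root iscaleA subrK -iscaleA; exact: germ_eq_iscale.
apply: filterS g' => x xE i ix; rewrite /section_pow xE // /iscale exprMn.
by rewrite ((mulZ4P R _ e4).1 hy) mul1r.
Qed.

Definition punctured_power : section S := fun i x =>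
  match pselect (Y x) with
  | left Yx => section_pow (adjusted_root (SigSub (mem_set Yx))) d i x
  | right _ => 0
  end.

Lemma punctured_powerE (y : Y) i :
  punctured_power i (set_val y) = section_pow (adjusted_root y) d i (set_val y).
Proof.
rewrite /punctured_power; case: pselect => [Yx|]; last by case; exact: set_valP.
by congr (section_pow (adjusted_root _) _ _ _); apply: val_inj; rewrite /= set_valE.
Qed.

Definition extends_power x w := \forall p \near x, Y p -> forall i, dom i p ->
  punctured_power i p = section_pow w d i p.

Lemma punctured_powerP (y0 : Y) : extends_power (set_val y0) (adjusted_root y0).
Proof.
have := nbhs_set_val (adjusted_root_power y0).
apply: filterS => p h Yp i ip.
pose y : Y := SigSub (mem_set Yp).
have yp : set_val y = p by rewrite set_valE.
have g := h y yp; rewrite -yp in ip *.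
by rewrite punctured_powerE (germ_eq_at g ip).
Qed.

Lemma punctured_power_transforms x : Y x -> transforms d punctured_power x.
Proof.
move=> Yx; pose y : Y := SigSub (mem_set Yx).
have yx : set_val y = x by rewrite set_valE.
have [t1 _] := nbhs_singleton (adjusted_rootP y).
have td := transforms_pow d t1; rewrite mul1n in td.
by rewrite -yx => i j iy jy; rewrite !punctured_powerE; exact: td.
Qed.

Lemma punctured_power_pow x i : Y x -> dom i x -> punctured_power i x ^+ e = q i x.
Proof.
move=> Yx; pose y : Y := SigSub (mem_set Yx).
have yx : set_val y = x by rewrite set_valE.
rewrite -yx => iy; rewrite punctured_powerE /section_pow -exprM de.
exact: local_root_pow (adjusted_rootP y) iy.
Qed.

Lemma punctured_power_continuous x i : Y x -> dom i x ->
  {for chart i x, continuous (local_expr punctured_power i)}.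
Proof.
move=> Yx; pose y : Y := SigSub (mem_set Yx).
have yx : set_val y = x by rewrite set_valE.
rewrite -yx => iy.
have h := near_param iy (punctured_powerP y).
have hY := near_param iy (punctured_near (set_valP y)).
have cont := @continuousX_at (C R) (local_expr (adjusted_root y) i) d _
  (local_root_continuous (adjusted_rootP y) iy).
apply: near_continuous cont; near=> z.
have [iz _] : dom i (param i z) /\ chart i (param i z) = z by near: z; exact: near_codom.
have Yz : Y (param i z) by near: z.
have hz : Y (param i z) -> forall i0, dom i0 (param i z) ->
  punctured_power i0 (param i z) = section_pow (adjusted_root y) d i0 (param i z).
  by near: z.
by rewrite /local_expr /= hz.
Unshelve. all: by end_near. Qed.

Lemma punctured_power_puncture x i : dom i x -> exists (k : int) (h : C R -> C R),
  [/\ D x = k * e%:Z, \forall z \near chart i x, derivable h z 1, h (chart i x) != 0 &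
    \forall z \near chart i x, z != chart i x ->
      local_expr punctured_power i z = (z - chart i x) ^ k * h z].
Proof.
move=> ix; have [g [dg ga gq]] := divq ix.
apply: puncture_root e4 dg ga _.
have h := near_param ix (Yiso x).
near=> z => zx.
have [iz cz] : dom i (param i z) /\ chart i (param i z) = z by near: z; exact: near_codom.
have qz : local_expr q i z = (z - chart i x) ^ D x * g z by near: z.
have Yz : Y (param i z).
  have : param i z <> x -> Y (param i z) by near: z.
  by apply => pz; move: zx; rewrite -cz pz eqxx.
split; first by have := punctured_power_continuous Yz iz; rewrite cz.
by rewrite -qz; exact: punctured_power_pow.
Unshelve. all: by end_near. Qed.

Lemma local_root_pow_transforms w x : local_fourth_root q w x ->
  transforms d (section_pow w d) x.
Proof.
by move=> /nbhs_singleton[t1 _]; have := transforms_pow d t1; rewrite mul1n.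
Qed.

Lemma chart_neq i x p : dom i x -> dom i p -> p <> x -> chart i p != chart i x.
Proof.
by move=> ix ip px; apply/eqP => cpx; apply: px; rewrite -(chartK ip) cpx chartK.
Qed.

(** At a puncture where [q] has order 0, a holomorphic extension of [punctured_power] in
    one chart is a constant multiple of the [d]-th power of a local fourth root,
    and the constant, an [e]-th root of unity, is absorbed in the choice of that
    root. *)
Lemma punctured_power_extends x : D x = 0 ->
  exists w, local_fourth_root q w x /\ extends_power x w.
Proof.
move=> Dx; have [Yx|nYx] := pselect (Y x).
  pose y : Y := SigSub (mem_set Yx).
  have yx : set_val y = x by rewrite set_valE.
  by exists (adjusted_root y); rewrite -yx; split;
    [exact: adjusted_rootP|exact: punctured_powerP].
have [i ix] := dom_cover S x; set a := chart i x.
have [k [h [Dk dh ha fh]]] := punctured_power_puncture ix.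
have k0 : k = 0.
  move: Dk; rewrite Dx => /eqP; rewrite eq_sym mulf_eq0 => /orP[/eqP//|/eqP[e0']].
  by move: e0; rewrite e0'.
have [v vq] := exists_root4 (q i x).
have [w [wx _]] := local_root_exists merq divq (divisor_near0 Dx) ix vq.
have w0 := local_root_neq0 divq Dx wx ix.
have [dq _] := regular_expr divq ix Dx.
have qc := derivable_continuous_at (nbhs_singleton dq).
have hc := derivable_continuous_at (nbhs_singleton dh).
pose u := local_expr (section_pow w d) i.
have uc : {for a, continuous u}.
  exact (@continuousX_at (C R) (local_expr w i) d a (local_root_continuous wx ix)).
have ua : u a != 0 by rewrite /u /a /local_expr /= chartK // expf_neq0.
have uq : \forall z \near a, u z ^+ e = local_expr q i z.
  have h1 := near_param ix (local_fourth_root_near wx).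
  apply: filterS2 h1 (near_codom ix) => z wz [iz _].
  by rewrite /u /local_expr /= /section_pow -exprM de; exact: local_root_pow wz iz.
have fz : \forall z \near a, z != a -> local_expr punctured_power i z = h z /\
    h z ^+ e = local_expr q i z.
  have h1 := near_param ix (Yiso x).
  near=> z => za.
  have [iz cz] : dom i (param i z) /\ chart i (param i z) = z by near: z; exact: near_codom.
  have Yz : Y (param i z).
    have : param i z <> x -> Y (param i z) by near: z; exact h1.
    by apply => pz; move: za; rewrite -cz pz eqxx.
  have : z != chart i x -> local_expr punctured_power i z = (z - chart i x) ^ k * h z.
    by near: z; exact fh.
  move=> /(_ za); rewrite k0 expr0z mul1r => hz; split; first exact hz.
  by rewrite -hz; exact: punctured_power_pow.
have hqa : h a ^+ e = local_expr q i a.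
  apply: (continuous_dnbhs_eq (@continuousX_at (C R) h e a hc) qc).
  by apply: filterS fz => z hz /hz[].
have he : \forall z \near a, h z ^+ e = u z ^+ e.
  apply: filterS2 fz uq => z hz uz; rewrite uz.
  by have [->|/hz[]] := eqVneq z a.
have h4 : \forall z \near a, h z ^+ 4 = u z ^+ 4.
  by apply: filterS he => z hz; rewrite -de mulnC !exprM hz.
have hu := near_root_of_unity hc uc ua h4.
have [|l bl] := @ipow_root R e (h a / u a) e4.
  by rewrite expr_div_n (nbhs_singleton he) (divff (expf_neq0 e ua)).
exists (iscale l w); split; first exact: local_fourth_root_iscale.
have n1 := near_chart ix fz; have n2 := near_chart ix hu.
rewrite /extends_power; near=> p => Yp j jp.
have ip : dom i p by near: p; exact: near_dom.
have wp : local_fourth_root q w p by near: p; exact: local_fourth_root_near.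
have px : p <> x by move=> px; apply: nYx; rewrite -px.
have wp' := local_root_pow_transforms (local_fourth_root_iscale l wp).
rewrite (transformsE (punctured_power_transforms Yp) jp ip) (transformsE wp' jp ip).
congr (_ * _).
have f1 : chart i p != a -> local_expr punctured_power i (chart i p) = h (chart i p) /\
    h (chart i p) ^+ e = local_expr q i (chart i p) by near: p; exact n1.
have [+ _] := f1 (chart_neq ix ip px).
have -> : h (chart i p) = h a / u a * u (chart i p) by near: p; exact n2.
by rewrite bl /u /local_expr /= chartK // /section_pow exprMn.
Unshelve. all: by end_near. Qed.

Definition extension (x : X) : section S :=
  if pselect (D x = 0) is left Dx then sval (cid (punctured_power_extends Dx))
  else fun _ _ => 0.

Lemma extensionP x : D x = 0 ->
  local_fourth_root q (extension x) x /\ extends_power x (extension x).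
Proof. by rewrite /extension; case: pselect => // Dx _; case: cid. Qed.

(** At zeros and poles of [q] the value is 0, following the convention for
    meromorphic functions as total functions. *)
Definition global_root : section S := fun i x =>
  if D x == 0 then section_pow (extension x) d i x else 0.

Lemma global_rootE x i : Y x -> dom i x -> global_root i x = punctured_power i x.
Proof.
move=> Yx ix; have [_ /nbhs_singleton h] := extensionP (DY Yx).
by rewrite /global_root DY // eqxx h.
Qed.

Lemma global_root_near x : D x = 0 -> \forall p \near x, forall i, dom i p ->
  global_root i p = section_pow (extension x) d i p.
Proof.
move=> Dx; have [_ h] := extensionP Dx.
apply: filterS2 (Yiso x) h => p Yp hp i ip.
have [->|/Yp Yp'] := pselect (p = x); first by rewrite /global_root Dx eqxx.
by rewrite global_rootE // hp.
Qed.

Lemma global_root_pow : section_eq q (section_pow global_root e).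
Proof.
move=> i x ix; rewrite /section_pow /global_root; case: eqP => [Dx|/eqP Dx].
  have [rx _] := extensionP Dx.
  by rewrite /section_pow -exprM de (local_root_pow rx ix).
have [g [_ _ /nbhs_singleton]] := divq ix.
rewrite /local_expr /= chartK // subrr => ->.
by rewrite exp0rz (negbTE Dx) mul0r expr0n eqn0Ngt e0.
Qed.

Lemma global_root_meromorphic : meromorphic_section d global_root.
Proof.
move=> x; split.
  move=> i j ix jx; rewrite /global_root; case: eqP => [Dx|_]; last by rewrite mul0r.
  by have [rx _] := extensionP Dx; exact: (local_root_pow_transforms rx).
move=> i ix; right; have [Dx|Dx] := pselect (D x = 0).
  exists 0; have [rx _] := extensionP Dx.
  have rx0 := local_root_neq0 divq Dx rx ix.
  have drx : \forall z \near chart i x,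
      derivable (local_expr (section_pow (extension x) d) i) z 1.
    apply: filterS2 (near_param ix rx) (near_codom ix) => z [_ rz] [iz cz].
    have [dz _] := rz i iz; rewrite cz in dz.
    exact (@derivableX_at (C R) (local_expr (extension x) i) d z dz).
  have nz : local_expr (section_pow (extension x) d) i (chart i x) != 0.
    by rewrite /local_expr /= chartK // expf_neq0.
  apply: near_order_at (order_at0I drx nz).
  apply: filterS2 (near_param ix (global_root_near Dx)) (near_codom ix) => z hz [iz _].
  by rewrite /local_expr /= hz.
have [k [h [Dk dh ha fh]]] := punctured_power_puncture ix.
have k0 : k != 0 by apply/eqP => k0; apply: Dx; rewrite Dk k0 mul0r.
exists k, h; split; [exact dh|exact ha|].
have h1 := near_param ix (Yiso x).
near=> z; have [iz cz] : dom i (param i z) /\ chart i (param i z) = z.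
  by near: z; exact: near_codom.
have [->|za] := eqVneq z (chart i x).
  rewrite subrr exp0rz (negbTE k0) mul0r /local_expr /= chartK // /global_root.
  by case: eqP.
have Yz : Y (param i z).
  have : param i z <> x -> Y (param i z) by near: z; exact h1.
  by apply => pz; move: za; rewrite -cz pz eqxx.
have fz : z != chart i x -> local_expr punctured_power i z = (z - chart i x) ^ k * h z.
  by near: z; exact fh.
by rewrite -(fz za) /local_expr /= global_rootE.
Unshelve. all: by end_near. Qed.

End RootConstruction.

(** * Divisors and proportional sections *)

Section PointDivisors.
Variables (X : topologicalType) (n : nat) (c : 'I_n -> X).

Lemma punctured_isolated : hausdorff_space X ->
  forall x, \forall p \near x, p <> x -> punctured c p.
Proof.
move=> hX x; have xF := nbhs_filter x.
have h : \forall p \near x, forall k, p <> x -> p <> c k.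
  apply: (@filter_forall _ _ (fun k p => p <> x -> p <> c k) _ xF) => k.
  have [<-|kx] := pselect (c k = x); first by apply: (@filterE _ (nbhs (c k)) _).
  have : nbhs x (~` [set c k]).
    apply: open_nbhs_nbhs; split; last by move=> /= xk; apply: kx.
    apply: closed_openC; apply: accessible_closed_set1; exact: hausdorff_accessible.
  by apply: filterS => p /= pk _.
by apply: filterS h => p hp px [k _ kp]; exact: hp px (esym kp).
Qed.

Lemma point_divisor_punctured (m : 'I_n -> int) x : punctured c x ->
  point_divisor c m x = 0.
Proof.
move=> cx; rewrite /point_divisor big1 // => k /eqP kx.
by exfalso; apply: cx; exists k.
Qed.

Lemma point_divisor_pole (m : 'I_n -> int) k : injective c ->
  point_divisor c m (c k) = m k.
Proof.
move=> c_inj; rewrite /point_divisor (bigD1 k) //= big1 ?addr0 // => l /andP[/eqP lk].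
by rewrite (c_inj _ _ lk) eqxx.
Qed.

Lemma point_divisor_div (m : 'I_n -> int) (d : nat) x : (forall k, (d%:Z %| m k)%Z) ->
  point_divisor c (fun k => (m k %/ d%:Z)%Z) x * d%:Z = point_divisor c m x.
Proof.
by move=> dm; rewrite /point_divisor mulr_suml; apply: eq_bigr => k _; rewrite divzK.
Qed.

End PointDivisors.

(** An odd multiple of [d] generates [mulZ4 d], so a subgroup without such an element
    consists of even multiples. *)
Lemma subgroupZ4 (H : set 'Z_4) (d : nat) : d \in [:: 1; 2; 4]%N -> H 0 ->
  (forall a b, H a -> H b -> H (a - b)) -> H `<=` mulZ4 d ->
  H = mulZ4 d \/ (d * 2 %| 4)%N /\ H `<=` mulZ4 (d * 2).
Proof.
move=> d124 H0 HB Hd.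
have HN a : H a -> H (- a) by move=> Ha; rewrite -sub0r; exact: HB.
have HM a l : H a -> H (a *+ l).
  move=> Ha; elim: l => [|l IH]; first by rewrite mulr0n.
  have -> : a *+ l.+1 = a *+ l - (- a) by rewrite opprK mulrSr.
  by apply: HB => //; exact: HN.
have [H1|H1] := pselect (H (1 *+ d)).
  left; apply/seteqP; split=> // _ [l _ <-].
  by rewrite -[l]natr_Zp -mulrnA mulnC mulrnA; exact: HM.
right; have d2 : (d * 2 %| 4)%N.
  move: d124 H1; rewrite !inE => /or3P[]/eqP-> // H1; exfalso; apply: H1.
  by rewrite [_ *+ 4](_ : _ = 0) //; exact: val_inj.
split=> // h Hh; have [l _ lh] := Hd h Hh; subst h.
have [l1|[l3|[l' ->]]] : l = 1 \/ l = - 1 \/ exists l', l = l' *+ 2.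
  case: l {Hh} => -[|[|[|[|]]]] // l4.
  - by right; right; exists 0; exact: val_inj.
  - by left; exact: val_inj.
  - by right; right; exists 1; exact: val_inj.
  - by right; left; exact: val_inj.
- by exfalso; apply: H1; rewrite -l1.
- by exfalso; apply: H1; rewrite -[1]opprK mulNrn; apply: HN; rewrite -l3.
- by exists l' => //; rewrite mulnC mulrnA.
Qed.

Section GlobalRatio.
Variables (R : realType) (X : topologicalType) (S : compact_riemann_surface R X).
Implicit Types (x : X) (i j : chart_index S) (s : section S).

(** After division by [(z - a) ^ k] both functions are continuous and nonzero at [a]. *)
Lemma order_ratio (f g : C R -> C R) a k : order_at f a k -> order_at g a k ->
  (\forall z \near a, f z ^+ 4 = g z ^+ 4) ->
  exists b, b ^+ 4 = 1 /\ \forall z \near a, f z = b * g z.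
Proof.
move=> [u [du ua fu]] [v [dv va gv]] fg.
have uc := derivable_continuous_at (nbhs_singleton du).
have vc := derivable_continuous_at (nbhs_singleton dv).
have uv : \forall z \near a, z != a -> u z ^+ 4 = v z ^+ 4.
  near=> z => za; have zk : (z - a) ^ k != 0 by rewrite expfz_neq0 // subr_eq0.
  apply: (mulfI (expf_neq0 4 zk)); rewrite -!exprMn.
  have <- : f z = (z - a) ^ k * u z by near: z; exact fu.
  have <- : g z = (z - a) ^ k * v z by near: z; exact gv.
  by near: z; exact fg.
have uva := continuous_dnbhs_eq (@continuousX_at (C R) u 4 a uc)
  (@continuousX_at (C R) v 4 a vc) uv.
have uv4 : \forall z \near a, u z ^+ 4 = v z ^+ 4.
  by apply: filterS uv => z; have [->|_ /(_ isT)] := eqVneq z a.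
exists (u a / v a); split.
  by rewrite expr_div_n uva (divff (expf_neq0 4 va)).
have h := near_root_of_unity uc vc va uv4.
near=> z.
have -> : f z = (z - a) ^ k * u z by near: z; exact fu.
have -> : g z = (z - a) ^ k * v z by near: z; exact gv.
have -> : u z = u a / v a * v z by near: z; exact h.
by rewrite mulrCA.
Unshelve. all: by end_near. Qed.

Lemma order_nonzero_near s (D : X -> int) x i (P : X -> Prop) : has_divisor s D -> dom i x ->
  (\forall p \near x, P p) -> exists p, [/\ P p, dom i p & s i p != 0].
Proof.
move=> divs ix Px.
have /nearP_cnorm[r r0 rP] : \forall z \near chart i x, [/\ P (param i z), dom i (param i z) &
    z != chart i x -> s i (param i z) != 0].
  near=> z; have [iz _] : dom i (param i z) /\ chart i (param i z) = z.
    by near: z; exact: near_codom.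
  split; [near: z; exact (near_param ix Px)|exact iz|].
  near: z; exact (order_at_near_neq0 (divs x i ix)).
have [z za zr] := punctured_disc_neq0 (chart i x) r0.
have [Pz iz sz] := rP z zr.
by exists (param i z); split => //; exact: sz.
Unshelve. all: by end_near. Qed.

Lemma meromorphic_scale k s (b : C R) : b != 0 -> meromorphic_section k s ->
  meromorphic_section k (fun i x => b * s i x).
Proof.
move=> b0 ms x; have [ts os] := ms x; split; first exact: transforms_scale.
move=> i ix; case: (os i ix) => [s0|[l [g [dg ga sg]]]]; [left|right].
  by apply: filterS s0 => z; rewrite /local_expr /= => ->; rewrite mulr0.
exists l, (fun z => b * g z); split.
- apply: filterS dg => z dz; exact (derivableM_at (@derivable_cst_at (C R) b z) dz).
- by rewrite mulf_neq0.
- by apply: filterS sg => z; rewrite /local_expr /= => ->; rewrite mulrCA.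
Qed.

(** The quotient is locally constant, also across zeros and poles, and the surface
    is connected. *)
Lemma proportional k s t (D : X -> int) : (forall x, transforms k s x) ->
  (forall x, transforms k t x) -> has_divisor s D -> has_divisor t D ->
  (forall i x, dom i x -> s i x ^+ 4 = t i x ^+ 4) ->
  exists b, b ^+ 4 = 1 /\ forall i x, dom i x -> s i x = b * t i x.
Proof.
move=> ts tt ds dt st4.
have ex x : exists b, b ^+ 4 = 1 /\ germ_eq s (fun i y => b * t i y) x.
  have [i ix] := dom_cover S x.
  have h4 : \forall z \near chart i x, local_expr s i z ^+ 4 = local_expr t i z ^+ 4.
    by apply: filterS (near_codom ix) => z [iz _]; exact: st4.
  have [b [b4 hb]] := order_ratio (ds x i ix) (dt x i ix) h4.
  exists b; split=> //; apply: (@germ_ratio _ _ S k _ _ _ i) => //.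
  - by apply: (@filterE _ (nbhs x) _).
  - by apply: (@filterE _ (nbhs x) _).
  - apply: filterS2 (near_chart ix hb) (near_dom ix) => y + iy.
    by rewrite /local_expr /= chartK.
pose b x := sval (cid (ex x)).
have bP x : b x ^+ 4 = 1 /\ germ_eq s (fun i y => b x * t i y) x by rewrite /b; case: cid.
have bc x y : [set: X] x -> [set: X] y -> b y = b x.
  apply: (connected_locally_constant (surface_connected S)) => {x y}x _.
  have [_ /germ_eq_near hx] := bP x; apply: filterS hx => p hp _.
  have [_ hp'] := bP p; have [i ip] := dom_cover S p.
  have [y [hy iy ty]] := order_nonzero_near dt ip (filterI hp hp').
  apply: (mulIf ty); have [h1 h2] := hy.
  by rewrite -(h1 i iy) -(h2 i iy).
have [x0 _] := surface_nonempty S.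
exists (b x0); split=> [|i x ix]; first by have [] := bP x0.
have [_ hx] := bP x; rewrite (germ_eq_at hx ix).
by congr (_ * _); exact: bc.
Qed.

End GlobalRatio.

(** * Roots, holonomy and primitivity *)

Section Powers.
Variables (R : realType) (X : topologicalType) (S : compact_riemann_surface R X).
Variables (n : nat) (c : 'I_n -> X) (m : 'I_n -> int).
Hypothesis c_inj : injective c.
Implicit Types (x : X) (i j : chart_index S) (q eta : section S).

Notation D := (point_divisor c m).
Notation Y := (punctured c).

Lemma punctured_isolated_surface x : \forall p \near x, p <> x -> Y p.
Proof. exact: (@punctured_isolated X n c (surface_hausdorff S)). Qed.

Lemma divisor_punctured x : Y x -> D x = 0.
Proof. exact: point_divisor_punctured. Qed.

Section Given.
Variables (q : section S) (merq : meromorphic_section 4 q) (divq : has_divisor q D).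

Notation Dreg := (punctured_divisor0 punctured_isolated_surface divisor_punctured).

Theorem power_iff_holonomy (rho : {additive homology1 R Y -> 'Z_4}) (e : nat) :
  (e %| 4)%N -> rotational_holonomy q rho ->
  (exists eta, meromorphic_section (4 %/ e) eta /\ section_eq q (section_pow eta e))
  <-> range rho `<=` mulZ4 e.
Proof.
move=> e4 rhoq; split=> [[eta [meta qeta]]|rhoe].
  exact (holonomy_range merq divq Dreg e4 rhoq meta qeta).
have rhoE := (rotational_holonomyP merq divq Dreg rho).1 rhoq.
have [phi phiP] := monodromy_potential rhoE rhoe.
exists (global_root e4 phiP); split.
  exact: global_root_meromorphic.
exact: global_root_pow.
Qed.

Theorem holonomy_exists : exists rho : {additive homology1 R Y -> 'Z_4},
  rotational_holonomy q rho.
Proof.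
have [rho rhoE] := monodromy_exists R (root_shift_local_system merq divq Dreg).
by exists rho; apply/(rotational_holonomyP merq divq Dreg).
Qed.

Lemma differential_of_power (k d : nat) eta : (0 < d)%N -> section_eq q (section_pow eta d) ->
  meromorphic_section k eta -> differential k eta.
Proof.
move=> d0 qeta meta; split=> //; have [x _] := surface_nonempty S.
have [i ix] := dom_cover S x.
have [p [_ ip qp]] := order_nonzero_near divq ix (@filterT _ (nbhs x) _).
by exists i, p; split=> //; move: qp; rewrite qeta // expf_eq0 d0.
Qed.

(** If [eta] were an [e]-th power, then [q] would be a power of exponent [d * e], and the
    image of [rho] would be contained in [mulZ4 (d * e)], which does not
    contain [d]. *)
Lemma primitive_of_holonomy (rho : {additive homology1 R Y -> 'Z_4}) (d : nat) eta :
  (d %| 4)%N -> rotational_holonomy q rho -> range rho = mulZ4 d ->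
  section_eq q (section_pow eta d) -> primitive (4 %/ d) eta.
Proof.
move=> d4 rhoq rhod qeta e e1 ed [t [[mt _] etat]].
have d0 : (0 < d)%N := dvdn_gt0 (isT : (0 < 4)%N) d4.
have dd : (d * (4 %/ d) = 4)%N by rewrite mulnC divnK.
have de4 : (d * e %| 4)%N by rewrite -[X in (_ %| X)%N]dd dvdn_mul.
have h : range rho `<=` mulZ4 (d * e).
  apply/(power_iff_holonomy de4 rhoq); exists t; split; first by rewrite -divnMA in mt.
  by move=> i x ix; rewrite qeta // /section_pow etat // -exprM mulnC.
have := h (1 *+ d); rewrite rhod => /(_ _)/(mulZ4P R _ de4).
have h1 : mulZ4 d (1 *+ d) by exists 1.
move=> /(_ h1) /eqP; rewrite ipowMn -!exprM -(prim_order_dvd (imag_prim R)).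
rewrite mul1n => /dvdn_leq.
have : (d * (4 %/ (d * e)) * e = 4)%N by rewrite -mulnA [(_ * e)%N]mulnC mulnA mulnC divnK.
case: (d * _)%N => // l le /(_ isT) l4.
have : (4 * 2 <= l.+1 * e)%N by exact: leq_mul.
by rewrite le.
Qed.

End Given.

End Powers.

Theorem lemma2p6 (R : realType) (X : topologicalType)
    (S : compact_riemann_surface R X) (n : nat) (c : 'I_n -> X) (m : 'I_n -> int)
    (c_inj : injective c) (m_gt : forall i, - 4 < m i) :
  (forall (q : section S) (rho : {additive homology1 R (punctured c) -> 'Z_4}),
     meromorphic_section 4 q -> has_divisor q (point_divisor c m) ->
     rotational_holonomy q rho ->
     (forall e : nat, (0 < e)%N -> (e %| 4)%N ->
        (exists eta : section S, meromorphic_section (4 %/ e) eta /\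
           section_eq q (section_pow eta e))
        <-> range rho `<=` mulZ4 e)
     /\ (forall d : nat, d \in [:: 1; 2; 4]%N -> range rho = mulZ4 d ->
        (forall i, d%:Z %| m i)%Z /\
        exists eta : section S,
          [/\ differential (4 %/ d) eta, primitive (4 %/ d) eta,
              has_divisor eta (point_divisor c (fun i => (m i %/ d%:Z)%Z)) &
              section_eq q (section_pow eta d)]))
  /\ (forall (d : nat) (eta : section S),
       d \in [:: 1; 2; 4]%N -> (forall i, d%:Z %| m i)%Z ->
       differential (4 %/ d) eta -> primitive (4 %/ d) eta ->
       has_divisor eta (point_divisor c (fun i => (m i %/ d%:Z)%Z)) ->
       (exists rho : {additive homology1 R (punctured c) -> 'Z_4},
          rotational_holonomy (section_pow eta d) rho) /\
       (forall rho : {additive homology1 R (punctured c) -> 'Z_4},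
          rotational_holonomy (section_pow eta d) rho -> range rho = mulZ4 d)).
Proof.
have dvd4 d : d \in [:: 1; 2; 4]%N -> (d %| 4)%N by rewrite !inE => /or3P[]/eqP->.
split=> [q rho merq divq rhoq|d eta d124 dm [meta nzeta] prim deta].
  split=> [e _ e4|d /dvd4 d4 rhod]; first exact: (power_iff_holonomy merq divq e4 rhoq).
  have d0 : (0 < d)%N := dvdn_gt0 (isT : (0 < 4)%N) d4.
  have [_ h] := power_iff_holonomy merq divq d4 rhoq.
  have [eta [meta qeta]] : exists eta, meromorphic_section (4 %/ d) eta /\
      section_eq q (section_pow eta d) by apply: h; rewrite rhod.
  have ord x i : dom i x -> exists2 k, point_divisor c m x = k * d%:Z &
      order_at (local_expr eta i) (chart i x) k.
    exact: root_order divq d d4 eta x i meta qeta.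
  have dm k : (d%:Z %| m k)%Z.
    have [i ik] := dom_cover S (c k); have [l lk _] := ord _ _ ik.
    by rewrite -(point_divisor_pole m k c_inj) lk dvdz_mull.
  split=> //; exists eta; split=> //.
  - exact: differential_of_power divq _ _ _ d0 qeta meta.
  - exact: primitive_of_holonomy merq divq rho d eta d4 rhoq rhod qeta.
  - move=> x i ix; have [k xk ok] := ord x i ix.
    have dz : d%:Z != 0 by rewrite -lt0n in d0 *.
    by have := point_divisor_div c x dm; rewrite xk => /(mulIf dz) ->.
have d4 := dvd4 d d124; have d0 : (0 < d)%N := dvdn_gt0 (isT : (0 < 4)%N) d4.
set q := section_pow eta d.
have tq x : transforms 4 q x.
  by have := transforms_pow d (meta x).1; rewrite divnK.
have divq : has_divisor q (point_divisor c m).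
  move=> x i ix; rewrite -(point_divisor_div c x dm).
  exact: order_at_pow (deta x i ix).
have merq : meromorphic_section 4 q.
  move=> x; split=> // i ix; right; exists (point_divisor c m x); exact: divq.
split=> [|rho rhoq]; first exact: holonomy_exists merq divq.
have rd : range rho `<=` mulZ4 d.
  by apply/(power_iff_holonomy merq divq d4 rhoq); exists eta.
have r0 : range rho 0 by exists 0 => //; exact: raddf0.
have rB (a b : 'Z_4) : range rho a -> range rho b -> range rho (a - b).
  by move=> [u _ <-] [v _ <-]; exists (u - v) => //; exact: raddfB.
have [//|[d2 rd2]] := subgroupZ4 d124 r0 rB rd; exfalso.
(* A smaller image gives [q] a root [t] of exponent [d * 2]; then [eta] is a
   constant multiple of the square of [t], hence itself a square. *)
have [_ h] := power_iff_holonomy merq divq d2 rhoq.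
have [t [mt qt]] := h rd2.
have dd : (4 %/ (d * 2) * 2 = 4 %/ d)%N.
  by clear -d2 d124; move: d2; move: d124; rewrite !inE => /or3P[]/eqP->.
have t2 x : transforms (4 %/ d) (section_pow t 2) x.
  by have := transforms_pow 2 (mt x).1; rewrite dd.
have dt2 : has_divisor (section_pow t 2) (point_divisor c (fun i => (m i %/ d%:Z)%Z)).
  move=> x i ix; have [k xk ok] := root_order divq d2 mt qt ix.
  have dz : d%:Z != 0 by rewrite -lt0n in d0 *.
  have -> : point_divisor c (fun i => (m i %/ d%:Z)%Z) x = k * 2%:Z.
    apply: (mulIf dz); rewrite (point_divisor_div c x dm) xk -mulrA; congr (_ * _).
    by rewrite mulrC -PoszM mulnC.
  exact: order_at_pow 2 ok.
have [|b [b4 etab]] := proportional (fun x => (meta x).1) t2 deta dt2.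
  move=> i x ix; have := qt i x ix.
  rewrite /q /section_pow mulnC exprM => /(congr1 (fun z => z ^+ (4 %/ d))).
  by rewrite -!exprM mulnC divnK.
have b0 : b != 0.
  by apply/eqP => b0; move: b4; rewrite b0 expr0n /= => /eqP; rewrite eq_sym oner_eq0.
have s0 : sqrtC b != 0 by rewrite sqrtC_eq0.
have etas : section_eq eta (section_pow (fun i x => sqrtC b * t i x) 2).
  by move=> i x ix; rewrite /section_pow exprMn sqrtCK etab.
have d2' : (2 %| 4 %/ d)%N by rewrite -dd dvdn_mull.
apply: (prim 2%N isT d2'); exists (fun i x => sqrtC b * t i x); split=> //.
have mst := meromorphic_scale s0 mt; rewrite divnMA in mst; split=> //.
have [i [x [ix etax]]] := nzeta; exists i, x; split=> //.
by move: etax; rewrite etas // expf_eq0.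
Qed.
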